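(* Let $k$ be an algebraically closed field, let $m\ge 1$ and $n>1$ be integers such that $m$ divides $n$, and let $\Lambda=N_m^n$ be the Nakayama algebra. Then $\Omega^3(\Lambda)$, the third syzygy of $\Lambda$ as a $\Lambda$-bimodule, is not stably isomorphic to an invertible $\Lambda$-bimodule; hence the category $\mathrm{proj}(\Lambda)$ of finitely generated projective right $\Lambda$-modules can be endowed neither with a triangulated category structure nor with an enhanced triangulated structure.
   Context: The Nakayama algebra $N_m^n$ is the quotient of the path algebra over $k$ of the oriented cycle with $m$ vertices $1,\dots,m$ and $m$ arrows $\alpha_i\colon i\to i+1$ (indices modulo $m$) by the two-sided ideal generated by the paths of length $n+1$. It is a basic Frobenius algebra. Stable isomorphism means isomorphism in the stable category of $\Lambda$-bimodules, the quotient of the category of $\Lambda$-bimodules by the maps factoring through a projective (equivalently injective) bimodule. A bimodule $I$ is invertible if there is a bimodule $J$ with $I\otimes_\Lambda J\cong\Lambda\cong J\otimes_\Lambda I$. Triangulated structures are $k$-linear. An enhanced triangulated structure on $\mathscr T$ is a DG-category $\mathscr A$ over $k$ with a $k$-linear equivalence $D^c(\mathscr A)\simeq\mathscr T$, where $D^c(\mathscr A)$ is the category of compact objects in the derived category of $\mathscr A$. *)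

(* Defs.v *)
From Stdlib Require List.
From HB Require Import structures.
From mathcomp Require Import all_boot all_algebra.

Set Implicit Arguments.
Unset Strict Implicit.
Unset Printing Implicit Defensive.

Import GRing.Theory.
Local Open Scope ring_scope.

Definition surj (A B : Type) (f : A -> B) : Prop := forall y, exists x, f x = y.

(* The vertices of the oriented cycle are 0, ..., m-1, with one arrow
   i -> ordS i for each i.  A path is determined by its source i and its
   length l, and its target is [walk l i]. *)
Definition walk (m l : nat) (i : 'I_m) : 'I_m := iter l (@ordS m) i.

(* The path algebra of the cycle: an element f is a finite linear combination
   of paths, the path of source i and length l having coefficient (f i)`_l. *)
Definition cycle_path_algebra (k : fieldType) (m : nat) : Type :=
  {ffun 'I_m -> {poly k}}.

Section CyclePathAlgebra.
Variables (k : fieldType) (m : nat).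
Local Notation kQ := (cycle_path_algebra k m).
Implicit Types (f g h : kQ) (p : {poly k}).

HB.instance Definition _ := GRing.Lmodule.copy kQ {ffun 'I_m -> {poly k}}.

Definition arrow_path (l : nat) (i : 'I_m) : kQ :=
  [ffun j => if j == i then 'X^l else 0].

Definition path_algebra_one : kQ := [ffun => 1].

(* Concatenation: the path of source i and length l followed by the path of
   source j and length l' is zero unless j = walk l i, and then it is the path
   of source i and length l + l'. *)
Definition concat_from (g : kQ) (i : 'I_m) (p : {poly k}) : {poly k} :=
  \sum_(l < size p) p`_l *: ('X^l * g (walk l i)).

Definition path_algebra_mul (f g : kQ) : kQ :=
  [ffun i => concat_from g i (f i)].

Lemma concat_from_widen g i p N : (size p <= N)%N ->
  concat_from g i p = \sum_(l < N) p`_l *: ('X^l * g (walk l i)).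
Proof.
move=> leN; pose F l := p`_l *: ('X^l * g (walk l i)).
rewrite /concat_from (big_ord_widen N F leN) big_mkcond /=; apply: eq_bigr => l _.
by case: ltnP => // le_l; rewrite nth_default // scale0r.
Qed.

Lemma concat_from_linear g i : linear (concat_from g i).
Proof.
move=> a p q; set N := maxn (size (a *: p + q)) (maxn (size p) (size q)).
rewrite (@concat_from_widen g i _ N) ?leq_maxl //.
rewrite (@concat_from_widen g i p N) ?leq_max ?leqnn ?orbT //.
rewrite (@concat_from_widen g i q N) ?leq_max ?leqnn ?orbT //.
rewrite scaler_sumr -big_split; apply: eq_bigr => l _ /=.
by rewrite coefD coefZ scalerDl scalerA.
Qed.

HB.instance Definition _ g i :=
  GRing.isLinear.Build k {poly k} {poly k} *:%R (concat_from g i)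
    (concat_from_linear g i).

Lemma concat_from1 g i : concat_from g i 1 = g i.
Proof. by rewrite /concat_from size_poly1 big_ord1 coef1 scale1r expr0 mul1r. Qed.

Lemma concat_fromXn g i l : concat_from g i 'X^l = 'X^l * g (walk l i).
Proof.
rewrite /concat_from size_polyXn (bigD1 ord_max) //= coefXn eqxx scale1r.
rewrite big1 ?addr0 // => j /negPf nj.
by have := nj; rewrite -val_eqE /= coefXn => ->; rewrite scale0r.
Qed.

Lemma concat_fromMXn g i l p :
  concat_from g i ('X^l * p) = 'X^l * concat_from g (walk l i) p.
Proof.
rewrite -[p in LHS]coefK poly_def mulr_sumr linear_sum /concat_from mulr_sumr.
apply: eq_bigr => j _; rewrite -scalerAr linearZ /= -exprD concat_fromXn.
by rewrite -scalerAr mulrA -exprD /walk (addnC l) iterD.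
Qed.

Lemma path_algebra_mulA : associative path_algebra_mul.
Proof.
move=> f g h; apply/ffunP=> i; rewrite !ffunE [concat_from g i (f i)]/concat_from.
by rewrite linear_sum; apply: eq_bigr => l _; rewrite linearZ /= concat_fromMXn ffunE.
Qed.

Lemma path_algebra_mul1l : left_id path_algebra_one path_algebra_mul.
Proof. by move=> f; apply/ffunP=> i; rewrite !ffunE concat_from1. Qed.

Lemma path_algebra_mul1r : right_id path_algebra_one path_algebra_mul.
Proof.
move=> f; apply/ffunP=> i; rewrite ffunE -[RHS]coefK poly_def.
by apply: eq_bigr => l _; rewrite ffunE mulr1.
Qed.

Lemma path_algebra_mulDl : left_distributive path_algebra_mul +%R.
Proof. by move=> f g h; apply/ffunP=> i; rewrite !ffunE linearD. Qed.

Lemma path_algebra_mulDr : right_distributive path_algebra_mul +%R.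
Proof.
move=> f g h; apply/ffunP=> i; rewrite !ffunE -big_split.
by apply: eq_bigr => l _; rewrite ffunE mulrDr scalerDr.
Qed.

HB.instance Definition _ := GRing.Zmodule_isPzRing.Build kQ
  path_algebra_mulA path_algebra_mul1l path_algebra_mul1r
  path_algebra_mulDl path_algebra_mulDr.

End CyclePathAlgebra.

Definition ideal_generated (R : pzRingType) (S : R -> Prop) (x : R) : Prop :=
  exists r : seq (R * R * R),
    (forall t, t \in r -> S t.1.2) /\ x = \sum_(t <- r) t.1.1 * t.1.2 * t.2.

(* L is the quotient of the path algebra by the two-sided ideal generated by the
   paths of length n + 1; this determines L up to isomorphism of k-algebras. *)
Definition is_nakayama (k : fieldType) (m n : nat) (L : algType k) : Prop :=
  exists pi : {rmorphism cycle_path_algebra k m -> L},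
    [/\ scalable pi, surj pi
      & forall x, pi x = 0 <->
          ideal_generated (fun p => exists i, p = arrow_path k n.+1 i) x].

Section Bimodules.
Variables (k : fieldType) (L : algType k).

(* k acts centrally, i.e. these are the modules over the enveloping algebra. *)
Record bimodule := Bimodule {
  bcar :> lmodType k;
  blact : L -> bcar -> bcar;
  bract : bcar -> L -> bcar;
  blact_linear_l : forall x, linear (blact^~ x);
  blact_linear_r : forall a, linear (blact a);
  bract_linear_l : forall a, linear (bract^~ a);
  bract_linear_r : forall x, linear (bract x);
  blact1 : forall x, blact 1 x = x;
  bract1 : forall x, bract x 1 = x;
  blactM : forall a b x, blact (a * b) x = blact a (blact b x);
  bractM : forall a b x, bract x (a * b) = bract (bract x a) b;
  lractA : forall a b x, bract (blact a x) b = blact a (bract x b)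
}.

Definition regular_bimodule : bimodule.
Proof.
refine (@Bimodule L (fun a x => a * x) (fun x a => x * a)
          _ _ _ _ _ _ _ _ _).
- by move=> x a b c; rewrite mulrDl scalerAl.
- by move=> x a b c; rewrite mulrDr scalerAr.
- by move=> x a b c; rewrite mulrDl scalerAl.
- by move=> x a b c; rewrite mulrDr scalerAr.
- exact: mul1r.
- exact: mulr1.
- by move=> a b x; rewrite mulrA.
- by move=> a b x; rewrite mulrA.
- by move=> a b x; rewrite mulrA.
Defined.

Record bimodule_hom (M N : bimodule) := BimoduleHom {
  bfun :> {linear M -> N};
  bfun_lact : forall a x, bfun (blact a x) = blact a (bfun x);
  bfun_ract : forall x a, bfun (bract x a) = bract (bfun x) a
}.

Definition bimodule_isomorphic (M N : bimodule) : Prop :=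
  exists (f : bimodule_hom M N) (g : bimodule_hom N M),
    cancel f g /\ cancel g f.

Definition projective_bimodule (P : bimodule) : Prop :=
  forall (X Y : bimodule) (p : bimodule_hom X Y) (f : bimodule_hom P Y),
    surj p -> exists g : bimodule_hom P X, forall x, p (g x) = f x.

(* K is a syzygy of M: 0 -> K -> P -> M -> 0 is exact with P projective.
   Syzygies are well defined up to stable isomorphism. *)
Definition is_syzygy1 (M K : bimodule) : Prop :=
  exists (P : bimodule) (i : bimodule_hom K P) (p : bimodule_hom P M),
    [/\ projective_bimodule P, injective i, surj p
      & forall x, p x = 0 <-> exists y, i y = x].

Fixpoint is_syzygy (n : nat) (M K : bimodule) : Prop :=
  if n is n'.+1 then exists N, is_syzygy1 M N /\ is_syzygy n' N K
  else bimodule_isomorphic M K.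

(* The endomorphism h - id of M factors through a projective bimodule. *)
Definition stably_identity (M : bimodule) (h : M -> M) : Prop :=
  exists (P : bimodule) (u : bimodule_hom M P) (v : bimodule_hom P M),
    projective_bimodule P /\ forall x, h x - x = v (u x).

Definition stably_isomorphic (M N : bimodule) : Prop :=
  exists (f : bimodule_hom M N) (g : bimodule_hom N M),
    stably_identity (g \o f) /\ stably_identity (f \o g).

Definition balanced_bilinear (M N : bimodule) (V : lmodType k)
    (b : M -> N -> V) : Prop :=
  [/\ forall y, linear (b^~ y), forall x, linear (b x)
    & forall x a y, b (bract x a) y = b x (blact a y)].

Definition is_tensor (M N T : bimodule) (t : M -> N -> T) : Prop :=
  [/\ balanced_bilinear t,
      forall a x y, t (blact a x) y = blact a (t x y),
      forall x y a, t x (bract y a) = bract (t x y) a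
    & forall (V : lmodType k) (b : M -> N -> V), balanced_bilinear b ->
        exists phi : {linear T -> V},
          (forall x y, phi (t x y) = b x y) /\
          (forall psi : {linear T -> V},
             (forall x y, psi (t x y) = b x y) -> psi =1 phi)].

Definition tensor_isomorphic (M N K : bimodule) : Prop :=
  exists (T : bimodule) (t : M -> N -> T),
    is_tensor t /\ bimodule_isomorphic T K.

Definition invertible_bimodule (I : bimodule) : Prop :=
  exists J : bimodule, tensor_isomorphic I J regular_bimodule /\
                       tensor_isomorphic J I regular_bimodule.

End Bimodules.

Declare Scope klin_scope.
Delimit Scope klin_scope with klin.
Reserved Notation "f ≡ g" (at level 70, no associativity).
Reserved Notation "g ∘ f" (at level 40, left associativity).

(* Morphisms are compared by an equivalence relation, because those of a
   localization are given by generators and relations.  The additive inverse of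
   a morphism f is (-1) f. *)
Record klincat (k : fieldType) := KLinCat {
  obj :> Type;
  mor : obj -> obj -> Type;
  heq : forall X Y, mor X Y -> mor X Y -> Prop;
  hid : forall X, mor X X;
  hcomp : forall X Y Z, mor Y Z -> mor X Y -> mor X Z;
  hzero : forall X Y, mor X Y;
  hadd : forall X Y, mor X Y -> mor X Y -> mor X Y;
  hscale : forall X Y, k -> mor X Y -> mor X Y;
  heq_refl : forall X Y (f : mor X Y), heq f f;
  heq_sym : forall X Y (f g : mor X Y), heq f g -> heq g f;
  heq_trans : forall X Y (f g h : mor X Y), heq f g -> heq g h -> heq f h;
  heq_comp : forall X Y Z (g g' : mor Y Z) (f f' : mor X Y),
    heq g g' -> heq f f' -> heq (hcomp g f) (hcomp g' f');
  heq_add : forall X Y (f f' g g' : mor X Y),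
    heq f f' -> heq g g' -> heq (hadd f g) (hadd f' g');
  heq_scale : forall X Y a (f f' : mor X Y),
    heq f f' -> heq (hscale a f) (hscale a f');
  hcompA : forall X Y Z W (h : mor Z W) (g : mor Y Z) (f : mor X Y),
    heq (hcomp h (hcomp g f)) (hcomp (hcomp h g) f);
  hcomp1f : forall X Y (f : mor X Y), heq (hcomp (hid Y) f) f;
  hcompf1 : forall X Y (f : mor X Y), heq (hcomp f (hid X)) f;
  haddA : forall X Y (f g h : mor X Y),
    heq (hadd f (hadd g h)) (hadd (hadd f g) h);
  haddC : forall X Y (f g : mor X Y), heq (hadd f g) (hadd g f);
  hadd0f : forall X Y (f : mor X Y), heq (hadd (hzero X Y) f) f;
  hscale0f : forall X Y (f : mor X Y), heq (hscale 0 f) (hzero X Y);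
  hscale1f : forall X Y (f : mor X Y), heq (hscale 1 f) f;
  hscaleA : forall X Y a b (f : mor X Y),
    heq (hscale a (hscale b f)) (hscale (a * b) f);
  hscaleDr : forall X Y a (f g : mor X Y),
    heq (hscale a (hadd f g)) (hadd (hscale a f) (hscale a g));
  hscaleDl : forall X Y a b (f : mor X Y),
    heq (hscale (a + b) f) (hadd (hscale a f) (hscale b f));
  hcompDl : forall X Y Z (g g' : mor Y Z) (f : mor X Y),
    heq (hcomp (hadd g g') f) (hadd (hcomp g f) (hcomp g' f));
  hcompDr : forall X Y Z (g : mor Y Z) (f f' : mor X Y),
    heq (hcomp g (hadd f f')) (hadd (hcomp g f) (hcomp g f'));
  hcompZl : forall X Y Z a (g : mor Y Z) (f : mor X Y),
    heq (hcomp (hscale a g) f) (hscale a (hcomp g f));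
  hcompZr : forall X Y Z a (g : mor Y Z) (f : mor X Y),
    heq (hcomp g (hscale a f)) (hscale a (hcomp g f))
}.

Arguments mor {k} C X Y : rename.
Arguments heq {k C X Y} f g : rename.
Arguments hid {k C} X : rename.
Arguments hcomp {k C X Y Z} g f : rename.
Arguments hzero {k C} X Y : rename.
Arguments hadd {k C X Y} f g : rename.
Arguments hscale {k C X Y} a f : rename.

Notation "f ≡ g" := (heq f g) : klin_scope.
Notation "g ∘ f" := (hcomp g f) : klin_scope.
Local Open Scope klin_scope.

Section KLinearCategories.
Variable k : fieldType.
Implicit Types C D : klincat k.

Definition inverse_of C (X Y : C) (f : mor C X Y) (g : mor C Y X) : Prop :=
  g ∘ f ≡ hid X /\ f ∘ g ≡ hid Y.

Definition is_iso C (X Y : C) (f : mor C X Y) : Prop :=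
  exists g, inverse_of f g.

Definition zero_object C (Z : C) : Prop := hid Z ≡ hzero Z Z.

Definition is_biproduct C (X Y B : C) (i : mor C X B) (j : mor C Y B)
    (p : mor C B X) (q : mor C B Y) : Prop :=
  [/\ p ∘ i ≡ hid X, q ∘ j ≡ hid Y, q ∘ i ≡ hzero X Y, p ∘ j ≡ hzero Y X
    & hadd (i ∘ p) (j ∘ q) ≡ hid B].

Definition additive_cat C : Prop :=
  (exists Z : C, zero_object Z) /\
  (forall X Y : C, exists (B : C) i j p q, @is_biproduct C X Y B i j p q).

Record klinfunctor C D := KLinFunctor {
  fobj :> C -> D;
  fhom : forall X Y, mor C X Y -> mor D (fobj X) (fobj Y);
  fhom_eq : forall X Y (f g : mor C X Y), f ≡ g -> fhom f ≡ fhom g;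
  fhom_id : forall X, fhom (hid X) ≡ hid (fobj X);
  fhom_comp : forall X Y Z (g : mor C Y Z) (f : mor C X Y),
    fhom (g ∘ f) ≡ fhom g ∘ fhom f;
  fhom_add : forall X Y (f g : mor C X Y),
    fhom (hadd f g) ≡ hadd (fhom f) (fhom g);
  fhom_scale : forall X Y a (f : mor C X Y),
    fhom (hscale a f) ≡ hscale a (fhom f)
}.

Definition is_equivalence C D (F : klinfunctor C D) : Prop :=
  exists G : klinfunctor D C,
    (exists eta : forall X, mor C X (G (F X)),
       (forall X, is_iso (eta X)) /\
       (forall X Y (f : mor C X Y),
          eta Y ∘ f ≡ fhom G (fhom F f) ∘ eta X)) /\
    (exists eps : forall Y, mor D (F (G Y)) Y,
       (forall Y, is_iso (eps Y)) /\
       (forall X Y (f : mor D X Y),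
          eps Y ∘ fhom F (fhom G f) ≡ f ∘ eps X)).

Definition equivalent_cats C D : Prop :=
  exists F : klinfunctor C D, is_equivalence F.

Record triangulation (T : klincat k) := Triangulation {
  tri_additive : additive_cat T;
  shift : klinfunctor T T;
  shift_equiv : is_equivalence shift;
  dist : forall X Y Z : T,
    mor T X Y -> mor T Y Z -> mor T Z (shift X) -> Prop;
  TR1_iso : forall (X Y Z X' Y' Z' : T)
      (f : mor T X Y) (g : mor T Y Z) (h : mor T Z (shift X))
      (f' : mor T X' Y') (g' : mor T Y' Z') (h' : mor T Z' (shift X'))
      (a : mor T X X') (b : mor T Y Y') (c : mor T Z Z'),
    is_iso a -> is_iso b -> is_iso c ->
    b ∘ f ≡ f' ∘ a -> c ∘ g ≡ g' ∘ b -> fhom shift a ∘ h ≡ h' ∘ c ->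
    dist f g h -> dist f' g' h';
  TR1_id : forall X Z : T, zero_object Z ->
    dist (hid X) (hzero X Z) (hzero Z (shift X));
  TR1_cone : forall (X Y : T) (f : mor T X Y),
    exists (Z : T) (g : mor T Y Z) (h : mor T Z (shift X)), dist f g h;
  TR2 : forall (X Y Z : T)
      (f : mor T X Y) (g : mor T Y Z) (h : mor T Z (shift X)),
    dist f g h <-> dist g h (hscale (-1) (fhom shift f));
  TR3 : forall (X Y Z X' Y' Z' : T)
      (f : mor T X Y) (g : mor T Y Z) (h : mor T Z (shift X))
      (f' : mor T X' Y') (g' : mor T Y' Z') (h' : mor T Z' (shift X'))
      (a : mor T X X') (b : mor T Y Y'),
    dist f g h -> dist f' g' h' -> b ∘ f ≡ f' ∘ a ->
    exists c : mor T Z Z', c ∘ g ≡ g' ∘ b /\ fhom shift a ∘ h ≡ h' ∘ c;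
  TR4 : forall (X Y Z X' Y' Z' : T)
      (u : mor T X Y) (i : mor T Y Z') (p : mor T Z' (shift X))
      (v : mor T Y Z) (j : mor T Z X') (q : mor T X' (shift Y))
      (s : mor T Z Y') (r : mor T Y' (shift X)),
    dist u i p -> dist v j q -> dist (v ∘ u) s r ->
    exists (f : mor T Z' Y') (g : mor T Y' X'),
      [/\ dist f g (fhom shift i ∘ q), f ∘ i ≡ s ∘ v, g ∘ s ≡ j, r ∘ f ≡ p
        & q ∘ g ≡ fhom shift u ∘ r]
}.

Definition triangulable (T : klincat k) : Prop := inhabited (triangulation T).

Definition full_subcat (C : klincat k) (P : C -> Prop) : klincat k.
Proof.
refine (@KLinCat k {X : C | P X}
  (fun X Y => mor C (sval X) (sval Y)) (fun X Y f g => f ≡ g)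
  (fun X => hid (sval X)) (fun X Y Z g f => g ∘ f)
  (fun X Y => hzero (sval X) (sval Y)) (fun X Y f g => hadd f g)
  (fun X Y a f => hscale a f)
  _ _ _ _ _ _ _ _ _ _ _ _ _ _ _ _ _ _ _ _ _); intros.
- exact: heq_refl.
- exact: heq_sym.
- exact: heq_trans H H0.
- exact: heq_comp.
- exact: heq_add.
- exact: heq_scale.
- exact: hcompA.
- exact: hcomp1f.
- exact: hcompf1.
- exact: haddA.
- exact: haddC.
- exact: hadd0f.
- exact: hscale0f.
- exact: hscale1f.
- exact: hscaleA.
- exact: hscaleDr.
- exact: hscaleDl.
- exact: hcompDl.
- exact: hcompDr.
- exact: hcompZl.
- exact: hcompZr.
Defined.

Definition is_coproduct (C : klincat k) (I : Type) (Y : I -> C) (S : C)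
    (inj : forall i, mor C (Y i) S) : Prop :=
  forall (Z : C) (f : forall i, mor C (Y i) Z),
    exists h : mor C S Z, (forall i, h ∘ inj i ≡ f i) /\
      (forall h' : mor C S Z, (forall i, h' ∘ inj i ≡ f i) -> h' ≡ h).

Definition hsum (C : klincat k) (X Y : C) (s : seq (mor C X Y)) : mor C X Y :=
  foldr hadd (hzero X Y) s.

(* g is a finitely supported family of morphisms X -> Y i, i.e. an element of
   the direct sum of the Hom(X, Y i), and f is its image under the canonical
   map to Hom(X, S). *)
Definition coproduct_image (C : klincat k) (X : C) (I : Type) (Y : I -> C)
    (S : C) (inj : forall i, mor C (Y i) S) (g : forall i, mor C X (Y i))
    (f : mor C X S) : Prop :=
  exists s : list I, [/\ List.NoDup s,
    forall i, ~ List.In i s -> g i ≡ hzero X (Y i)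
    & f ≡ hsum [seq inj i ∘ g i | i <- s]].

(* The two clauses are the surjectivity and the injectivity of the canonical map
   from the direct sum of the Hom(X, Y i) to Hom(X, S). *)
Definition compact_object (C : klincat k) (X : C) : Prop :=
  forall (I : Type) (Y : I -> C) (S : C) (inj : forall i, mor C (Y i) S),
    is_coproduct inj ->
    (forall f : mor C X S, exists g, coproduct_image inj g f) /\
    (forall (f : mor C X S) (g g' : forall i, mor C X (Y i)),
       coproduct_image inj g f -> coproduct_image inj g' f ->
       forall i, g i ≡ g' i).

Section Localization.
Variables (C : klincat k) (W : forall X Y : C, mor C X Y -> Prop).

(* The k-linear category obtained from C by formally inverting the morphisms in
   W, by generators and relations.  When C is additive and W contains the
   identities and is closed under finite direct sums, it coincides with the
   ordinary localization of the underlying category. *)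
Inductive loc_hom : C -> C -> Type :=
| Loc X Y : mor C X Y -> loc_hom X Y
| LocInv X Y (w : mor C X Y) : W w -> loc_hom Y X
| LocComp X Y Z : loc_hom Y Z -> loc_hom X Y -> loc_hom X Z
| LocAdd X Y : loc_hom X Y -> loc_hom X Y -> loc_hom X Y
| LocScale X Y : k -> loc_hom X Y -> loc_hom X Y.

Inductive loc_eq : forall X Y, loc_hom X Y -> loc_hom X Y -> Prop :=
| loc_refl X Y (f : loc_hom X Y) : loc_eq f f
| loc_sym X Y (f g : loc_hom X Y) : loc_eq f g -> loc_eq g f
| loc_trans X Y (f g h : loc_hom X Y) :
    loc_eq f g -> loc_eq g h -> loc_eq f h
| loc_comp X Y Z (g g' : loc_hom Y Z) (f f' : loc_hom X Y) :
    loc_eq g g' -> loc_eq f f' -> loc_eq (LocComp g f) (LocComp g' f')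
| loc_add X Y (f f' g g' : loc_hom X Y) :
    loc_eq f f' -> loc_eq g g' -> loc_eq (LocAdd f g) (LocAdd f' g')
| loc_scale X Y a (f f' : loc_hom X Y) :
    loc_eq f f' -> loc_eq (LocScale a f) (LocScale a f')
| loc_compA X Y Z V (h : loc_hom Z V) (g : loc_hom Y Z) (f : loc_hom X Y) :
    loc_eq (LocComp h (LocComp g f)) (LocComp (LocComp h g) f)
| loc_comp1f X Y (f : loc_hom X Y) : loc_eq (LocComp (Loc (hid Y)) f) f
| loc_compf1 X Y (f : loc_hom X Y) : loc_eq (LocComp f (Loc (hid X))) f
| loc_addA X Y (f g h : loc_hom X Y) :
    loc_eq (LocAdd f (LocAdd g h)) (LocAdd (LocAdd f g) h)
| loc_addC X Y (f g : loc_hom X Y) : loc_eq (LocAdd f g) (LocAdd g f)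
| loc_add0f X Y (f : loc_hom X Y) : loc_eq (LocAdd (Loc (hzero X Y)) f) f
| loc_scale0f X Y (f : loc_hom X Y) : loc_eq (LocScale 0 f) (Loc (hzero X Y))
| loc_scale1f X Y (f : loc_hom X Y) : loc_eq (LocScale 1 f) f
| loc_scaleA X Y a b (f : loc_hom X Y) :
    loc_eq (LocScale a (LocScale b f)) (LocScale (a * b) f)
| loc_scaleDr X Y a (f g : loc_hom X Y) :
    loc_eq (LocScale a (LocAdd f g)) (LocAdd (LocScale a f) (LocScale a g))
| loc_scaleDl X Y a b (f : loc_hom X Y) :
    loc_eq (LocScale (a + b) f) (LocAdd (LocScale a f) (LocScale b f))
| loc_compDl X Y Z (g g' : loc_hom Y Z) (f : loc_hom X Y) :
    loc_eq (LocComp (LocAdd g g') f) (LocAdd (LocComp g f) (LocComp g' f))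
| loc_compDr X Y Z (g : loc_hom Y Z) (f f' : loc_hom X Y) :
    loc_eq (LocComp g (LocAdd f f')) (LocAdd (LocComp g f) (LocComp g f'))
| loc_compZl X Y Z a (g : loc_hom Y Z) (f : loc_hom X Y) :
    loc_eq (LocComp (LocScale a g) f) (LocScale a (LocComp g f))
| loc_compZr X Y Z a (g : loc_hom Y Z) (f : loc_hom X Y) :
    loc_eq (LocComp g (LocScale a f)) (LocScale a (LocComp g f))
| loc_map_eq X Y (f g : mor C X Y) : f ≡ g -> loc_eq (Loc f) (Loc g)
| loc_map_comp X Y Z (g : mor C Y Z) (f : mor C X Y) :
    loc_eq (Loc (g ∘ f)) (LocComp (Loc g) (Loc f))
| loc_map_add X Y (f g : mor C X Y) :
    loc_eq (Loc (hadd f g)) (LocAdd (Loc f) (Loc g))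
| loc_map_scale X Y a (f : mor C X Y) :
    loc_eq (Loc (hscale a f)) (LocScale a (Loc f))
| loc_invl X Y (w : mor C X Y) (Ww : W w) :
    loc_eq (LocComp (LocInv Ww) (Loc w)) (Loc (hid X))
| loc_invr X Y (w : mor C X Y) (Ww : W w) :
    loc_eq (LocComp (Loc w) (LocInv Ww)) (Loc (hid Y)).

Definition localization : klincat k :=
  @KLinCat k C loc_hom loc_eq (fun X => Loc (hid X)) LocComp
    (fun X Y => Loc (hzero X Y)) LocAdd LocScale
    loc_refl loc_sym loc_trans loc_comp loc_add loc_scale loc_compA
    loc_comp1f loc_compf1 loc_addA loc_addC loc_add0f loc_scale0f
    loc_scale1f loc_scaleA loc_scaleDr loc_scaleDl loc_compDl loc_compDr
    loc_compZl loc_compZr.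

End Localization.

End KLinearCategories.

(* Complexes are graded cohomologically.  Composition and actions take a proof
   that the degrees add up, which avoids transport along equalities of
   integers. *)
Record dgcat (k : fieldType) := DGCat {
  dgob :> Type;
  dghom : dgob -> dgob -> int -> lmodType k;
  dgd : forall x y i, {linear dghom x y i -> dghom x y (i + 1)};
  dgid : forall x, dghom x x 0;
  dgcomp : forall x y z i j l, i + j = l ->
    dghom y z i -> dghom x y j -> dghom x z l;
  dgdd : forall x y i (f : dghom x y i), dgd _ _ _ (dgd _ _ _ f) = 0;
  dgd_id : forall x, dgd _ _ _ (dgid x) = 0;
  dgcomp_linear_l : forall x y z i j l (e : i + j = l) (f : dghom x y j),
    linear (fun g : dghom y z i => dgcomp e g f);
  dgcomp_linear_r : forall x y z i j l (e : i + j = l) (g : dghom y z i),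
    linear (fun f : dghom x y j => dgcomp e g f);
  dgcompA : forall x y z w i j l ij jl t
      (e1 : i + j = ij) (e2 : ij + l = t) (e3 : j + l = jl) (e4 : i + jl = t)
      (h : dghom z w i) (g : dghom y z j) (f : dghom x y l),
    dgcomp e2 (dgcomp e1 h g) f = dgcomp e4 h (dgcomp e3 g f);
  dgcomp1f : forall x y i (e : 0 + i = i) (f : dghom x y i),
    dgcomp e (dgid y) f = f;
  dgcompf1 : forall x y i (e : i + 0 = i) (f : dghom x y i),
    dgcomp e f (dgid x) = f;
  dg_leibniz : forall x y z i j l (e : i + j = l)
      (e1 : (i + 1) + j = l + 1) (e2 : i + (j + 1) = l + 1)
      (g : dghom y z i) (f : dghom x y j),
    dgd _ _ _ (dgcomp e g f) =
      dgcomp e1 (dgd _ _ _ g) f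
        + (-1 : k) ^ i *: dgcomp e2 g (dgd _ _ _ f)
}.

Section DGModules.
Variables (k : fieldType) (A : dgcat k).

Record dgmod := DGMod {
  mcar :> A -> int -> lmodType k;
  md : forall x i, {linear mcar x i -> mcar x (i + 1)};
  dgact : forall (x y : A) i j l, i + j = l ->
    mcar y i -> dghom x y j -> mcar x l;
  mdd : forall x i (u : mcar x i), md _ _ (md _ _ u) = 0;
  dgact_linear_l : forall x y i j l (e : i + j = l) (a : dghom x y j),
    linear (fun u : mcar y i => dgact e u a);
  dgact_linear_r : forall x y i j l (e : i + j = l) (u : mcar y i),
    linear (fun a : dghom x y j => dgact e u a);
  dgactA : forall (x y z : A) i j l ij jl t
      (e1 : i + j = ij) (e2 : ij + l = t) (e3 : j + l = jl) (e4 : i + jl = t)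
      (u : mcar z i) (a : dghom y z j) (b : dghom x y l),
    dgact e2 (dgact e1 u a) b = dgact e4 u (dgcomp e3 a b);
  dgact1 : forall x i (e : i + 0 = i) (u : mcar x i), dgact e u (dgid x) = u;
  m_leibniz : forall (x y : A) i j l (e : i + j = l)
      (e1 : (i + 1) + j = l + 1) (e2 : i + (j + 1) = l + 1)
      (u : mcar y i) (a : dghom x y j),
    md _ _ (dgact e u a) =
      dgact e1 (md _ _ u) a + (-1 : k) ^ i *: dgact e2 u (dgd _ _ _ a)
}.

Arguments md M {x i} : rename.
Arguments dgact M {x y i j l} e u a : rename.

Record dgmod_hom (M N : dgmod) := DGModHom {
  mfun : forall x i, {linear M x i -> N x i};
  mfun_d : forall x i (u : M x i), mfun _ _ (md M u) = md N (mfun _ _ u);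
  mfun_act : forall (x y : A) i j l (e : i + j = l)
      (u : M y i) (a : dghom x y j),
    mfun _ _ (dgact M e u a) = dgact N e (mfun _ _ u) a
}.

Definition dgmod_heq M N (f g : dgmod_hom M N) : Prop :=
  forall x i, mfun f x i =1 mfun g x i.

Definition dgmod_id M : dgmod_hom M M.
Proof. by exists (fun x i => idfun : {linear M x i -> M x i}). Defined.

Definition dgmod_comp M N P (g : dgmod_hom N P) (f : dgmod_hom M N) :
  dgmod_hom M P.
Proof.
exists (fun x i => (mfun g x i \o mfun f x i) : {linear M x i -> P x i}).
- by move=> x i u /=; rewrite !mfun_d.
- by move=> x y i j l e u a /=; rewrite !mfun_act.
Defined.

Definition dgmod_zero M N : dgmod_hom M N.
Proof.
exists (fun x i => \0 : {linear M x i -> N x i}).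
- by move=> x i u /=; rewrite linear0.
- move=> x y i j l e u a /=.
  by have /= := dgact_linear_l e a (-1) 0 (0 : N y i);
     rewrite scaler0 addr0 scaleN1r addNr.
Defined.

Definition dgmod_add M N (f g : dgmod_hom M N) : dgmod_hom M N.
Proof.
exists (fun x i => (mfun f x i \+ mfun g x i) : {linear M x i -> N x i}).
- by move=> x i u /=; rewrite linearD !mfun_d.
- move=> x y i j l e u a /=; rewrite !mfun_act.
  have /= := dgact_linear_l e a 1 (mfun f _ _ u) (mfun g _ _ u).
  by rewrite !scale1r => ->.
Defined.

Definition dgmod_scale M N (c : k) (f : dgmod_hom M N) : dgmod_hom M N.
Proof.
exists (fun x i => (c \*: mfun f x i) : {linear M x i -> N x i}).
- by move=> x i u /=; rewrite linearZ /= mfun_d.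
- move=> x y i j l e u a /=; rewrite mfun_act.
  have z := (dgmod_zero N N).(mfun_act) e 0 a; rewrite /= in z.
  have /= := dgact_linear_l e a c (mfun f _ _ u) 0.
  by rewrite -z !addr0 => ->.
Defined.

Definition dgmod_cat : klincat k.
Proof.
refine (@KLinCat k dgmod dgmod_hom dgmod_heq dgmod_id dgmod_comp
  dgmod_zero dgmod_add dgmod_scale _ _ _ _ _ _ _ _ _ _ _ _ _ _ _ _ _ _ _ _ _);
  rewrite /dgmod_heq.
- by [].
- by move=> X Y f g E x i u; rewrite E.
- by move=> X Y f g h E F x i u; rewrite E F.
- by move=> X Y Z g g' f f' E F x i u /=; rewrite E F.
- by move=> X Y f f' g g' E F x i u /=; rewrite E F.
- by move=> X Y a f f' E x i u /=; rewrite E.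
- by [].
- by [].
- by [].
- by move=> X Y f g h x i u /=; rewrite addrA.
- by move=> X Y f g x i u /=; rewrite addrC.
- by move=> X Y f x i u /=; rewrite add0r.
- by move=> X Y f x i u /=; rewrite scale0r.
- by move=> X Y f x i u /=; rewrite scale1r.
- by move=> X Y a b f x i u /=; rewrite scalerA.
- by move=> X Y a f g x i u /=; rewrite scalerDr.
- by move=> X Y a b f x i u /=; rewrite scalerDl.
- by [].
- by move=> X Y Z g f f' x i u /=; rewrite linearD.
- by [].
- by move=> X Y Z a g f x i u /=; rewrite linearZ.
Defined.

(* f induces an isomorphism on cohomology: injectivity and surjectivity of
   H^(i+1)(f) at each object; every integer is of the form i + 1. *)
Definition quasi_iso (M N : dgmod_cat) (f : mor dgmod_cat M N) : Prop :=
  forall x i,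
    (forall z : M x (i + 1), md M z = 0 ->
       (exists y : N x i, md N y = mfun f _ _ z) ->
       exists y : M x i, md M y = z) /\
    (forall z : N x (i + 1), md N z = 0 ->
       exists (w : M x (i + 1)) (y : N x i),
         md M w = 0 /\ z = mfun f _ _ w + md N y).

Definition derived_cat : klincat k := localization quasi_iso.

Definition compact_derived_cat : klincat k :=
  full_subcat (@compact_object k derived_cat).

End DGModules.

Definition enhanceable (k : fieldType) (T : klincat k) : Prop :=
  exists A : dgcat k, equivalent_cats (compact_derived_cat A) T.

Section ProjectiveModules.
Variables (k : fieldType) (L : algType k).

Definition fin_gen_module (R : pzRingType) (M : lmodType R) : Prop :=
  exists s : seq M, forall x : M,
    exists c : 'I_(size s) -> R, x = \sum_i c i *: s`_i.

Definition projective_module (R : pzRingType) (P : lmodType R) : Prop :=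
  forall (X Y : lmodType R) (p : {linear X -> Y}) (f : {linear P -> Y}),
    surj p -> exists g : {linear P -> X}, p \o g =1 f.

(* Right L-modules are left modules over the converse ring L^c. *)
Record projmod := ProjMod {
  pcar :> lmodType L^c;
  pcar_fin_gen : fin_gen_module pcar;
  pcar_projective : projective_module pcar
}.

(* The scalar c in k acts on right L-modules through c%:A in L. *)
Definition pscale_fun (P Q : projmod) (c : k) (f : {linear P -> Q}) (x : P) : Q :=
  (c%:A : L^c) *: f x.

Lemma pscale_linear (P Q : projmod) (c : k) (f : {linear P -> Q}) : linear (pscale_fun c f).
Proof.
move=> a x y; rewrite /pscale_fun linearP scalerDr !scalerA; congr (_ *: _ + _).
by rewrite -[LHS]/((a : L) * c%:A) -[RHS]/(c%:A * (a : L)) mulr_algr mulr_algl.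
Qed.

HB.instance Definition _ (P Q : projmod) (c : k) (f : {linear P -> Q}) :=
  GRing.isLinear.Build L^c P Q *:%R (pscale_fun c f) (pscale_linear c f).

Definition proj_cat : klincat k.
Proof.
refine (@KLinCat k projmod (fun P Q => {linear P -> Q}) (fun P Q f g => f =1 g)
  (fun P => idfun : {linear P -> P})
  (fun P Q R g f => (g \o f) : {linear P -> R})
  (fun P Q => \0 : {linear P -> Q})
  (fun P Q f g => (f \+ g) : {linear P -> Q})
  (fun P Q c f => pscale_fun c f : {linear P -> Q})
  _ _ _ _ _ _ _ _ _ _ _ _ _ _ _ _ _ _ _ _ _).
- by [].
- by move=> X Y f g E u; rewrite E.
- by move=> X Y f g h E F u; rewrite E F.
- by move=> X Y Z g g' f f' E F u /=; rewrite E F.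
- by move=> X Y f f' g g' E F u /=; rewrite E F.
- by move=> X Y a f f' E u /=; rewrite /pscale_fun E.
- by [].
- by [].
- by [].
- by move=> X Y f g h u /=; rewrite addrA.
- by move=> X Y f g u /=; rewrite addrC.
- by move=> X Y f u /=; rewrite add0r.
- by move=> X Y f u /=; rewrite /pscale_fun scale0r (@scale0r L^c).
- by move=> X Y f u /=; rewrite /pscale_fun scale1r (@scale1r L^c).
- move=> X Y a b f u /=; rewrite /pscale_fun scalerA; congr (_ *: _).
  by rewrite -[LHS]/(b%:A * a%:A : L) mulr_algl scalerA mulrC.
- by move=> X Y a f g u /=; rewrite /pscale_fun scalerDr.
- by move=> X Y a b f u /=; rewrite /pscale_fun (scalerDl _ a b) (@scalerDl L^c).
- by [].
- by move=> X Y Z g f f' u /=; rewrite linearD.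
- by [].
- by move=> X Y Z a g f u /=; rewrite /pscale_fun linearZ.
Defined.

End ProjectiveModules.

(* Main.v *)
From HB Require Import structures.
From Stdlib Require Import Setoid Morphisms List ClassicalEpsilon.
Require Import Defs.
From mathcomp Require Import all_boot all_algebra.

Set Implicit Arguments.
Unset Strict Implicit.
Unset Printing Implicit Defensive.

(* Let [a] be the sum of the arrows, so that [a ^ (n + 1) = 0] and [aL = La] is the radical.

   Bimodules.  Reducing modulo [a] on the left sends the bimodule [L] to [S = L / aL], a
   projective bimodule to a projective right module, and an invertible bimodule to a
   semisimple one.  The third syzygy of [S] is, up to projectives, [aL], which has Loewy
   length [n > 1].  A property of right modules that is stable under projective summands,
   holds for semisimple modules and fails for [aL] separates the two.

   Triangulations.  Let [a] act on [X = L] by left multiplication and let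
   [X -> X -g-> Z -h-> SX] be its cone.  Since [Z] and [SX] are projective, [g = w a^n] and
   [h = S(a)^n v].  As [S(a) v w] lies in the radical, [S(a) v g = 0], so that
   [S(a) v = l h = l S(a)^n v]; now [l S(a)^(n-1)] is nilpotent because [n > 1], hence
   [h = 0], and the identity of [SX] factors through the nilpotent [S(a)].  This only uses
   that cones are weak cokernels.

   Enhancements.  The compact objects of a derived category have such cones: morphisms of
   the localization are left fractions, and equality of two fractions is decoded by letting
   them act on morphisms into a varying object. *)

Import GRing.Theory.
Local Open Scope ring_scope.

(** * The Nakayama algebra *)

(** The syzygies in the statement come from arbitrary projective presentations, so no resolution is
    computed. Instead 1 is lifted step by step: the commutator x a - a x and the norm, the sum of
    the a^l x a^(n - l), which are the two alternating differentials of the bimodule resolution of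
    k[a]/(a^(n+1)), turn each lift into an element of the next syzygy. Reduction modulo [a] on the
    left stays exact because the higher Tor groups of L / aL with every syzygy vanish.

    Annihilators of powers of [a] are recorded through k-linear splittings: a linear map on one
    factor acts directly on L (x) V (x) L, and every projective bimodule is a retract of such a
    product.

    Morphisms of the localization are formal terms, equal when a derivation says so; hence decoding
    an equality requires an invariant of terms. Values in a colimit of Hom sets would need
    quotients, which a relation between morphisms of the original category avoids. *)

Definition linear_of (R : nzRingType) (U V : lmodType R) (f : U -> V) (fl : linear f) :
  {linear U -> V} := HB.pack f (GRing.isLinear.Build R U V *:%R f fl).

(** The properties of the sum of arrows on which the rest relies. The splittings say that on either
    side the annihilator of a^j is generated by a^(n+1-j), with [s] and [t] only k-linear. The last
    field holds because L / aL is a product of copies of k, which is reduced. *)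
Record cyclic_radical (k : fieldType) (n : nat) (L : algType k) (a : L) : Prop := {
  radX0 : a ^+ n.+1 = 0;
  rad_mull : forall x, exists y, a * x = y * a;
  rad_mulr : forall x, exists y, x * a = a * y;
  rad_split_l : forall j, (j <= n.+1)%N -> exists s t : {linear L -> L},
    forall x, x = a ^+ (n.+1 - j) * s x + t (a ^+ j * x);
  rad_split_r : forall j, (j <= n.+1)%N -> exists s t : {linear L -> L},
    forall x, x = s x * a ^+ (n.+1 - j) + t (x * a ^+ j);
  nilpotent_rad : forall x p, x ^+ p = 0 -> exists y, x = a * y
}.

Definition basis_of_alg (k : fieldType) (L : algType k) (B : finType)
    (e : B -> L) (c : B -> {scalar L}) : Prop :=
  (forall x, x = \sum_b c b x *: e b) /\ (forall b d, c b (e d) = (b == d)%:R).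

Section PathAlgebra.
Variables (k : fieldType) (m : nat).
Local Notation kQ := (cycle_path_algebra k m).
Implicit Types f g : kQ.

Lemma lin_ffun c f g i : (c *: f + g) i = c *: f i + g i.
Proof. by rewrite !ffunE. Qed.

Definition arrows_sum (j : nat) : kQ := [ffun => 'X^j].

Lemma mul_arrows f j i : (f * arrows_sum j) i = f i * 'X^j.
Proof.
rewrite ffunE /concat_from -[in RHS](coefK (f i)) poly_def mulr_suml.
by apply: eq_bigr => l _; rewrite ffunE scalerAl.
Qed.

Lemma arrows_mul f j i : (arrows_sum j * f) i = 'X^j * f (walk j i).
Proof. by rewrite !ffunE concat_fromXn. Qed.

Lemma arrowsX j : arrows_sum 1 ^+ j = arrows_sum j.
Proof.
elim: j => [|j IH]; first by apply/ffunP => i; rewrite !ffunE.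
by rewrite exprSr IH; apply/ffunP => i; rewrite mul_arrows !ffunE -exprD addn1.
Qed.

(** Killing the paths of positive length is a ring morphism onto k^m; this is what puts nilpotent
    elements into the radical. *)
Lemma coef0_mul f g i : ((f * g) i)`_0 = (f i)`_0 * (g i)`_0.
Proof.
rewrite ffunE (@concat_from_widen _ _ g i (f i) (size (f i)).+1) // big_ord_recl.
rewrite coefD coefZ expr0 mul1r coef_sum big1 ?addr0 // => l _.
by rewrite coefZ coefXnM mulr0.
Qed.

Lemma arrow_mul l j f i :
  (arrow_path k l j * f) i = if i == j then 'X^l * f (walk l i) else 0.
Proof. by rewrite !ffunE; case: eqP => _; rewrite ?concat_fromXn // linear0. Qed.

(** Concatenation adds lengths, so the ideal lives in lengths at least N; conversely a path of
    length at least N begins with one of length exactly N. *)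
Lemma ideal_long_paths N f :
  ideal_generated (fun p => exists i, p = arrow_path k N i) f <->
  forall i, take_poly N (f i) = 0.
Proof.
split=> [[r [rS ->]] i|f0].
  elim: r rS => [|t r IH] rS; first by rewrite big_nil ffunE take_poly0r.
  rewrite big_cons ffunE take_polyD IH ?addr0; last first.
    by move=> u ur; apply: rS; rewrite inE ur orbT.
  have [|j ->] := rS t; first exact: mem_head.
  rewrite -mulrA ffunE /concat_from take_poly_sum big1 // => l _.
  rewrite arrow_mul; case: eqP => _; last by rewrite mulr0 scaler0 take_poly0r.
  by rewrite take_polyZ mulrCA mulrC take_polyMXn_0 scaler0.
(* [g i] does not depend on the vertex, so its value at the target [walk N i] is the right one
   without reindexing. *)
pose g i : kQ := [ffun => drop_poly N (f i)].
exists [seq (1, arrow_path k N i, g i) | i <- enum 'I_m]; split.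
  by move=> t /mapP[i _ ->]; exists i.
rewrite big_map big_enum /=; apply/ffunP => i.
rewrite sum_ffunE (bigD1 i) //= mul1r arrow_mul eqxx big1 ?addr0; last first.
  by move=> j ji; rewrite mul1r arrow_mul eq_sym (negPf ji).
by rewrite /g ffunE mulrC -{1}[f i](poly_take_drop N) f0 add0r.
Qed.

End PathAlgebra.

Section Nakayama.
Variables (k : fieldType) (m n : nat) (L : algType k).
Local Notation kQ := (cycle_path_algebra k m).
Variable pi : {rmorphism kQ -> L}.
Hypothesis piZ : scalable pi.
Hypothesis pi_surj : surj pi.
Hypothesis pi_ker : forall x, pi x = 0 <->
  ideal_generated (fun p => exists i, p = arrow_path k n.+1 i) x.

Local Notation N := n.+1.

Lemma pi_eq0 f : pi f = 0 <-> forall i, take_poly N (f i) = 0.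
Proof. by rewrite pi_ker; exact: ideal_long_paths. Qed.

Lemma pi_eq f g : pi f = pi g <-> forall i, take_poly N (f i) = take_poly N (g i).
Proof.
split=> [E i|E].
  have /pi_eq0/(_ i) : pi (f - g) = 0 by rewrite rmorphB E subrr.
  by rewrite !ffunE take_polyD -scaleN1r take_polyZ scaleN1r => /subr0_eq.
apply/subr0_eq; rewrite -rmorphB; apply/pi_eq0 => i.
by rewrite !ffunE take_polyD -scaleN1r take_polyZ scaleN1r E subrr.
Qed.

Lemma pi_preimage (y : L) : exists x : kQ, pi x == y.
Proof. by have [x xy] := pi_surj y; exists x; apply/eqP. Qed.

(** Truncation erases the choice of preimage: this is the unique preimage with all components of
    degree at most n, hence it depends linearly on [y]. *)
Definition nf (y : L) : kQ :=
  locked [ffun i => take_poly N (xchoose (pi_preimage y) i)].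

Lemma take_take (p : {poly k}) : take_poly N (take_poly N p) = take_poly N p.
Proof. by rewrite take_poly_id ?size_take_poly. Qed.

Lemma nfK y : pi (nf y) = y.
Proof.
rewrite -[RHS](eqP (xchooseP (pi_preimage y))); apply/pi_eq => i.
by rewrite /nf -lock ffunE take_take.
Qed.

Lemma take_nf y i : take_poly N (nf y i) = nf y i.
Proof. by rewrite /nf -lock ffunE take_take. Qed.

Lemma nf_pi f i : nf (pi f) i = take_poly N (f i).
Proof.
by rewrite -take_nf; move/pi_eq: (nfK (pi f)) => ->.
Qed.

Lemma nf_linear : linear nf.
Proof.
move=> c x y; apply/ffunP => i.
have -> : c *: x + y = pi (c *: nf x + nf y) by rewrite rmorphD piZ !nfK.
by rewrite nf_pi lin_ffun take_polyD take_polyZ !take_nf.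
Qed.

HB.instance Definition _ := GRing.isLinear.Build k L kQ *:%R nf nf_linear.

Definition radical_gen : L := pi (arrows_sum k m 1).

(* Left division by the [j]-th power of the radical generator moves the source of a path
   [u] steps backwards along the cycle. *)
Definition shift_down (u j : nat) (y : L) : L :=
  pi [ffun i => drop_poly j (nf y (iter u (@ord_pred m) i))].

Lemma shift_down_linear u j : linear (shift_down u j).
Proof.
move=> c x y; rewrite /shift_down -piZ -rmorphD; congr (pi _); apply/ffunP => i.
by rewrite lin_ffun !ffunE linearP lin_ffun linearP.
Qed.

HB.instance Definition _ u j :=
  GRing.isLinear.Build k L L *:%R (shift_down u j) (shift_down_linear u j).

Lemma walkK j : cancel (@walk m j) (iter j (@ord_pred m)).
Proof.
elim: j => // j IH i; rewrite /walk iterSr [iter j.+1 _ i]iterS ordSK; exact: IH.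
Qed.

Lemma walk_predK j : cancel (iter j (@ord_pred m)) (@walk m j).
Proof.
elim: j => // j IH i; rewrite /walk iterSr [iter j.+1 _ i]iterS ord_predK; exact: IH.
Qed.

Lemma drop_take j (p : {poly k}) : (j <= N)%N ->
  drop_poly j (take_poly N ('X^j * p)) = take_poly (N - j) p.
Proof.
move=> le; apply/polyP => i; rewrite coef_drop_poly !coef_take_poly coefXnM addnK.
by rewrite [(i + j < j)%N]ltnNge leq_addl ltn_subRL addnC.
Qed.

Lemma nakayama_radical : cyclic_radical n radical_gen.
Proof.
have aX j : radical_gen ^+ j = pi (arrows_sum k m j) by rewrite -rmorphXn arrowsX.
split.
- rewrite aX; apply/pi_eq0 => i; rewrite ffunE -['X^_]mul1r; exact: take_polyMXn_0.
- move=> x; exists (pi [ffun i => nf x (walk 1 i)]); rewrite -{1}(nfK x) -!rmorphM.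
  by congr (pi _); apply/ffunP => i; rewrite arrows_mul mul_arrows [in RHS]ffunE mulrC.
- move=> x; exists (pi [ffun i => nf x (ord_pred i)]); rewrite -{1}(nfK x) -!rmorphM.
  congr (pi _); apply/ffunP => i; rewrite arrows_mul mul_arrows [in RHS]ffunE.
  by rewrite (ordSK i : ord_pred (walk 1 i) = i) mulrC.
(* The first summand collects the terms of [x] of length at least N - j; multiplication by a^j kills
   exactly these, and the second map shifts the surviving terms back. *)
- move=> j le_j; exists (shift_down (N - j) (N - j)), (shift_down j j) => x.
  rewrite /= /shift_down !aX -{1 3}(nfK x) -!rmorphM -rmorphD; apply/pi_eq => i.
  rewrite ffunE arrows_mul !ffunE walkK !take_polyD nf_pi arrows_mul walk_predK.
  rewrite drop_take // -take_polyD; congr take_poly.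
  by rewrite addrC mulrC poly_take_drop.
(* Right multiplication leaves the source of a path in place, hence no backward steps along the
   cycle. *)
- move=> j le_j; exists (shift_down 0 (N - j)), (shift_down 0 j) => x.
  rewrite /= /shift_down !aX -{1 3}(nfK x) -!rmorphM -rmorphD; apply/pi_eq => i.
  rewrite ffunE mul_arrows !ffunE /= nf_pi mul_arrows mulrC.
  rewrite [nf x i * _]mulrC drop_take //; congr take_poly.
  by rewrite addrC mulrC poly_take_drop.
- move=> x p xp0; exists (shift_down 1 1 x); rewrite /radical_gen -rmorphM -[LHS]nfK.
  congr (pi _); apply/ffunP => i; rewrite arrows_mul ffunE (ordSK i : iter 1 _ (walk 1 i) = i).
  (* The constant terms of a nilpotent element are nilpotent in the field k, so they vanish and one
     arrow can be split off. *)
  have x0 : (nf x i)`_0 = 0.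
    have: pi (nf x ^+ p) = 0 by rewrite rmorphXn nfK.
    move/pi_eq0/(_ i)/(congr1 (fun q : {poly k} => q`_0)); rewrite !coefE /=.
    have -> : ((nf x ^+ p) i)`_0 = (nf x i)`_0 ^+ p.
      by elim: p {xp0} => [|p IH]; rewrite ?ffunE ?coefE // !exprS coef0_mul IH.
    by move/eqP; rewrite expf_eq0 => /andP[_ /eqP].
  rewrite -[LHS](poly_take_drop 1) mulrC -[RHS]add0r; congr (_ + _).
  by apply/polyP => l; rewrite !coefE; case: l.
Qed.

Lemma nakayama_basis : exists (B : finType) (e : B -> L) (c : B -> {scalar L}),
  basis_of_alg e c.
Proof.
pose c0 (b : 'I_m * 'I_N) (x : L) : k := (nf x b.1)`_b.2.
have cl b : scalar (c0 b) by move=> u x y; rewrite /c0 linearP !ffunE !coefE.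
pose c b : {scalar L} := HB.pack (c0 b) (GRing.isLinear.Build k L k *%R (c0 b) (cl b)).
exists ('I_m * 'I_N)%type, (fun b : 'I_m * 'I_N => pi (arrow_path k b.2 b.1)), c; split.
  move=> x; under eq_bigr do rewrite -piZ.
  rewrite -raddf_sum -{1}[x]nfK; congr (pi _); apply/ffunP => i.
  rewrite sum_ffunE -(pair_bigA _ (fun i' l => (c (i', l) x *: arrow_path k l i') i)) /=.
  rewrite (bigD1 i) //= [X in _ + X]big1 ?addr0; last first.
    by move=> j ji; rewrite big1 // => l _; rewrite !ffunE eq_sym (negPf ji) scaler0.
  under eq_bigr do rewrite !ffunE eqxx.
  rewrite /c0 /= -[LHS]take_nf; apply/polyP => l; rewrite coef_sum coef_take_poly.
  case: ltnP => lN.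
    rewrite (bigD1 (Ordinal lN)) //= !coefE eqxx mulr1 big1 ?addr0 // => l' nl.
    rewrite !coefE; case: eqP => [E|]; last by rewrite mulr0.
    by case/eqP: nl; apply: val_inj.
  rewrite big1 // => l' _; rewrite !coefE; case: eqP => [E|]; last by rewrite mulr0.
  by move: (ltn_ord l'); rewrite -E ltnNge lN.
move=> [i l] [i' l']; rewrite /= /c0 /= nf_pi ffunE xpair_eqE.
case: eqP => _ /=; last by rewrite take_poly0r coef0.
by rewrite coef_take_poly ltn_ord coefXn.
Qed.

End Nakayama.

(** * Bimodules *)

Section InducedBimodule.
Variables (k : fieldType) (L : algType k).

Lemma mulrl_linear (x : L) : linear ( *%R x).
Proof. by move=> u y z; rewrite mulrDr scalerAr. Qed.

Lemma mulrr_linear (x : L) : linear ( *%R^~ x).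
Proof. by move=> u y z; rewrite mulrDl scalerAl. Qed.

Variables (B : finType) (e : B -> L) (c : B -> {scalar L}).
Hypothesis ec : basis_of_alg e c.

(* With respect to the basis [e], a function [B * B -> V] stands for an element of
   [L (x) V (x) L], on which an endomorphism of [L] acts through either factor. *)
Definition tensl (V : lmodType k) (phi : L -> L) (w : {ffun B * B -> V}) :
    {ffun B * B -> V} :=
  [ffun b => \sum_d c b.1 (phi (e d)) *: w (d, b.2)].

Definition tensr (V : lmodType k) (phi : L -> L) (w : {ffun B * B -> V}) :
    {ffun B * B -> V} :=
  [ffun b => \sum_d c b.2 (phi (e d)) *: w (b.1, d)].

Section Tens.
Variable V : lmodType k.
Implicit Types (w : {ffun B * B -> V}) (phi psi : L -> L).

Lemma basis_sum (phi : L -> L) x : linear phi -> phi x = \sum_b c b x *: phi (e b).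
Proof.
move=> lphi; pose f : {linear L -> L} := HB.pack phi (GRing.isLinear.Build k L L *:%R phi lphi).
rewrite -[LHS]/(f x) [in LHS](ec.1 x) linear_sum; apply: eq_bigr => b _; rewrite linearZ //.
Qed.

Lemma coord_comp phi psi b d : linear phi ->
  c b (phi (psi (e d))) = \sum_i c b (phi (e i)) * c i (psi (e d)).
Proof.
move=> lphi; rewrite (basis_sum (psi _) lphi) linear_sum; apply: eq_bigr => i _.
by rewrite linearZ mulrC.
Qed.

Lemma tensl_comp phi psi w : linear phi -> tensl phi (tensl psi w) = tensl (phi \o psi) w.
Proof.
move=> lphi; apply/ffunP => b; rewrite !ffunE.
under eq_bigr do rewrite ffunE scaler_sumr.
rewrite exchange_big /=; apply: eq_bigr => d _; rewrite /= (coord_comp psi b.1 d lphi) scaler_suml.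
by apply: eq_bigr => i _; rewrite scalerA.
Qed.

Lemma tensr_comp phi psi w : linear phi -> tensr phi (tensr psi w) = tensr (phi \o psi) w.
Proof.
move=> lphi; apply/ffunP => b; rewrite !ffunE.
under eq_bigr do rewrite ffunE scaler_sumr.
rewrite exchange_big /=; apply: eq_bigr => d _; rewrite /= (coord_comp psi b.2 d lphi) scaler_suml.
by apply: eq_bigr => i _; rewrite scalerA.
Qed.

Lemma tensl_id w : tensl id w = w.
Proof.
apply/ffunP => -[b b']; rewrite ffunE (bigD1 b) //= (ec.2 b b) eqxx scale1r big1 ?addr0 //.
by move=> d db; rewrite (ec.2 b d) eq_sym (negPf db) scale0r.
Qed.

Lemma tensr_id w : tensr id w = w.
Proof.
apply/ffunP => -[b b']; rewrite ffunE (bigD1 b') //= (ec.2 b' b') eqxx scale1r big1 ?addr0 //.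
by move=> d db; rewrite (ec.2 b' d) eq_sym (negPf db) scale0r.
Qed.

Lemma tensl_linear phi : linear (@tensl V phi).
Proof.
move=> u w w'; apply/ffunP => b; rewrite !ffunE scaler_sumr -big_split.
by apply: eq_bigr => d _; rewrite !ffunE scalerDr !scalerA mulrC.
Qed.

Lemma tensr_linear phi : linear (@tensr V phi).
Proof.
move=> u w w'; apply/ffunP => b; rewrite !ffunE scaler_sumr -big_split.
by apply: eq_bigr => d _; rewrite !ffunE scalerDr !scalerA mulrC.
Qed.

Lemma tensl_lin phi psi chi u w : (forall x, chi x = u *: phi x + psi x) ->
  tensl chi w = u *: tensl phi w + tensl psi w.
Proof.
move=> E; apply/ffunP => b; rewrite !ffunE scaler_sumr -big_split.
by apply: eq_bigr => d _; rewrite E linearP scalerDl scalerA.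
Qed.

Lemma tensr_lin phi psi chi u w : (forall x, chi x = u *: phi x + psi x) ->
  tensr chi w = u *: tensr phi w + tensr psi w.
Proof.
move=> E; apply/ffunP => b; rewrite !ffunE scaler_sumr -big_split.
by apply: eq_bigr => d _; rewrite E linearP scalerDl scalerA.
Qed.

Lemma tenslrC phi psi w : tensl phi (tensr psi w) = tensr psi (tensl phi w).
Proof.
apply/ffunP => b; rewrite !ffunE; under eq_bigr do rewrite ffunE scaler_sumr.
rewrite exchange_big; apply: eq_bigr => d _ /=; rewrite ffunE scaler_sumr.
by apply: eq_bigr => i _; rewrite !scalerA mulrC.
Qed.

Lemma eq_tensl phi psi w : phi =1 psi -> tensl phi w = tensl psi w.
Proof. by move=> E; apply/ffunP => b; rewrite !ffunE; apply: eq_bigr => d _; rewrite E. Qed.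

Lemma eq_tensr phi psi w : phi =1 psi -> tensr phi w = tensr psi w.
Proof. by move=> E; apply/ffunP => b; rewrite !ffunE; apply: eq_bigr => d _; rewrite E. Qed.

Definition induced_bimodule : bimodule L.
Proof.
refine (@Bimodule k L {ffun B * B -> V} (fun x => tensl ( *%R x))
          (fun w x => tensr ( *%R^~ x) w) _ _ _ _ _ _ _ _ _).
- by move=> w u x y; apply: tensl_lin => z; rewrite mulrDl scalerAl.
- by move=> x; exact: tensl_linear.
- by move=> x; exact: tensr_linear.
- by move=> w u x y; apply: tensr_lin => z; rewrite mulrDr scalerAr.
- by move=> w; rewrite -[RHS]tensl_id; apply: eq_tensl => x; rewrite mul1r.
- by move=> w; rewrite -[RHS]tensr_id; apply: eq_tensr => x; rewrite mulr1.
- move=> x y w; rewrite tensl_comp; last exact: mulrl_linear.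
  by apply: eq_tensl => z; rewrite /= mulrA.
- move=> x y w; rewrite tensr_comp; last exact: mulrr_linear.
  by apply: eq_tensr => z; rewrite /= mulrA.
- by move=> x y w; rewrite tenslrC.
Defined.

End Tens.

Section Bilinear.
Variable M : bimodule L.
Implicit Types (x y : M) (u v : L).

Lemma blactDl u v x : blact (u + v) x = blact u x + blact v x.
Proof. by have /= := blact_linear_l x 1 u v; rewrite !scale1r. Qed.
Lemma bractDr u v x : bract x (u + v) = bract x u + bract x v.
Proof. by have /= := bract_linear_r x 1 u v; rewrite !scale1r. Qed.
Lemma blactD u x y : blact u (x + y) = blact u x + blact u y.
Proof. by have /= := blact_linear_r u 1 x y; rewrite !scale1r. Qed.
Lemma bractD u x y : bract (x + y) u = bract x u + bract y u.
Proof. by have /= := bract_linear_l u 1 x y; rewrite !scale1r. Qed.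
Lemma blact0 u : blact u (0 : M) = 0.
Proof. by apply: (addrI (blact u 0)); rewrite -blactD !addr0. Qed.
Lemma bract0 u : bract (0 : M) u = 0.
Proof. by apply: (addrI (bract 0 u)); rewrite -bractD !addr0. Qed.
Lemma blact0l x : blact 0 x = 0.
Proof. by apply: (addrI (blact 0 x)); rewrite -blactDl !addr0. Qed.
Lemma bract0r x : bract x 0 = 0.
Proof. by apply: (addrI (bract x 0)); rewrite -bractDr !addr0. Qed.
Lemma blactZl s u x : blact (s *: u) x = s *: blact u x.
Proof. by have /= := blact_linear_l x s u 0; rewrite !addr0 blact0l addr0. Qed.
Lemma bractZr s u x : bract x (s *: u) = s *: bract x u.
Proof. by have /= := bract_linear_r x s u 0; rewrite !addr0 bract0r addr0. Qed.
Lemma blactZ s u x : blact u (s *: x) = s *: blact u x.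
Proof. by have /= := blact_linear_r u s x 0; rewrite !addr0 blact0 addr0. Qed.
Lemma bractZ s u x : bract (s *: x) u = s *: bract x u.
Proof. by have /= := bract_linear_l u s x 0; rewrite !addr0 bract0 addr0. Qed.
Lemma blactN u x : blact u (- x) = - blact u x.
Proof. by rewrite -scaleN1r blactZ scaleN1r. Qed.
Lemma bractN u x : bract (- x) u = - bract x u.
Proof. by rewrite -scaleN1r bractZ scaleN1r. Qed.
Lemma blactB u x y : blact u (x - y) = blact u x - blact u y.
Proof. by rewrite blactD blactN. Qed.
Lemma bractB u x y : bract (x - y) u = bract x u - bract y u.
Proof. by rewrite bractD bractN. Qed.
Lemma blact_sum u I (r : seq I) (F : I -> M) :
  blact u (\sum_(i <- r) F i) = \sum_(i <- r) blact u (F i).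
Proof. by elim: r => [|i r IH]; rewrite ?big_nil ?blact0 // !big_cons blactD IH. Qed.
Lemma bract_sum u I (r : seq I) (F : I -> M) :
  bract (\sum_(i <- r) F i) u = \sum_(i <- r) bract (F i) u.
Proof. by elim: r => [|i r IH]; rewrite ?big_nil ?bract0 // !big_cons bractD IH. Qed.
Lemma blact_suml x I (r : seq I) (F : I -> L) :
  blact (\sum_(i <- r) F i) x = \sum_(i <- r) blact (F i) x.
Proof. by elim: r => [|i r IH]; rewrite ?big_nil ?blact0l // !big_cons blactDl IH. Qed.
Lemma bract_sumr x I (r : seq I) (F : I -> L) :
  bract x (\sum_(i <- r) F i) = \sum_(i <- r) bract x (F i).
Proof. by elim: r => [|i r IH]; rewrite ?big_nil ?bract0r // !big_cons bractDr IH. Qed.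

End Bilinear.

Section Multiplication.
Variable M : bimodule L.
Local Notation X := (induced_bimodule M).

(** The action map L (x) M (x) L -> M, expanded in the basis. *)
Definition induced_mul (w : X) : M :=
  \sum_b \sum_d bract (blact (e b) ((w : {ffun B * B -> M}) (b, d))) (e d).

Lemma induced_mul_linear : linear induced_mul.
Proof.
move=> s w w'; rewrite /induced_mul scaler_sumr -big_split /=; apply: eq_bigr => b _.
rewrite scaler_sumr -big_split /=; apply: eq_bigr => d _.
by rewrite !ffunE blactD bractD blactZ bractZ.
Qed.

Lemma induced_mul_lact u w : induced_mul (blact u w) = blact u (induced_mul w).
Proof.
rewrite /induced_mul blact_sum exchange_big /=.
under [RHS]eq_bigr do rewrite blact_sum.
rewrite [RHS]exchange_big /=; apply: eq_bigr => d _.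
under eq_bigr do rewrite ffunE /= blact_sum bract_sum.
rewrite exchange_big /=; apply: eq_bigr => b _.
rewrite -lractA -blactM [in RHS](ec.1 (u * e b)) blact_suml bract_sum.
by apply: eq_bigr => i _; rewrite blactZ blactZl.
Qed.

Lemma induced_mul_ract w u : induced_mul (bract w u) = bract (induced_mul w) u.
Proof.
rewrite /induced_mul bract_sum; apply: eq_bigr => b _; rewrite bract_sum.
under eq_bigr do rewrite ffunE /= blact_sum bract_sum.
rewrite exchange_big /=; apply: eq_bigr => d _.
rewrite -bractM [in RHS](ec.1 (e d * u)) bract_sumr; apply: eq_bigr => i _.
by rewrite blactZ bractZ bractZr.
Qed.

Definition induced_mul_lin : {linear X -> M} :=
  HB.pack induced_mul (GRing.isLinear.Build k X M *:%R induced_mul induced_mul_linear).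

Definition induced_mul_hom : bimodule_hom X M :=
  @BimoduleHom k L X M induced_mul_lin induced_mul_lact induced_mul_ract.

Lemma induced_mul_surj : surj induced_mul_hom.
Proof.
(* These are the coordinates of 1 (x) x (x) 1. *)
move=> x; exists [ffun b => c b.1 1 *: (c b.2 1 *: x)].
rewrite /= /induced_mul -[RHS]blact1 -[in RHS](bract1 x).
rewrite [in RHS](ec.1 1) blact_suml; apply: eq_bigr => b _.
rewrite bract_sumr blact_sum; apply: eq_bigr => d _.
by rewrite ffunE /= bractZr blactZl !blactZ !bractZ lractA.
Qed.

End Multiplication.

(** A bimodule is a quotient of the one induced from its underlying vector space, so a projective
    one splits off; identities verified on the outer factors of L (x) P (x) L then descend to P. *)
Lemma projective_retract (P : bimodule L) : projective_bimodule P ->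
  exists u : bimodule_hom P (induced_bimodule P), forall x, induced_mul (u x) = x.
Proof.
move=> projP.
have idl x a : (idfun : {linear P -> P}) (blact a x) = blact a (idfun x) by [].
have idr x a : (idfun : {linear P -> P}) (bract x a) = bract (idfun x) a by [].
pose idP := @BimoduleHom k L P P idfun (fun a x => idl x a) idr.
exact: (projP _ _ _ idP (@induced_mul_surj P)).
Qed.

(** In the right module P / aP, the elements killed by a^j are multiples of a^(n+1-j). The splitting
    acts on the last tensor factor, hence commutes with the left action of [a], and the term a y
    stays in the image of [a]. *)
Lemma projective_mod_left (P : bimodule L) (n : nat) (a : L) j x y :
  cyclic_radical n a -> projective_bimodule P -> (j <= n.+1)%N ->
  bract x (a ^+ j) = blact a y :> P ->
  exists p q, x = blact a p + bract q (a ^+ (n.+1 - j)) :> P.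
Proof.
move=> ra /projective_retract[u uK] lej E.
have [s [t st]] := rad_split_r ra lej.
have: bract (u x) (a ^+ j) = blact a (u y) by rewrite -bfun_ract E bfun_lact.
set w := u x => {}E.
have wE : w = blact a (tensr t (u y) : induced_bimodule P) +
    bract (tensr s w : induced_bimodule P) (a ^+ (n.+1 - j)).
  rewrite /= in E *; rewrite tenslrC -E addrC.
  rewrite !tensr_comp; try exact: mulrr_linear; try exact: linearP.
  rewrite -[LHS]tensr_id -[X in X + _]scale1r; apply: tensr_lin => z.
  by rewrite scale1r {1}(st z).
exists (induced_mul (tensr t (u y) : induced_bimodule P)).
exists (induced_mul (tensr s w : induced_bimodule P)).
rewrite -[LHS]uK -/w {1}wE.
rewrite -[LHS]/(induced_mul_lin P _) linearD.
by rewrite -induced_mul_lact -induced_mul_ract.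
Qed.

Lemma projective_left_exact (P : bimodule L) (n : nat) (a : L) j x :
  cyclic_radical n a -> projective_bimodule P -> (j <= n.+1)%N ->
  blact (a ^+ j) x = 0 :> P -> exists y, x = blact (a ^+ (n.+1 - j)) y :> P.
Proof.
move=> ra /projective_retract[u uK] lej E.
have [s [t st]] := rad_split_l ra lej.
have: blact (a ^+ j) (u x) = 0 by rewrite -bfun_lact E linear0.
set w := u x => {}E.
have wE : w = blact (a ^+ (n.+1 - j)) (tensl s w : induced_bimodule P).
  have t0 : tensl t (0 : {ffun B * B -> P}) = 0.
    by apply/ffunP => b; rewrite !ffunE big1 // => i _; rewrite ffunE scaler0.
  rewrite -[RHS]addr0 -t0 -[in RHS]E /=.
  rewrite !tensl_comp; try exact: mulrl_linear; try exact: linearP.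
  rewrite -[LHS]tensl_id -[X in X + _]scale1r; apply: tensl_lin => z.
  by rewrite scale1r {1}(st z).
exists (induced_mul (tensl s w : induced_bimodule P)).
by rewrite -[LHS]uK -/w {1}wE induced_mul_lact.
Qed.

End InducedBimodule.

(** * Invertible bimodules as nondegenerate pairings *)

Section Invertible.
Variables (k : fieldType) (L : algType k).
Local Notation reg := (regular_bimodule L).

Lemma tensor_regular (I J : bimodule L) : tensor_isomorphic I J reg ->
  exists tau : I -> J -> reg, is_tensor tau.
Proof.
move=> [T [t [[[tl tr tb] tL tR tU] [f [g [fK gK]]]]]].
exists (fun x y => f (t x y)); split.
- split=> [y u x x'|x u y y'|x u y]; last by rewrite tb.
    by rewrite -linearP; congr (f _); exact: tl.
  by rewrite -linearP; congr (f _); exact: tr.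
- by move=> u x y; rewrite tL bfun_lact.
- by move=> x y u; rewrite tR bfun_ract.
- move=> V b bb; have [phi [phiE phiU]] := tU V b bb.
  exists (phi \o g : {linear _ -> _}); split=> [x y|psi psiE u]; first by rewrite /= fK.
  have /(_ (g u)) := phiU (psi \o f : {linear _ -> _}) psiE.
  by rewrite /= gK.
Qed.

Section Pairing.
Variables (I J : bimodule L) (tau : I -> J -> reg).
Hypothesis tauT : is_tensor tau.

(** The uniqueness half of the universal property: the values of [tau] span L. *)
Lemma tensor_ext (V : lmodType k) (f g : L -> V) : linear f -> linear g ->
  (forall x y, f (tau x y) = g (tau x y)) -> f =1 g.
Proof.
move=> lf lg E u; have [[tl tr tb] tL tR tU] := tauT.
have [|phi [_ phiU]] := tU V (fun x y => linear_of lf (tau x y)).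
  split=> [y c x x'|x c y y'|x c y]; last by rewrite tb.
    by rewrite -linearP; congr (linear_of lf _); exact: tl.
  by rewrite -linearP; congr (linear_of lf _); exact: tr.
have fE := phiU (linear_of lf) (fun x y => erefl).
have gE := phiU (linear_of lg) (fun x y => esym (E x y)).
exact: (etrans (fE u) (esym (gE u))).
Qed.

Lemma tensor_pairing0l y : tau 0 y = 0.
Proof.
have [[/(_ y) tl _ _] _ _ _] := tauT; exact: (linear0 (linear_of tl)).
Qed.

End Pairing.

(* If [I (x) J] and [J (x) I] are both identified with [L], the two resulting
   identifications of [I (x) J (x) I] with [I] differ by an endomorphism of [I]. *)
Lemma tensor_exchange (I J : bimodule L) (tau : I -> J -> reg) (tau' : J -> I -> reg) :
  is_tensor tau -> is_tensor tau' -> forall x, exists x0, forall y x',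
    blact (tau x y) x' = bract x0 (tau' y x').
Proof.
move=> [[tl tr tb] tL tR tU] T'; have [[tl' tr' tb'] tL' tR' tU'] := T'.
move=> x; have [|phi [phiE _]] := tU' I (fun y x' => blact (tau x y) x').
  split=> [x' c y y'|y c x' x''|y c x'].
  - by have /= -> := tr x c y y'; exact: blact_linear_l.
  - exact: blact_linear_r.
  - by rewrite tR blactM.
exists (phi 1) => y x'; rewrite -phiE.
suff E u : phi (u * tau' y x') = bract (phi u) (tau' y x') by rewrite -E mul1r.
apply: (@tensor_ext J I tau' T' I (fun u => phi (u * tau' y x'))
    (fun u => bract (phi u) (tau' y x'))) => [c v w|c v w|y' x''].
- by rewrite mulrDl -scalerAl linearP.
- by rewrite linearP bract_linear_l.
- by rewrite -[_ * _]/(bract (tau' y' x'') _) -tR' !phiE lractA.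
Qed.

Section InvertibleBimodule.
Variables (I J : bimodule L) (tau : I -> J -> reg) (tau' : J -> I -> reg).
Hypotheses (tauT : is_tensor tau) (tauT' : is_tensor tau').

(** Exchange gives tau'(y, z) y' = y0 tau(z, y') = 0, so tau'(y, z) annihilates J on the left, hence
    all values of [tau']; these span L, so tau'(y, z) = 0. A second exchange gives tau(x, y) z = x0
    tau'(y, z) = 0, and the values of [tau] span L as well. *)
Lemma tensor_nondegenerate z : (forall y, tau z y = 0) -> z = 0.
Proof.
move=> z0; have z0' y : tau' y z = 0.
  have [y0 y0E] := tensor_exchange tauT' tauT y.
  have E (y' : J) : blact (tau' y z) y' = 0 by rewrite y0E z0 bract0r.
  have [_ tL' _ _] := tauT'.
  rewrite -[LHS]mulr1.
  apply: (@tensor_ext J I tau' tauT' _ (fun u => tau' y z * u) (fun=> 0 : L)).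
  - by move=> c u v; rewrite mulrDr scalerAr.
  - by move=> c u v; rewrite scaler0 addr0.
  - move=> y' x'; rewrite -[LHS]/(blact (_ : L) (tau' y' x')) -tL' E.
    exact: tensor_pairing0l.
rewrite -[z]blact1.
apply: (@tensor_ext I J tau tauT _ (fun u => blact u z) (fun=> 0 : I)).
- exact: blact_linear_l.
- by move=> c u v; rewrite scaler0 addr0.
- move=> x y; have [x0 ->] := tensor_exchange tauT tauT' x.
  by rewrite z0' bract0r.
Qed.

Variables (n : nat) (a : L).
Hypothesis ra : cyclic_radical n a.

(** Each further factor contributes a power of [a]: balance turns tau(x a, y) into tau(x, a y),
    exchange produces tau'(a y, x' a^(p+1)) = a tau'(y, x') a^(p+1), and normality of [a] carries
    the outer [a] to the right. *)
Lemma tensor_rad_nilpotent x y p :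
  exists x', tau (bract x a) y ^+ p.+1 = tau (bract x' (a ^+ p.+1)) y :> L.
Proof.
have [[tl tr tb] tL tR tU] := tauT; have [_ tL' tR' _] := tauT'.
elim: p => [|p [x' IH]]; first by exists x; rewrite !expr1.
have [x0 x0E] := tensor_exchange tauT tauT' x.
have [u uE] := rad_mull ra (tau' y x'); exists (bract x0 u).
rewrite exprS IH -[LHS]/(blact (_ : L) (tau _ y)) -tL tb.
by rewrite x0E tL' tR' /= mulrA uE -mulrA -exprS bractM.
Qed.

Lemma tensor_rad x y : exists u, tau (bract x a) y = a * u :> L.
Proof.
apply: (nilpotent_rad ra (p := n.+1)).
have [x' ->] := tensor_rad_nilpotent x y n.
by rewrite (radX0 ra) bract0r tensor_pairing0l.
Qed.

(** The pairing is nondegenerate and a^n tau(x a, y) lies in a^(n+1) L. Once I satisfies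
    [rad_exact], this puts I a into a I, so that I / aI is semisimple. *)
Lemma invertible_soc x : blact (a ^+ n) (bract x a) = 0 :> I.
Proof.
have [_ tL _ _] := tauT; apply: tensor_nondegenerate => y; rewrite tL.
by have [u ->] := tensor_rad x y; rewrite /= mulrA -exprSr (radX0 ra) mul0r.
Qed.

End InvertibleBimodule.
End Invertible.

(** * Three syzygies of the regular bimodule, modulo the radical *)

Section Syzygies.
Variables (k : fieldType) (L : algType k) (n : nat) (a : L).
Hypothesis ra : cyclic_radical n a.
Hypothesis n_gt1 : (1 < n)%N.
Hypothesis L_basis : exists (B : finType) (e : B -> L) (c : B -> {scalar L}),
  basis_of_alg e c.
Local Notation reg := (regular_bimodule L).

(* The vanishing of the Tor groups of [L / aL] with the left module [M]. *)
Definition rad_exact (M : bimodule L) : Prop :=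
  (forall x : M, blact a x = 0 -> exists y, x = blact (a ^+ n) y) /\
  (forall x : M, blact (a ^+ n) x = 0 -> exists y, x = blact a y).

Lemma rad_exact_regular : rad_exact reg.
Proof.
split=> x /= x0.
  have [s [t /(_ x)]] := rad_split_l ra (isT : (1 <= n.+1)%N).
  by rewrite expr1 x0 linear0 addr0 subSS subn0 => ?; exists (s x).
have [s [t /(_ x)]] := rad_split_l ra (leqnSn n).
by rewrite x0 linear0 addr0 subSnn expr1 => ?; exists (s x).
Qed.

Lemma rad_exact_projective P : projective_bimodule P -> rad_exact P.
Proof.
have [B [e [c ec]]] := L_basis; move=> projP; split=> x x0.
  have := @projective_left_exact _ _ _ _ _ ec P n a 1 x ra projP isT.
  by rewrite expr1 subSS subn0; apply.
have := @projective_left_exact _ _ _ _ _ ec P n a n x ra projP (leqnSn n) x0.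
by rewrite subSnn expr1.
Qed.

Lemma projective_mod_rad (P : bimodule L) j (x y : P) : projective_bimodule P -> (j <= n.+1)%N ->
  bract x (a ^+ j) = blact a y ->
  exists p q, x = blact a p + bract q (a ^+ (n.+1 - j)).
Proof.
have [B [e [c ec]]] := L_basis => projP lej E.
exact: (projective_mod_left ec ra projP lej E).
Qed.

Lemma rad_proper u : 1 = a * u -> False.
Proof.
move=> E; have /esym/eqP : a ^+ n.+1 * u ^+ n.+1 = 1.
  elim: n.+1 => [|j IH]; first by rewrite mulr1.
  by rewrite exprSr exprS mulrA -(mulrA _ a) -E mulr1.
by rewrite (radX0 ra) mul0r oner_eq0.
Qed.

Definition bimodule_norm (M : bimodule L) (x : M) : M :=
  \sum_(l < n.+1) blact (a ^+ l) (bract x (a ^+ (n - l))).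

Lemma norm_hom (M N : bimodule L) (f : bimodule_hom M N) x :
  f (bimodule_norm x) = bimodule_norm (f x).
Proof. by rewrite linear_sum; apply: eq_bigr => l _; rewrite bfun_lact bfun_ract. Qed.

(** Both composites of the norm with the commutator reduce to this sum, whose two ends carry
    a^(n+1). *)
Lemma norm_telescope (M : bimodule L) (x : M) :
  \sum_(l < n.+1) (blact (a ^+ l) (bract x (a ^+ (n.+1 - l))) -
                   blact (a ^+ l.+1) (bract x (a ^+ (n - l)))) = 0.
Proof.
pose F l := - blact (a ^+ l) (bract x (a ^+ (n.+1 - l))).
transitivity (\sum_(0 <= l < n.+1) (F l.+1 - F l)).
  by rewrite big_mkord; apply: eq_bigr => l _; rewrite /F opprK subSS addrC.
rewrite telescope_sumr // /F subn0 (radX0 ra) bract0r blact0 blact0l.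
by rewrite oppr0 subrr.
Qed.

Lemma norm_commutator (M : bimodule L) (x : M) :
  bimodule_norm (bract x a - blact a x) = 0.
Proof.
rewrite -[RHS](norm_telescope x); apply: eq_bigr => l _.
rewrite bractB blactB -bractM -exprS -subSn ?leq_ord // lractA -blactM -exprSr.
by [].
Qed.

Lemma norm_commute (M : bimodule L) (x : M) :
  bract (bimodule_norm x) a = blact a (bimodule_norm x).
Proof.
apply/subr0_eq; rewrite -[RHS](norm_telescope x) bract_sum blact_sum -sumrB.
apply: eq_bigr => l _.
by rewrite lractA -bractM -exprSr -subSn ?leq_ord // -blactM -exprS.
Qed.

Lemma norm_mod (M : bimodule L) (x : M) :
  exists w, bimodule_norm x = bract x (a ^+ n) + blact a w.
Proof.
exists (\sum_(l < n) blact (a ^+ l) (bract x (a ^+ (n - l.+1)))).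
rewrite /bimodule_norm big_ord_recl expr0 blact1 subn0 blact_sum; congr (_ + _).
by apply: eq_bigr => l _; rewrite -blactM -exprS.
Qed.

Section Step.
Variables (M K P : bimodule L) (i : bimodule_hom K P) (p : bimodule_hom P M).
Hypotheses (projP : projective_bimodule P) (i_inj : injective i) (p_surj : surj p).
Hypothesis exact : forall x, p x = 0 <-> exists y, i y = x.
Hypothesis exM : rad_exact M.

(** If i x = a y, then p y is killed by [a], hence of the form a^n u; subtracting a lift of it moves
    y into K without changing a y. This is the injectivity of K / aK -> P / aP, the vanishing of
    Tor_1. *)
Lemma syzygy_cap x y : i x = blact a y -> exists z, x = blact a z.
Proof.
move=> E; have /exM.1[u uE] : blact a (p y) = 0.
  by rewrite -bfun_lact -E; apply/exact; exists x.
have [v vE] := p_surj u; have /exact[w wE] : p (y - blact (a ^+ n) v) = 0.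
  by rewrite linearB /= bfun_lact vE uE subrr.
exists w; apply: i_inj; rewrite bfun_lact wE blactB -blactM -exprS (radX0 ra).
by rewrite blact0l subr0.
Qed.

Lemma syzygy_capX x y : i x = blact (a ^+ n) y -> exists z, x = blact (a ^+ n) z.
Proof.
move=> E; have /exM.2[u uE] : blact (a ^+ n) (p y) = 0.
  by rewrite -bfun_lact -E; apply/exact; exists x.
have [v vE] := p_surj u; have /exact[w wE] : p (y - blact a v) = 0.
  by rewrite linearB /= bfun_lact vE uE subrr.
exists w; apply: i_inj; rewrite bfun_lact wE blactB -blactM -exprSr (radX0 ra).
by rewrite blact0l subr0.
Qed.

Lemma rad_exact_syzygy : rad_exact K.
Proof.
have [P1 P2] := rad_exact_projective projP; split=> x x0.
  have /P1[y] : blact a (i x) = 0 by rewrite -bfun_lact x0 linear0.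
  exact: syzygy_capX.
have /P2[y] : blact (a ^+ n) (i x) = 0 by rewrite -bfun_lact x0 linear0.
exact: syzygy_cap.
Qed.

End Step.

(* A property of the right module [M / aM] that holds for projective modules and is
   invariant under stable isomorphism, but fails for the third syzygy of [L / aL]. *)
Definition rad_torsion_divisible (M : bimodule L) : Prop :=
  forall x z : M, bract x (a ^+ n) = blact a z ->
  exists y z', bract x a = bract y (a ^+ 2) + blact a z'.

(** The elements [v1], [v2], [x] come from 1 by commutator, norm and commutator, each followed by a
    lift to the next projective. If x a were divisible by a^2 modulo a N3, then division in P3, P2
    and P1, by the powers 2, n - 1 and 2 of [a], would push the relation back along the resolution
    until 1 falls into aL. *)
Lemma third_syzygy_not_divisible (N1 N2 N3 : bimodule L) :
  is_syzygy1 reg N1 -> is_syzygy1 N1 N2 -> is_syzygy1 N2 N3 ->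
  rad_exact N3 /\ ~ rad_torsion_divisible N3.
Proof.
move=> [P1 [i1 [p1 [proj1 inj1 surj1 ex1]]]] [P2 [i2 [p2 [proj2 inj2 surj2 ex2]]]].
move=> [P3 [i3 [p3 [proj3 inj3 surj3 ex3]]]].
have exN1 := rad_exact_syzygy proj1 inj1 surj1 ex1 rad_exact_regular.
have exN2 := rad_exact_syzygy proj2 inj2 surj2 ex2 exN1.
split; first exact: rad_exact_syzygy proj3 inj3 surj3 ex3 exN2.
move=> div.
have pi1 x : p1 (i1 x) = 0 by apply/ex1; exists x.
have pi2 x : p2 (i2 x) = 0 by apply/ex2; exists x.
have pi3 x : p3 (i3 x) = 0 by apply/ex3; exists x.
have [g1 g1E] := surj1 1.
have /ex1[v1 v1E] : p1 (bract g1 a - blact a g1) = 0.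
  by rewrite linearB /= bfun_ract bfun_lact g1E /= mul1r mulr1 subrr.
have [g2 g2E] := surj2 v1.
have /ex2[v2 v2E] : p2 (bimodule_norm g2) = 0.
  rewrite norm_hom g2E; apply: inj1.
  by rewrite norm_hom v1E norm_commutator linear0.
have [g3 g3E] := surj3 v2.
have /ex3[x xE] : p3 (bract g3 a - blact a g3) = 0.
  rewrite linearB /= bfun_ract bfun_lact g3E; apply: inj2.
  by rewrite linearB /= bfun_ract bfun_lact v2E linear0 norm_commute subrr.
(* In P3 the element x a^n becomes - a g3 a^n, since g3 a^(n+1) = 0. *)
have [z zE] : exists z, bract x (a ^+ n) = blact a z.
  apply: (syzygy_cap inj3 surj3 ex3 exN2 (y := - bract g3 (a ^+ n))).
  rewrite bfun_ract xE bractB -bractM -exprS (radX0 ra) bract0r sub0r.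
  by rewrite blactN lractA.
have [y [z' yE]] := div _ _ zE.
(* The assumed divisibility says that (g3 - y) a^2 lies in a P3. *)
have [] := @projective_mod_rad _ 2 (g3 - i3 y) (bract g3 a + i3 z') proj3 _ _.
- by rewrite ltnS ltnW.
- have := congr1 i3 yE; rewrite linearD /= !bfun_ract bfun_lact xE !bractB -bractM -expr2.
  move/eqP; rewrite subr_eq => /eqP ->.
  by rewrite lractA [RHS]blactD addrC !addrA addNr add0r addrC.
move=> p [q] /(congr1 p3); rewrite linearB /= pi3 subr0 g3E linearD /= bfun_lact bfun_ract.
move/(congr1 i2); rewrite v2E linearD /= bfun_lact bfun_ract.
(* Modulo [a] the norm of [g2] is g2 a^n, so the relation for [v2] says that (g2 a - r) a^(n-1) lies
   in a P2. *)
have [w ->] := norm_mod g2; set r := i2 (p3 q) => rE.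
have [] := @projective_mod_rad _ n.-1 (bract g2 a - r) (i2 (p3 p) - w) proj2 _ _.
- by rewrite (leq_trans (leq_pred n)).
- rewrite bractB -bractM -exprS prednK ?(ltnW n_gt1) // blactB.
  move: rE => /eqP; rewrite subSS subn1 -subr_eq => /eqP <-.
  by rewrite [in RHS]addrAC addrK.
move=> p' [q'] /(congr1 p2); rewrite linearB /= pi2 subr0 bfun_ract g2E.
rewrite linearD /= bfun_lact bfun_ract.
move/(congr1 i1); rewrite bfun_ract v1E linearD /= bfun_lact bfun_ract.
have -> : (n.+1 - n.-1 = 2)%N by case: (n) n_gt1 => // n' _; rewrite /= subSn // subSnn.
set r1 := i1 (p2 q') => r1E.
(* Writing [v1] as g1 a - a g1 puts (g1 - r1) a^2 into a P1. *)
have [] := @projective_mod_rad _ 2 (g1 - r1) (i1 (p2 p') + bract g1 a) proj1 _ _.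
- by rewrite ltnS ltnW.
- move: r1E; rewrite !bractB -bractM -expr2 blactD lractA.
  by move/(canRL (subrK _)) ->; rewrite addrAC addrK.
move=> p'' [q''] /(congr1 p1); rewrite linearB /= pi1 subr0 g1E linearD /= bfun_lact bfun_ract.
(* The relation now puts 1 into aL + L a^(n-1), which is contained in aL because n - 1 is
   positive. *)
have -> : (n.+1 - 2 = (n - 2).+1)%N by rewrite subSn.
rewrite /= exprSr mulrA; have [u ->] := rad_mulr ra (p1 q'' * a ^+ (n - 2)).
rewrite -mulrDr; exact: rad_proper.
Qed.

Lemma rad_exact_stable (M N : bimodule L) :
  stably_isomorphic M N -> rad_exact M -> rad_exact N.
Proof.
move=> [f [g [_ [P [u [v [projP E]]]]]]] [M1 M2].
have {E}E x : x = f (g x) - v (u x) by rewrite -E /= opprB addrC subrK.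
have [P1 P2] := rad_exact_projective projP; split=> x x0.
  have /M1[y yE] : blact a (g x) = 0 by rewrite -bfun_lact x0 linear0.
  have /P1[z zE] : blact a (u x) = 0 by rewrite -bfun_lact x0 linear0.
  by exists (f y - v z); rewrite blactB -!bfun_lact -yE -zE.
have /M2[y yE] : blact (a ^+ n) (g x) = 0 by rewrite -bfun_lact x0 linear0.
have /P2[z zE] : blact (a ^+ n) (u x) = 0 by rewrite -bfun_lact x0 linear0.
by exists (f y - v z); rewrite blactB -!bfun_lact -yE -zE.
Qed.

Lemma third_syzygy_not_invertible (K I : bimodule L) :
  is_syzygy 3 reg K -> invertible_bimodule I -> ~ stably_isomorphic K I.
Proof.
move=> [N1 [s1 [N2 [s2 [N3 [s3 [t [t' [tK tK']]]]]]]]] [J [IJ JI]] KI.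
have [exN ndiv] := third_syzygy_not_divisible s1 s2 s3.
have exK : rad_exact K.
  by split=> x x0; [have [|y yE] := exN.1 (t' x)|have [|y yE] := exN.2 (t' x)];
    rewrite -?bfun_lact ?x0 ?linear0 //; exists (t y);
    rewrite -bfun_lact -yE tK'.
have [_ exI] := rad_exact_stable KI exK.
have [tau tauT] := tensor_regular IJ; have [tau' tauT'] := tensor_regular JI.
have I_rad x : exists y, bract x a = blact a y :> I.
  exact/exI/(invertible_soc tauT tauT' ra).
have [f [g [[P [u [v [projP E]]]] _]]] := KI.
have {E}E x : x = g (f x) - v (u x) by rewrite -E /= opprB addrC subrK.
(* Divisibility holds in the projective P, and also in I, where every x a lies in a I; the formula x
   = g (f x) - v (u x) carries it over to K, and [t'] to the syzygy. *)
apply: ndiv => x z xz.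
have [] := @projective_mod_rad P n (u (t x)) (u (t z)) projP (leqnSn n) _.
  by rewrite -!bfun_ract xz -!bfun_lact.
rewrite subSnn expr1 => p [q uE].
have [y yE] := I_rad (f (t x)).
exists (t' (- v q)), (t' (g y - bract (v p) a)).
rewrite -bfun_ract -bfun_lact -linearD /= -[LHS]tK bfun_ract; congr (t' _).
rewrite [t x]E bractB -[bract (g _) a]bfun_ract -[bract (v _) a]bfun_ract yE uE.
rewrite bractD linearD /= lractA -bractM -expr2 !bfun_lact !bfun_ract bractN blactB.
by rewrite opprD addrA [RHS]addrC.
Qed.

End Syzygies.

Local Open Scope klin_scope.

(** * Cones in linear categories *)

#[global] Instance heq_equivalence (k : fieldType) (C : klincat k) (X Y : C) :
  Equivalence (@heq k C X Y).
Proof.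
by split; [exact: heq_refl | exact: heq_sym | move=> f g h; exact: heq_trans].
Qed.

#[global] Instance hcomp_proper (k : fieldType) (C : klincat k) (X Y Z : C) :
  Proper (@heq k C Y Z ==> @heq k C X Y ==> @heq k C X Z) (@hcomp k C X Y Z).
Proof. by move=> g g' gg' f f' ff'; exact: heq_comp. Qed.

#[global] Instance hadd_proper (k : fieldType) (C : klincat k) (X Y : C) :
  Proper (@heq k C X Y ==> @heq k C X Y ==> @heq k C X Y) (@hadd k C X Y).
Proof. by move=> g g' gg' f f' ff'; exact: heq_add. Qed.

#[global] Instance hscale_proper (k : fieldType) (C : klincat k) (X Y : C) a :
  Proper (@heq k C X Y ==> @heq k C X Y) (@hscale k C X Y a).
Proof. by move=> f f' ff'; exact: heq_scale. Qed.

#[global] Instance fhom_proper (k : fieldType) (C D : klincat k) (F : klinfunctor C D)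
  (X Y : C) : Proper (@heq k C X Y ==> @heq k D (F X) (F Y)) (@fhom k C D F X Y).
Proof. by move=> f f' ff'; exact: fhom_eq. Qed.

#[global] Hint Resolve heq_refl : core.

Section Basics.
Variables (k : fieldType) (C : klincat k).
Implicit Types X Y Z : C.

Lemma hcomp0f X Y Z (f : mor C X Y) : hzero Y Z ∘ f ≡ hzero X Z.
Proof. by rewrite -(hscale0f (hzero Y Z)) hcompZl hscale0f. Qed.

Lemma hcompf0 X Y Z (g : mor C Y Z) : g ∘ hzero X Y ≡ hzero X Z.
Proof. by rewrite -(hscale0f (hzero X Y)) hcompZr hscale0f. Qed.

Lemma haddf0 X Y (f : mor C X Y) : hadd f (hzero X Y) ≡ f.
Proof. by rewrite haddC hadd0f. Qed.

Lemma haddfN X Y (f : mor C X Y) : hadd f (hscale (-1) f) ≡ hzero X Y.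
Proof. by rewrite -{1}(hscale1f f) -hscaleDl subrr hscale0f. Qed.

Lemma haddNf X Y (f : mor C X Y) : hadd (hscale (-1) f) f ≡ hzero X Y.
Proof. by rewrite haddC haddfN. Qed.

Lemma hscalef0 X Y a : hscale a (hzero X Y) ≡ hzero X Y.
Proof. by rewrite -(hscale0f (hzero X Y)) hscaleA mulr0. Qed.

Lemma hscaleN_eq0 X Y (f : mor C X Y) : hscale (-1) f ≡ hzero X Y -> f ≡ hzero X Y.
Proof. by move=> E; rewrite -(hscale1f f) -[1](opprK 1) -mulN1r -hscaleA E hscalef0. Qed.


Lemma iso_inv X Y (f : mor C X Y) : is_iso f ->
  exists2 g : mor C Y X, is_iso g & g ∘ f ≡ hid X /\ f ∘ g ≡ hid Y.
Proof. by move=> [g [gf fg]]; exists g => //; exists f. Qed.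

Lemma iso_cancel_l X Y Z (f : mor C Y Z) (g h : mor C X Y) :
  is_iso f -> f ∘ g ≡ f ∘ h -> g ≡ h.
Proof.
by move=> [f' [f'f _]] E; rewrite -(hcomp1f g) -(hcomp1f h) -f'f -!hcompA E.
Qed.

Lemma iso_cancel_r X Y Z (f : mor C X Y) (g h : mor C Y Z) :
  is_iso f -> g ∘ f ≡ h ∘ f -> g ≡ h.
Proof.
by move=> [f' [_ ff']] E; rewrite -(hcompf1 g) -(hcompf1 h) -ff' !hcompA E.
Qed.

Lemma iso_id X : is_iso (hid X).
Proof. by exists (hid X); split; rewrite hcomp1f. Qed.

Lemma iso_comp X Y Z (g : mor C Y Z) (f : mor C X Y) :
  is_iso g -> is_iso f -> is_iso (g ∘ f).
Proof.
move=> [g' [g'g gg']] [f' [f'f ff']]; exists (f' ∘ g'); split.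
  by rewrite -hcompA (hcompA g') g'g hcomp1f.
by rewrite -hcompA (hcompA f) ff' hcomp1f.
Qed.

Lemma zero_object_from X Z (f g : mor C Z X) : zero_object Z -> f ≡ g.
Proof. by move=> Z0; rewrite -(hcompf1 f) -(hcompf1 g) Z0 !hcompf0. Qed.

End Basics.

Section Functors.
Variable k : fieldType.

Lemma fhom0 (C D : klincat k) (F : klinfunctor C D) X Y :
  fhom F (hzero X Y) ≡ hzero (F X) (F Y).
Proof. by rewrite -(hscale0f (hzero X Y)) fhom_scale hscale0f. Qed.

Lemma fhom_iso (C D : klincat k) (F : klinfunctor C D) X Y (f : mor C X Y) :
  is_iso f -> is_iso (fhom F f).
Proof.
by move=> [g [gf fg]]; exists (fhom F g); split; rewrite -fhom_comp ?gf ?fg fhom_id.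
Qed.

Definition fully_faithful (C D : klincat k) (F : klinfunctor C D) : Prop :=
  (forall X Y (f g : mor C X Y), fhom F f ≡ fhom F g -> f ≡ g) /\
  (forall X Y (h : mor D (F X) (F Y)), exists f, fhom F f ≡ h).

Definition essentially_surjective (C D : klincat k) (F : klinfunctor C D) : Prop :=
  forall Y, exists X (f : mor D (F X) Y), is_iso f.

Lemma natural_iso_inv (C D : klincat k) (F G : klinfunctor C D)
    (t : forall X, mor D (F X) (G X)) :
  (forall X, is_iso (t X)) ->
  (forall X Y (f : mor C X Y), t Y ∘ fhom F f ≡ fhom G f ∘ t X) ->
  exists u : forall X, mor D (G X) (F X),
    (forall X, is_iso (u X)) /\
    (forall X Y (f : mor C X Y), u Y ∘ fhom G f ≡ fhom F f ∘ u X).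
Proof.
move=> tI tN; pose u X := proj1_sig (constructive_indefinite_description _ (tI X)).
have uK X : inverse_of (t X) (u X) := proj2_sig (constructive_indefinite_description _ (tI X)).
exists u; split=> [X|X Y f]; first by have [ut tu] := uK X; exists (t X).
have [_ tuX] := uK X; have [utY _] := uK Y.
by rewrite -{1}(hcompf1 (fhom G f)) -tuX (hcompA (fhom G f)) -tN !hcompA utY hcomp1f.
Qed.

Definition id_functor (C : klincat k) : klinfunctor C C :=
  @KLinFunctor k C C id (fun X Y f => f) (fun X Y f g e => e) (fun X => heq_refl _)
    (fun X Y Z g f => heq_refl _) (fun X Y f g => heq_refl _) (fun X Y a f => heq_refl _).

Definition comp_functor (C D E : klincat k) (G : klinfunctor D E) (F : klinfunctor C D) :
  klinfunctor C E.
Proof.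
refine (@KLinFunctor k C E (fun X => G (F X)) (fun X Y f => fhom G (fhom F f)) _ _ _ _ _).
- by move=> X Y f g fg; rewrite fg.
- by move=> X; rewrite !fhom_id.
- by move=> X Y Z g f; rewrite !fhom_comp.
- by move=> X Y f g; rewrite !fhom_add.
- by move=> X Y a f; rewrite !fhom_scale.
Defined.

Lemma unit_faithful (C D : klincat k) (F : klinfunctor C D) (G : klinfunctor D C)
    (eta : forall X, mor C X (G (F X))) :
  (forall X, is_iso (eta X)) ->
  (forall X Y (f : mor C X Y), eta Y ∘ f ≡ fhom G (fhom F f) ∘ eta X) ->
  forall X Y (f g : mor C X Y), fhom F f ≡ fhom F g -> f ≡ g.
Proof. by move=> I N X Y f g E; apply: (iso_cancel_l (I Y)); rewrite !N E. Qed.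

Lemma is_equivalence_inv (C D : klincat k) (F : klinfunctor C D) :
  is_equivalence F -> exists2 G : klinfunctor D C, is_equivalence G &
    exists eps : forall Y, mor D (F (G Y)) Y,
      (forall Y, is_iso (eps Y)) /\
      (forall X Y (f : mor D X Y), eps Y ∘ fhom F (fhom G f) ≡ f ∘ eps X).
Proof.
move=> [G [[eta [etaI etaN]] [eps [epsI epsN]]]]; exists G; last by exists eps.
exists F; split.
  exact: (@natural_iso_inv D D (comp_functor F G) (id_functor D) eps epsI epsN).
exact: (@natural_iso_inv C C (id_functor C) (comp_functor G F) eta etaI etaN).
Qed.

(** The preimage of h is G h conjugated by the unit; by naturality its image under F agrees with h
    after applying G, which is faithful because of the counit. *)
Lemma equivalence_fully_faithful (C D : klincat k) (F : klinfunctor C D) :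
  is_equivalence F -> fully_faithful F.
Proof.
move=> [G [[eta [etaI etaN]] [eps [epsI epsN]]]].
have G_faithful X Y (f g : mor D X Y) : fhom G f ≡ fhom G g -> f ≡ g.
  by move=> E; apply: (iso_cancel_r (epsI X)); rewrite -!epsN E.
split=> [|X Y h]; first exact: unit_faithful etaI etaN.
have [g _ [gK Kg]] := iso_inv (etaI Y).
exists (g ∘ (fhom G h ∘ eta X)); apply: G_faithful; apply: (iso_cancel_r (etaI X)).
by rewrite -etaN !hcompA Kg hcomp1f.
Qed.

Lemma equivalence_essentially_surjective (C D : klincat k) (F : klinfunctor C D) :
  is_equivalence F -> essentially_surjective F.
Proof. by move=> [G [_ [eps [epsI _]]]] Y; exists (G Y), (eps Y). Qed.

End Functors.

(** * Weakly triangulated categories and their transport *)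

Section Cones.
Variable k : fieldType.

(** The factorization clauses concern maps into an arbitrary V. Left fractions deliver them in this
    form, since such a map is represented by a map of dg modules after enlarging V. *)
Definition cone_triangle (C : klincat k) (S : klinfunctor C C) (X Y Z : C)
    (f : mor C X Y) (g : mor C Y Z) (h : mor C Z (S X)) : Prop :=
  [/\ g ∘ f ≡ hzero X Z, fhom S f ∘ h ≡ hzero Z (S Y),
      forall V (u : mor C Z V), u ∘ g ≡ hzero Y V -> exists v, u ≡ v ∘ h
    & forall V (u : mor C (S X) V), u ∘ h ≡ hzero Z V -> exists v, u ≡ v ∘ fhom S f].

Definition has_cones (C : klincat k) (S : klinfunctor C C) : Prop :=
  forall (X Y : C) (f : mor C X Y), exists Z g h, @cone_triangle C S X Y Z f g h.

(** The common ground of the two negative statements on projective modules: it follows from a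
    triangulation, holds for the compact objects of a derived category, and is invariant under
    equivalence. *)
Definition weakly_triangulated (C : klincat k) : Prop :=
  exists S : klinfunctor C C, [/\ fully_faithful S, essentially_surjective S & has_cones S].

Section Triangulation.
Variables (T : klincat k) (t : triangulation T).
Local Notation S := (shift t).
Local Notation dist := (@dist k T t _ _ _).

Lemma dist_comp0 (X Y Z : T) (f : mor T X Y) (g : mor T Y Z) (h : mor T Z (S X)) :
  dist f g h -> g ∘ f ≡ hzero X Z.
Proof.
move=> fgh; have [Z0 Z00] := (tri_additive t).1.
have [|c [cE _]] := TR3 (TR1_id t X Z00) fgh (a := hid X) (b := f); first by [].
by rewrite -cE hcompf0.
Qed.

(** TR3 compares the triangle with Z0 -> V -> V -> S Z0; the third component of the comparison is
    the factorization. *)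
Lemma dist_extend (X Y Z V : T) (f : mor T X Y) (g : mor T Y Z) (h : mor T Z (S X))
    (u : mor T Y V) : dist f g h -> u ∘ f ≡ hzero X V -> exists v, u ≡ v ∘ g.
Proof.
move=> fgh uf0; have [Z0 Z00] := (tri_additive t).1.
have SZ0 : zero_object (S Z0) by rewrite /zero_object -fhom_id Z00 fhom0.
(* This is the triangle on the identity of V rotated backwards, S Z0 being again a zero object. *)
have tri0 : dist (hzero Z0 V) (hid V) (hzero V (S Z0)).
  apply/TR2; apply: TR1_iso (iso_id V) (iso_id V) (iso_id (S Z0)) _ _ _ (TR1_id t V SZ0).
  - by [].
  - by rewrite hcomp1f hcompf1.
  - exact: zero_object_from.
have [|c [cE _]] := TR3 fgh tri0 (a := hzero X Z0) (b := u).
  by rewrite uf0 hcompf0.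
by exists c; rewrite cE hcomp1f.
Qed.

Lemma triangulation_weakly_triangulated : weakly_triangulated T.
Proof.
exists S; split.
- exact: equivalence_fully_faithful (shift_equiv t).
- exact: equivalence_essentially_surjective (shift_equiv t).
move=> X Y f; have [Z [g [h fgh]]] := TR1_cone t f; exists Z, g, h.
have gh := (TR2 _ _ _).1 fgh; have hf := (TR2 _ _ _).1 gh; split.
- exact: dist_comp0 fgh.
- by apply: hscaleN_eq0; rewrite -hcompZl (dist_comp0 hf).
- by move=> V u; exact: (dist_extend gh).
(* The doubly rotated triangle contains -S f; the sign is moved into the factor. *)
- move=> V u /(dist_extend hf)[v vE]; exists (hscale (-1) v).
  by rewrite vE hcompZr hcompZl.
Qed.

End Triangulation.

(** The shift becomes F S G, and the cone of f is F of a cone of G f, with [e : Y -> F (G Y)]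
    correcting the first map. A map out of F W is, up to an isomorphism of its target, F of a map,
    so factorizations can be found in C. *)
Lemma equivalent_weakly_triangulated (C D : klincat k) :
  equivalent_cats C D -> weakly_triangulated C -> weakly_triangulated D.
Proof.
move=> [F Feq] [S [[Sf SF] Ss Sc]].
have [Ff FF] := equivalence_fully_faithful Feq.
have Fs := equivalence_essentially_surjective Feq.
have [G Geq [eps [epsI epsN]]] := is_equivalence_inv Feq.
have [Gf GF] := equivalence_fully_faithful Geq.
have Gs := equivalence_essentially_surjective Geq.
exists (comp_functor F (comp_functor S G)); split; first split.
- by move=> X Y f g /= /Ff/Sf/Gf.
- move=> X Y h /=; have [h1 h1E] := FF _ _ h; have [h2 h2E] := SF _ _ h1.
  by have [h3 h3E] := GF _ _ h2; exists h3; rewrite h3E h2E h1E.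
- move=> Y; have [Y1 [y1 y1I]] := Fs Y; have [Y2 [y2 y2I]] := Ss Y1.
  have [Y3 [y3 y3I]] := Gs Y2; exists Y3, (y1 ∘ fhom F (y2 ∘ fhom S y3)).
  by apply: iso_comp y1I _; apply/fhom_iso/(iso_comp y2I)/fhom_iso.
move=> X Y f; have [Z [g [h [gf fh exZ exS]]]] := Sc _ _ (fhom G f).
have [e _ [eK Ke]] := iso_inv (epsI Y).
have [eX _ [eXK KeX]] := iso_inv (epsI X).
have lift W V (u : mor D (F W) V) :
    exists V0 (v : mor D (F V0) V) u0, u ≡ v ∘ fhom F u0 /\ is_iso v.
  have [V0 [v vI]] := Fs V; have [v' _ [_ vv']] := iso_inv vI.
  have [u0 u0E] := FF _ _ (v' ∘ u); exists V0, v, u0; split=> //.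
  by rewrite u0E hcompA vv' hcomp1f.
exists (F Z), (fhom F g ∘ e), (fhom F h); split.
- have fE : e ∘ f ≡ fhom F (fhom G f) ∘ eX.
    by apply: (iso_cancel_l (epsI Y)); rewrite !hcompA Ke hcomp1f epsN -hcompA KeX hcompf1.
  by rewrite -hcompA fE hcompA -fhom_comp gf fhom0 hcomp0f.
- by rewrite /= -fhom_comp fh fhom0.
- move=> V u; have [V0 [v [u0 [uE vI]]]] := lift _ _ u => E.
  have {}E : (v ∘ fhom F u0) ∘ (fhom F g ∘ e) ≡ hzero _ _ by rewrite -uE.
  have [|w wE] := exZ _ u0; last by exists (v ∘ fhom F w); rewrite uE wE fhom_comp hcompA.
  apply: Ff; apply: (iso_cancel_l vI); apply: (iso_cancel_r (f := e)); first by exists (eps Y).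
  by rewrite fhom_comp hcompA -hcompA E fhom0 hcompf0 hcomp0f.
- move=> V u; have [V0 [v [u0 [uE vI]]]] := lift _ _ u => E.
  have {}E : (v ∘ fhom F u0) ∘ fhom F h ≡ hzero _ _ by rewrite -uE.
  have [|w wE] := exS _ u0; last by exists (v ∘ fhom F w); rewrite uE wE fhom_comp hcompA.
  apply: Ff; apply: (iso_cancel_l vI).
  by rewrite fhom_comp hcompA E fhom0 hcompf0.
Qed.

(** * Coproducts and compact objects *)

Section Coproducts.
Variables (C : klincat k).
Lemma hsum_cat (X Z : C) (r s : seq (mor C X Z)) : hsum (r ++ s) ≡ hadd (hsum r) (hsum s).
Proof. by elim: r => [|f r IH] /=; rewrite ?hadd0f // IH haddA. Qed.

Lemma hsum_comp (A : Type) (X W Z : C) (u : A -> mor C W Z) (f : mor C X W) (s : seq A) :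
  hsum [seq u i | i <- s] ∘ f ≡ hsum [seq u i ∘ f | i <- s].
Proof. by elim: s => [|i s IH] /=; rewrite ?hcomp0f // hcompDl IH. Qed.

Lemma comp_hsum (A : Type) (X W Z : C) (f : mor C W Z) (u : A -> mor C X W) (s : seq A) :
  f ∘ hsum [seq u i | i <- s] ≡ hsum [seq f ∘ u i | i <- s].
Proof. by elim: s => [|i s IH] /=; rewrite ?hcompf0 // hcompDr IH. Qed.

Lemma eq_hsum (A : Type) (X Z : C) (u v : A -> mor C X Z) (s : seq A) :
  (forall i, List.In i s -> u i ≡ v i) ->
  hsum [seq u i | i <- s] ≡ hsum [seq v i | i <- s].
Proof.
elim: s => [|i s IH] //= E; rewrite E; last by left.
by rewrite IH // => j js; apply: E; right.
Qed.

Lemma hsum0 (A : Type) (X Z : C) (u : A -> mor C X Z) (s : seq A) :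
  (forall i, List.In i s -> u i ≡ hzero X Z) -> hsum [seq u i | i <- s] ≡ hzero X Z.
Proof.
elim: s => [|i s IH] //= E; rewrite E; last by left.
by rewrite IH ?hadd0f // => j js; apply: E; right.
Qed.

Lemma hsum1 (A : Type) (X Z : C) (u : A -> mor C X Z) (s : seq A) i :
  List.NoDup s -> List.In i s -> (forall j, j <> i -> u j ≡ hzero X Z) ->
  hsum [seq u i | i <- s] ≡ u i.
Proof.
elim: s => [|j s IH] //= /List.NoDup_cons_iff[js ns] [ji|is_] E.
  rewrite ji hsum0 ?haddf0 // => l ls; apply: E => li; apply: js.
  by rewrite ji -li.
rewrite IH // E ?hadd0f // => ji; apply: js; by rewrite ji.
Qed.

Section Projections.
Variables (I : Type) (Y : I -> C) (S : C) (inj : forall i, mor C (Y i) S).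
Hypothesis coprod : is_coproduct inj.

(** The projection to [Y i] has the identity as component at i and zero elsewhere. The index type is
    arbitrary, hence the use of excluded middle and of transport along j = i. *)
Lemma coproduct_projections : exists p : forall i, mor C S (Y i),
  (forall i, p i ∘ inj i ≡ hid (Y i)) /\
  (forall i j, j <> i -> p i ∘ inj j ≡ hzero (Y j) (Y i)).
Proof.
suff P i : exists p : mor C S (Y i), p ∘ inj i ≡ hid (Y i) /\
    forall j, j <> i -> p ∘ inj j ≡ hzero (Y j) (Y i).
  exists (fun i => proj1_sig (constructive_indefinite_description _ (P i))).
  by split=> i; case: (constructive_indefinite_description _ (P i)) => p [].
pose f j : mor C (Y j) (Y i) := match excluded_middle_informative (j = i) with
  | left e => eq_rect j (fun l => mor C (Y j) (Y l)) (hid (Y j)) i e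
  | right _ => hzero (Y j) (Y i) end.
have [p [pE _]] := coprod f; exists p; split=> [|j ji]; rewrite pE /f.
  by case: (excluded_middle_informative _) => // e; rewrite (proof_irrelevance _ e erefl).
by case: (excluded_middle_informative _).
Qed.

(** Indices may repeat, so that sums correspond to concatenation; [finitely_supported_image]
    restores distinct indices. *)
Definition finitely_supported (X : C) (f : mor C X S) : Prop :=
  exists r : seq {i : I & mor C X (Y i)}, f ≡ hsum [seq inj (tag t) ∘ tagged t | t <- r].

Lemma finitely_supported_cut (X : C) (f : mor C X S) (r : seq {i : I & mor C X (Y i)})
    (p : forall i, mor C S (Y i)) (s : seq I) :
  (forall i, p i ∘ inj i ≡ hid (Y i)) ->
  (forall i j, j <> i -> p i ∘ inj j ≡ hzero (Y j) (Y i)) ->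
  f ≡ hsum [seq inj (tag t) ∘ tagged t | t <- r] ->
  List.NoDup s -> (forall t, List.In t r -> List.In (tag t) s) ->
  hsum [seq inj i ∘ p i | i <- s] ∘ f ≡ f.
Proof.
move=> p1 p0 rE ns rs; rewrite rE comp_hsum; apply: eq_hsum => t tr; rewrite hcompA.
suff -> : hsum [seq inj i ∘ p i | i <- s] ∘ inj (tag t) ≡ inj (tag t) by [].
rewrite hsum_comp (hsum1 ns (rs t tr)) -?hcompA ?p1 ?hcompf1 // => j jt.
by rewrite -hcompA p0 ?hcompf0 // => /esym.
Qed.

Definition nodup_tags (X : C) (r : seq {i : I & mor C X (Y i)}) : seq I :=
  List.nodup (fun x y => excluded_middle_informative (x = y)) [seq tag t | t <- r].

Lemma nodup_tagsP (X : C) (r : seq {i : I & mor C X (Y i)}) :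
  List.NoDup (nodup_tags r) /\ forall t, List.In t r -> List.In (tag t) (nodup_tags r).
Proof.
split=> [|t tr]; first exact: List.NoDup_nodup.
by apply/List.nodup_In/List.in_map.
Qed.

Lemma finitely_supported_image (X : C) (f : mor C X S) :
  finitely_supported f <-> exists g, coproduct_image inj g f.
Proof.
split=> [[r rE]|[g [s [_ _ fE]]]]; last first.
  exists [seq Tagged (fun i => mor C X (Y i)) (g i) | i <- s].
  by rewrite fE -map_comp.
have [p [p1 p0]] := coproduct_projections.
have [ns rs] := nodup_tagsP r.
exists (fun i => p i ∘ f); exists (nodup_tags r); split=> //.
- move=> i ni; rewrite rE comp_hsum hsum0 // => t tr; rewrite hcompA p0 ?hcomp0f // => ti.
  by apply: ni; rewrite -ti; apply: rs.
- transitivity (hsum [seq inj i ∘ p i | i <- nodup_tags r] ∘ f).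
    by rewrite (finitely_supported_cut p1 p0 rE).
  by rewrite hsum_comp; apply: eq_hsum => i _; rewrite hcompA.
Qed.

(** The sum of the [inj i ∘ p i] over the support of f replaces the projection onto a finite
    subcoproduct, without forming that subcoproduct. *)
Lemma finitely_supported_project (X : C) (f : mor C X S) : finitely_supported f ->
  exists e : mor C S S, e ∘ f ≡ f /\
    forall (Z : C) (u : mor C Z S), finitely_supported (e ∘ u).
Proof.
move=> [r rE]; have [p [p1 p0]] := coproduct_projections.
have [ns rs] := nodup_tagsP r.
exists (hsum [seq inj i ∘ p i | i <- nodup_tags r]).
split=> [|Z u]; first exact: finitely_supported_cut rE ns rs.
exists [seq Tagged (fun i => mor C Z (Y i)) (p i ∘ u) | i <- nodup_tags r].
by rewrite hsum_comp -map_comp /=; apply: eq_hsum => i _; rewrite hcompA.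
Qed.

End Projections.
(** The projections recover each component as [p i ∘ f], which gives the uniqueness clause; what is
    left is that every map has finite support. *)
Lemma compactP (X : C) : compact_object X <->
  forall (I : Type) (Y : I -> C) (S : C) (inj : forall i, mor C (Y i) S),
    is_coproduct inj -> forall f : mor C X S, finitely_supported inj f.
Proof.
split=> [cX I' Y S inj cp f|fs I' Y S inj cp].
  by apply/(finitely_supported_image cp); exact: (cX I' Y S inj cp).1.
split=> [f|f g g' gf gf' i]; first by apply/(finitely_supported_image cp); exact: fs.
have [p [p1 p0]] := coproduct_projections cp.
suff E h : coproduct_image inj h f -> h i ≡ p i ∘ f by rewrite (E g) // (E g').
move=> [s [ns s0 fE]]; rewrite fE comp_hsum.
case: (classic (List.In i s)) => is_.
  rewrite (hsum1 ns is_) ?hcompA ?p1 ?hcomp1f // => j ji.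
  by rewrite hcompA p0 // hcomp0f.
rewrite s0 // hsum0 // => j js; rewrite hcompA p0 ?hcomp0f // => ji.
by apply: is_; rewrite -ji.
Qed.

End Coproducts.

(** A quasi-inverse carries coproducts of D to coproducts of C, where supports out of X are finite;
    the counit brings the decomposition back. *)
Lemma equivalence_compact (C D : klincat k) (F : klinfunctor C D) (X : C) :
  is_equivalence F -> compact_object X -> compact_object (F X).
Proof.
move=> Feq /compactP cX; apply/compactP => I Y S inj cp f.
have [_ FF] := equivalence_fully_faithful Feq.
have [Ff _] := equivalence_fully_faithful Feq.
have [G _ [eps [epsI epsN]]] := is_equivalence_inv Feq.
have [e _ [eK Ke]] := iso_inv (epsI S).
have cpG : is_coproduct (fun i => fhom G (inj i)).
  move=> Z u.
  have inv i : exists v, inverse_of (eps (Y i)) v := epsI (Y i).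
  pose v i := proj1_sig (constructive_indefinite_description _ (inv i)).
  have vK i : inverse_of (eps (Y i)) (v i) :=
    proj2_sig (constructive_indefinite_description _ (inv i)).
  have [h [hE hU]] := cp _ (fun i => fhom F (u i) ∘ v i).
  have [h0 h0E] := FF _ _ (h ∘ eps S); exists h0; split=> [i|h1 h1E].
    apply: Ff; rewrite fhom_comp h0E -hcompA epsN hcompA hE -hcompA.
    by have [-> _] := vK i; rewrite hcompf1.
  apply: Ff; rewrite h0E -(hU (fhom F h1 ∘ e)) -?hcompA ?eK ?hcompf1 // => i.
  have [ve ev] := vK i.
  rewrite -hcompA; have -> : e ∘ inj i ≡ fhom F (fhom G (inj i)) ∘ v i.
    apply: (iso_cancel_l (epsI S)); rewrite !hcompA Ke hcomp1f epsN -hcompA ev.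
    by rewrite hcompf1.
  by rewrite hcompA -fhom_comp h1E.
have [f0 f0E] := FF _ _ (e ∘ f).
have [r rE] := cX _ _ _ _ cpG f0.
pose tr (t : {i : I & mor C X (G (Y i))}) : {i : I & mor D (F X) (Y i)} :=
  Tagged (fun i => mor D (F X) (Y i)) (eps (Y (tag t)) ∘ fhom F (tagged t)).
exists [seq tr t | t <- r].
have -> : f ≡ eps S ∘ fhom F f0 by rewrite f0E hcompA Ke hcomp1f.
rewrite rE; elim: r {rE} => [|t r IH] /=; first by rewrite fhom0 hcompf0.
rewrite fhom_add hcompDr IH; apply: heq_add => //.
by rewrite fhom_comp hcompA epsN hcompA.
Qed.

(** Choose e fixing u g, with [e ∘ _] always finitely supported. Then u - e u kills g, so it equals
    v h with v defined on S X, and u = e u + v h has finite support. *)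
Lemma cone_compact (C : klincat k) (S : klinfunctor C C) (X Y Z : C)
    (f : mor C X Y) (g : mor C Y Z) (h : mor C Z (S X)) :
  cone_triangle f g h -> compact_object Y -> compact_object (S X) -> compact_object Z.
Proof.
move=> [_ _ exZ _] /compactP cY /compactP cSX; apply/compactP => I U T inj cp u.
have [e [eug eF]] := finitely_supported_project cp (cY _ _ _ _ cp (u ∘ g)).
have [|v vE] := exZ _ (hadd u (hscale (-1) (e ∘ u))).
  by rewrite hcompDl hcompZl -hcompA eug haddfN.
have [r1 r1E] := eF _ u; have [r2 r2E] := cSX _ _ _ _ cp v.
pose comph (t : {i : I & mor C (S X) (U i)}) : {i : I & mor C Z (U i)} :=
  Tagged (fun i => mor C Z (U i)) (tagged t ∘ h).
exists (r1 ++ [seq comph t | t <- r2]).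
rewrite map_cat hsum_cat -r1E -map_comp.
transitivity (hadd (e ∘ u) (v ∘ h)).
  by rewrite -vE (haddC u) haddA haddfN hadd0f.
by rewrite r2E hsum_comp; apply: heq_add => //; apply: eq_hsum => t _; rewrite hcompA.
Qed.

Definition restrict_functor (C D : klincat k) (P : C -> Prop) (Q : D -> Prop)
    (F : klinfunctor C D) (FP : forall X, P X -> Q (F X)) :
  klinfunctor (full_subcat P) (full_subcat Q).
Proof.
refine (@KLinFunctor k (full_subcat P) (full_subcat Q)
  (fun X => exist _ (F (sval X)) (FP _ (proj2_sig X)))
  (fun X Y f => fhom F (f : mor C (sval X) (sval Y))) _ _ _ _ _).
- exact: (fun X Y => @fhom_eq _ _ _ F (sval X) (sval Y)).
- exact: (fun X => @fhom_id _ _ _ F (sval X)).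
- exact: (fun X Y Z => @fhom_comp _ _ _ F (sval X) (sval Y) (sval Z)).
- exact: (fun X Y => @fhom_add _ _ _ F (sval X) (sval Y)).
- exact: (fun X Y => @fhom_scale _ _ _ F (sval X) (sval Y)).
Defined.

Lemma compact_weakly_triangulated (C : klincat k) (S : klinfunctor C C) :
  is_equivalence S -> has_cones S -> weakly_triangulated (full_subcat (@compact_object k C)).
Proof.
move=> Seq Sc; have [Sf SF] := equivalence_fully_faithful Seq.
have [S' S'eq [eps [epsI epsN]]] := is_equivalence_inv Seq.
pose SP X (cX : compact_object X) : compact_object (S X) := equivalence_compact Seq cX.
exists (restrict_functor SP); split; first split.
- by move=> X Y f g; exact: Sf.
- by move=> X Y; exact: SF.
- move=> [Y cY]; exists (exist _ (S' Y) (equivalence_compact S'eq cY)), (eps Y).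
  by have [e E] := epsI Y; exists e.
move=> [X cX] [Y cY] f; have [Z [g [h tri]]] := Sc _ _ (f : mor C X Y).
exists (exist _ Z (cone_compact tri cY (SP _ cX))), g, h.
have [gf fh exZ exS] := tri; split=> //.
- by move=> [V cV] u; exact: exZ.
- by move=> [V cV] u; exact: exS.
Qed.

End Cones.

(** * Projective modules *)

Definition hpow (k : fieldType) (C : klincat k) (X : C) (f : mor C X X) (p : nat) :=
  iter p (hcomp f) (hid X).

Lemma fhom_pow (k : fieldType) (C D : klincat k) (F : klinfunctor C D) (X : C)
    (f : mor C X X) p : fhom F (hpow f p) ≡ hpow (fhom F f) p.
Proof. by elim: p => [|p IH] /=; rewrite ?fhom_id // fhom_comp IH. Qed.

#[global] Instance hpow_proper (k : fieldType) (C : klincat k) (X : C) :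
  Proper (@heq k C X X ==> eq ==> @heq k C X X) (@hpow k C X).
Proof. by move=> f g fg p _ <-; elim: p => [|p IH] //=; exact: heq_comp. Qed.

Lemma hpow_comp (k : fieldType) (C : klincat k) (X : C) (f s : mor C X X) p :
  hpow (s ∘ f) p.+1 ≡ s ∘ (hpow (f ∘ s) p ∘ f).
Proof.
elim: p => [|p IH]; first by rewrite /= hcompf1 hcomp1f.
by rewrite -[hpow (s ∘ f) _]/((s ∘ f) ∘ hpow (s ∘ f) p.+1) IH /= !hcompA.
Qed.

(** Nilpotence of f s gives that of s f, and u is fixed by s f. *)
Lemma nilpotent_absorb (k : fieldType) (C : klincat k) (X V : C) (f s : mor C X X)
    (u : mor C V X) p :
  hpow (f ∘ s) p ≡ hzero X X -> u ≡ (s ∘ f) ∘ u -> u ≡ hzero V X.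
Proof.
move=> nil uE; have uE' j : u ≡ hpow (s ∘ f) j ∘ u.
  by elim: j => [|j IH]; rewrite /= ?hcomp1f // -hcompA -IH.
by rewrite (uE' p.+1) hpow_comp nil hcomp0f hcompf0 hcomp0f.
Qed.

Section Projectives.
Variables (k : fieldType) (L : algType k).
Local Notation Lc := (L^c : nzRingType).
Local Notation reg := (Lc^o : lmodType Lc).

Lemma regular_fin_gen : fin_gen_module reg.
Proof.
exists [:: 1 : reg] => x; exists (fun=> x : Lc).
by rewrite big_ord1 /= -[RHS]/((x : Lc) * 1) mulr1.
Qed.

Section LinearFromRegular.
Variables (R : nzRingType) (V : lmodType R) (v : V).
Lemma scale_vec_linear : linear (fun x : R^o => (x : R) *: v).
Proof. by move=> c x y; rewrite scalerDl -[in LHS]/((c : R) * x) scalerA. Qed.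
Definition scale_vec : {linear R^o -> V} :=
  linear_of scale_vec_linear.
End LinearFromRegular.

Lemma regular_projective : projective_module reg.
Proof.
move=> X Y p f p_surj; have [x xE] := p_surj (f (1 : reg)).
exists (scale_vec x) => y /=; rewrite linearZ /= xE -linearZ /=.
by rewrite -[_ *: _]/((y : Lc) * 1) mulr1.
Qed.

Definition regular_projmod : projmod L := ProjMod regular_fin_gen regular_projective.

Lemma lmul_linear (u : L) : linear ((fun x => u * (x : L)) : reg -> reg).
Proof.
move=> c x y; rewrite -[c *: x]/((x : L) * (c : L) : L) mulrDr mulrA.
by rewrite -[RHS]/((u * (x : L)) * (c : L) + u * (y : L) : L).
Qed.

Definition lmul (u : L) : mor (proj_cat L) regular_projmod regular_projmod :=
  linear_of (lmul_linear u).

Lemma lmulE (f : mor (proj_cat L) regular_projmod regular_projmod) :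
  f ≡ lmul (f (1 : reg) : L).
Proof.
move=> x; have {1}-> : x = (x : Lc) *: (1 : reg) by rewrite -[RHS]/((x : Lc) * 1) mulr1.
by rewrite linearZ.
Qed.

Lemma dual_basis (P : projmod L) : exists (d : nat) (q : 'I_d -> P)
    (phi : 'I_d -> {linear P -> reg}), forall x, x = \sum_j (phi j x : Lc) *: q j.
Proof.
have [s sP] := pcar_fin_gen P.
pose F := {ffun 'I_(size s) -> reg}.
pose p0 (c : F) : P := \sum_i (c i : Lc) *: s`_i.
have p0l : linear p0.
  move=> c x y; rewrite /p0 scaler_sumr -big_split; apply: eq_bigr => i _ /=.
  by rewrite !ffunE scalerA -scalerDl.
pose p : {linear F -> P} := linear_of p0l.
have p_surj : surj p.
  move=> x; have [c ->] := sP x; exists [ffun i => c i : reg].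
  by apply: eq_bigr => i _; rewrite ffunE.
have [g gE] := pcar_projective (idfun : {linear P -> P}) p_surj.
pose phi0 i (x : P) : reg := g x i.
have phil i : linear (phi0 i) by move=> c x y; rewrite /phi0 linearP !ffunE.
exists (size s), (fun i => s`_i), (fun i => linear_of (phil i)) => x.
by rewrite -{1}[x]gE.
Qed.

Variables (n : nat) (a : L).
Hypothesis ra : cyclic_radical n a.
Hypothesis n_gt1 : (1 < n)%N.

Lemma projmod_torsion (P : projmod L) (z : P) : (a : Lc) *: z = 0 ->
  exists w, z = (a ^+ n : Lc) *: w.
Proof.
move=> az; have [d [q [phi qE]]] := dual_basis P.
have [s [t st]] := rad_split_r ra (isT : (1 <= n.+1)%N).
exists (\sum_j (s (phi j z) : Lc) *: q j).
rewrite {1}[z]qE scaler_sumr; apply: eq_bigr => j _; rewrite scalerA; congr (_ *: _).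
rewrite -[RHS]/((s (phi j z) : L) * a ^+ n : L) [LHS](st (phi j z)) expr1 subSS subn0.
suff -> : (phi j z : L) * a = 0 :> L by rewrite linear0 addr0.
by rewrite -[LHS]/((a : Lc) *: (phi j z : reg)) -linearZ az linear0.
Qed.

Lemma projmod_weak_kernel (Z : projmod L) (h : mor (proj_cat L) Z regular_projmod) :
  lmul a ∘ h ≡ hzero _ _ -> exists v, h ≡ lmul (a ^+ n) ∘ v.
Proof.
move=> ah; have [d [q [phi qE]]] := dual_basis Z.
have [s [t st]] := rad_split_l ra (isT : (1 <= n.+1)%N).
(* [s] is only k-linear, so composing it with h would not give a module map; it is applied to the
   finitely many values h (q j), and the coordinates extend the result L-linearly. *)
pose v0 (z : Z) : reg := \sum_j (phi j z : Lc) *: (s (h (q j)) : reg).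
have vl : linear v0.
  move=> c x y; rewrite /v0 scaler_sumr -big_split; apply: eq_bigr => j _ /=.
  by rewrite linearP scalerDl scalerA.
exists (linear_of vl) => z.
rewrite /= {1}[z]qE linear_sum /v0 mulr_sumr; apply: eq_bigr => j _.
rewrite linearZ /= -[LHS]/((h (q j) : L) * (phi j z : L)).
rewrite -[_ *: _]/((s (h (q j)) : L) * (phi j z : L)).
rewrite mulrA [h (q j) in LHS](st (h (q j) : L)) expr1 subSS subn0.
by have /= -> := ah (q j); rewrite linear0 addr0.
Qed.

(** The shift of L is an unspecified projective, so radical endomorphisms are detected by
    nilpotence. For the rank one map s = x phi_j, the j-th coordinate of (b s)^p is u^p phi_j with u
    = phi_j (b x); hence u is nilpotent and lies in aL = La. *)
Lemma projmod_radical (Q : projmod L) (b : mor (proj_cat L) Q Q) :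
  (forall s : mor (proj_cat L) Q Q, exists p, hpow (b ∘ s) p ≡ hzero _ _) ->
  forall x, exists w, b x = (a : Lc) *: w.
Proof.
move=> nil x; have [d [q [phi qE]]] := dual_basis Q.
suff /fin_all_exists[y yE] : forall j, exists y, phi j (b x) = y * a :> L.
  exists (\sum_j (y j : Lc) *: q j); rewrite {1}[b x]qE scaler_sumr.
  by apply: eq_bigr => j _; rewrite yE scalerA.
move=> j; set u : L := phi j (b x).
pose s : mor (proj_cat L) Q Q := (scale_vec x : {linear reg -> Q}) \o phi j.
have pow y p : phi j (hpow (b ∘ s) p y) = u ^+ p * (phi j y : L) :> L.
  elim: p => [|p IH] /=; first by rewrite mul1r.
  by rewrite linearZ linearZ /= -[LHS]/(u * (phi j (hpow (b ∘ s) p y) : L)) IH mulrA -exprS.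
have [p bs0] := nil s.
have [y uE] : exists y, u = a * y.
  by apply: (nilpotent_rad ra (p := p.+1)); rewrite exprSr -pow bs0 linear0.
by have [y' y'E] := rad_mull ra y; exists y'; rewrite uE.
Qed.

Lemma lmul_radical_nil (s : mor (proj_cat L) regular_projmod regular_projmod) :
  hpow (lmul a ∘ s) n.+1 ≡ hzero _ _.
Proof.
have lmulX u p : hpow (lmul u) p ≡ lmul (u ^+ p).
  move=> x; elim: p => [|p IH] /=; first by rewrite mul1r.
  by rewrite IH mulrA -exprS.
have E : lmul a ∘ s ≡ lmul (a * s (1 : reg)) by move=> x; rewrite /= (lmulE s x) /= mulrA.
rewrite E lmulX => x /=.
suff [v ->] : exists v, (a * s (1 : reg)) ^+ n.+1 = a ^+ n.+1 * v.
  by rewrite (radX0 ra) !mul0r.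
elim: n.+1 => [|p [v IH]]; first by exists 1; rewrite mulr1.
have comm w : exists w', w * a ^+ p = a ^+ p * w'.
  elim: p w {IH} => [|p IHp] w; first by exists w; rewrite mulr1 mul1r.
  have [w1 w1E] := rad_mulr ra w; have [w2 w2E] := IHp w1.
  by exists w2; rewrite exprS mulrA w1E -mulrA w2E mulrA.
have [w wE] := comm (s (1 : reg) : L).
by exists (w * v); rewrite exprS IH !mulrA -(mulrA a) wE !mulrA -exprS.
Qed.

Lemma proj_not_weakly_triangulated : ~ weakly_triangulated (proj_cat L).
Proof.
move=> [S [[Sf SF] Ss Sc]].
have [Z [g [h [gf fh exZ exS]]]] := Sc _ _ (lmul a).
pose A j := fhom S (lmul (a ^+ j)).
have AD i j : A (i + j)%N ≡ A i ∘ A j.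
  rewrite /A -fhom_comp; apply: fhom_eq => x /=; by rewrite mulrA -exprD.
have A1 : A 1%N ≡ fhom S (lmul a) by rewrite /A expr1.
(* Nilpotence passes to the shifted object because S is full. *)
have nilA s : hpow (A 1%N ∘ s) n.+1 ≡ hzero _ _.
  have [s0 s0E] := SF _ _ s.
  have -> : A 1%N ∘ s ≡ fhom S (lmul a ∘ s0) by rewrite A1 fhom_comp s0E.
  by rewrite -fhom_pow lmul_radical_nil fhom0.
have nilA' s V (u : mor (proj_cat L) V (S regular_projmod)) :
    u ≡ (s ∘ A 1%N) ∘ u -> u ≡ hzero _ _.
  by apply: nilpotent_absorb (nilA s).
(* The weak kernel lemma concerns maps into L itself, so Z is replaced by an isomorphic S Z' and h
   by the shift of such a map. *)
have [v hE] : exists v, h ≡ A n ∘ v.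
  have [Z' [e eI]] := Ss Z; have [e' _ [_ ee']] := iso_inv eI.
  have [h0 h0E] := SF _ _ (h ∘ e).
  have [|v0 v0E] := @projmod_weak_kernel _ h0.
    by apply: Sf; rewrite fhom_comp h0E hcompA fh hcomp0f fhom0.
  exists (fhom S v0 ∘ e'); rewrite hcompA -fhom_comp -v0E h0E -hcompA ee'.
  by rewrite hcompf1.
have [w gE] : exists w, g (1 : reg) = (a ^+ n : Lc) *: w.
  apply: projmod_torsion; rewrite -linearZ; have /= <- := gf (1 : reg).
  by congr (g _); rewrite mulr1 -[LHS]/(1 * a) mul1r.
have [l lE] : exists l, A 1%N ∘ v ≡ l ∘ h.
  apply: exZ => x /=.
  have -> : x = (x : Lc) *: (1 : reg) by rewrite -[RHS]/((x : Lc) * 1) mulr1.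
  rewrite !linearZ /= gE !linearZ /=.
  have [|y ->] := @projmod_radical _ (A 1%N) _ (v w); first by move=> s; exists n.+1.
  rewrite [X in _ *: X]scalerA -[_ * _]/(a * a ^+ n : L) -exprS (radX0 ra).
  by rewrite scale0r scaler0.
have Av0 : A 1%N ∘ v ≡ hzero _ _.
  (* In n = (n - 2) + 1 + 1, one unit belongs to the fixed map [A 1 ∘ v] and the other makes the
     operator acting on it nilpotent. *)
  apply: (nilA' (l ∘ A (n - 2)%N)); rewrite {1}lE hE !hcompA.
  apply: heq_comp => //; rewrite -!hcompA; apply: heq_comp => //.
  by rewrite -!AD; have -> : (n - 2 + (1 + 1) = n)%N by rewrite subnK.
have h0 : h ≡ hzero _ _.
  have -> : h ≡ A (n - 1)%N ∘ (A 1%N ∘ v).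
    by rewrite hcompA -AD subnK ?(ltnW n_gt1).
  by rewrite Av0 hcompf0.
have [|l' l'E] := exS _ (hid _); first by rewrite hcomp1f.
have id0 : hid (S regular_projmod) ≡ hzero _ _.
  by apply: (nilA' l'); rewrite hcompf1 A1.
have /Sf/(_ (1 : reg)) /= : fhom S (hid (regular_projmod : proj_cat L)) ≡ fhom S (hzero _ _).
  by rewrite fhom_id id0 fhom0.
by move/eqP; rewrite oner_eq0.
Qed.

End Projectives.

(** * Calculus of left fractions *)

(** For dg modules the Ore and cancellation conditions are established up to homotopy. Carrying the
    relation [htp] along replaces a passage to the homotopy category, and [htp_loc] says that the
    localization does not see the difference. *)
Record left_calculus (k : fieldType) (C : klincat k)
    (W : forall X Y, mor C X Y -> Prop) (htp : forall X Y, mor C X Y -> mor C X Y -> Prop) :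
    Prop := LeftCalculus {
  calc_id : forall X, W X X (hid X);
  calc_comp : forall X Y Z (g : mor C Y Z) (f : mor C X Y),
    W Y Z g -> W X Y f -> W X Z (g ∘ f);
  htp_heq : forall X Y (f g : mor C X Y), f ≡ g -> htp X Y f g;
  htp_sym : forall X Y (f g : mor C X Y), htp X Y f g -> htp X Y g f;
  htp_trans : forall X Y (f g h : mor C X Y), htp X Y f g -> htp X Y g h -> htp X Y f h;
  htp_add : forall X Y (f f' g g' : mor C X Y),
    htp X Y f f' -> htp X Y g g' -> htp X Y (hadd f g) (hadd f' g');
  htp_scale : forall X Y c (f g : mor C X Y),
    htp X Y f g -> htp X Y (hscale c f) (hscale c g);
  htp_compl : forall X Y Z (u : mor C Y Z) (f g : mor C X Y),
    htp X Y f g -> htp X Z (u ∘ f) (u ∘ g);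
  htp_compr : forall X Y Z (u : mor C X Y) (f g : mor C Y Z),
    htp Y Z f g -> htp X Z (f ∘ u) (g ∘ u);
  htp_loc : forall X Y (f g : mor C X Y), htp X Y f g -> @loc_eq k C W X Y (Loc W f) (Loc W g);
  calc_ore : forall X X' Y (v : mor C X X') (f : mor C X Y), W X X' v ->
    exists Y' (v' : mor C Y Y') (f' : mor C X' Y'), W Y Y' v' /\ htp X Y' (f' ∘ v) (v' ∘ f);
  calc_cancel : forall X' X Y (t : mor C X' X) (f g : mor C X Y),
    W X' X t -> htp X' Y (f ∘ t) (g ∘ t) ->
    exists Y' (v : mor C Y Y'), W Y Y' v /\ htp X Y' (v ∘ f) (v ∘ g)
}.

Section LeftCalculus.
Variables (k : fieldType) (C : klincat k).
Variables (W : forall X Y, mor C X Y -> Prop) (htp : forall X Y, mor C X Y -> mor C X Y -> Prop).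
Arguments W {X Y}.
Arguments htp {X Y}.
Hypothesis calc : left_calculus (@W) (@htp).
Local Notation D := (localization (@W)).
Local Notation loc f := (Loc (@W) f : mor D _ _).

#[local] Instance htp_equivalence X Y : Equivalence (@htp X Y).
Proof.
split=> [f|f g|f g h]; [exact: (htp_heq calc) | exact: (htp_sym calc) | exact: (htp_trans calc)].
Qed.

#[local] Instance htp_subrelation X Y : subrelation (@heq k C X Y) (@htp X Y).
Proof. by move=> f g; exact: (htp_heq calc). Qed.

#[local] Instance htp_hcomp_proper X Y Z :
  Proper (@htp Y Z ==> @htp X Y ==> @htp X Z) (@hcomp k C X Y Z).
Proof.
move=> g g' gg' f f' ff'; apply: (htp_trans calc) (htp_compr calc f gg') _.
exact: (htp_compl calc).
Qed.

#[local] Instance htp_hadd_proper X Y :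
  Proper (@htp X Y ==> @htp X Y ==> @htp X Y) (@hadd k C X Y).
Proof. by move=> g g' gg' f f' ff'; exact: (htp_add calc). Qed.

#[local] Instance htp_hscale_proper X Y c : Proper (@htp X Y ==> @htp X Y) (@hscale k C X Y c).
Proof. by move=> f f' ff'; exact: (htp_scale calc). Qed.

(** This is equality in the localization, as [frac_loc] and [loc_eq_frac] show. *)
Definition frac_eq (X Y : C) (f g : mor C X Y) : Prop :=
  exists Y' (t : mor C Y Y'), W t /\ htp (t ∘ f) (t ∘ g).
Local Notation "f ≈ g" := (frac_eq f g) (at level 70).

Lemma htp_frac X Y (f g : mor C X Y) : htp f g -> f ≈ g.
Proof.
move=> fg; exists Y, (hid Y); split; first exact: (calc_id calc).
exact: (htp_compl calc).
Qed.

Lemma frac_compl X Y Z (u : mor C Y Z) (f g : mor C X Y) : f ≈ g -> u ∘ f ≈ u ∘ g.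
Proof.
move=> [Y' [t [Wt tfg]]]; have [Z' [t' [u' [Wt' E]]]] := calc_ore calc u Wt.
exists Z', t'; split=> //; rewrite !hcompA -!E -!hcompA.
exact: (htp_compl calc).
Qed.

Lemma frac_trans X Y (f g h : mor C X Y) : f ≈ g -> g ≈ h -> f ≈ h.
Proof.
move=> [Y1 [t1 [W1 E1]]] [Y2 [t2 [W2 E2]]].
have [Y' [t' [u' [W' E]]]] := calc_ore calc t1 W2.
exists Y', (t' ∘ t1); split; first exact: (calc_comp calc).
rewrite -hcompA E1 hcompA -E -!hcompA E2 !hcompA E.
by reflexivity.
Qed.

#[local] Instance frac_equivalence X Y : Equivalence (@frac_eq X Y).
Proof.
split; last exact: frac_trans.
  by move=> f; apply: htp_frac; reflexivity.
by move=> f g [Y' [t [Wt E]]]; exists Y', t; split=> //; symmetry.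
Qed.

#[local] Instance frac_subrelation X Y : subrelation (@heq k C X Y) (@frac_eq X Y).
Proof. by move=> f g fg; apply/htp_frac/(htp_heq calc). Qed.

#[local] Instance frac_htp_subrelation X Y : subrelation (@htp X Y) (@frac_eq X Y).
Proof. exact: htp_frac. Qed.

#[local] Instance frac_hcomp_proper X Y Z :
  Proper (@frac_eq Y Z ==> @frac_eq X Y ==> @frac_eq X Z) (@hcomp k C X Y Z).
Proof.
move=> g g' [Z' [t [Wt E]]] f f' ff'; apply: frac_trans (frac_compl g' ff').
by exists Z', t; split=> //; rewrite !hcompA E; reflexivity.
Qed.

#[local] Instance frac_hadd_proper X Y :
  Proper (@frac_eq X Y ==> @frac_eq X Y ==> @frac_eq X Y) (@hadd k C X Y).
Proof.
have addl (h f g : mor C X Y) : f ≈ g -> hadd f h ≈ hadd g h.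
  by move=> [Y' [t [Wt E]]]; exists Y', t; split=> //; rewrite !hcompDr E; reflexivity.
move=> g g' gg' f f' ff'; apply: frac_trans (addl _ _ _ gg') _.
by rewrite haddC (haddC g'); exact: addl.
Qed.

#[local] Instance frac_hscale_proper X Y c :
  Proper (@frac_eq X Y ==> @frac_eq X Y) (@hscale k C X Y c).
Proof.
by move=> f g [Y' [t [Wt E]]]; exists Y', t; split=> //; rewrite !hcompZr E; reflexivity.
Qed.

Lemma frac_mono X Y Y' (t : mor C Y Y') (f g : mor C X Y) : W t -> t ∘ f ≈ t ∘ g -> f ≈ g.
Proof.
move=> Wt [Y2 [t2 [W2 E]]]; exists Y2, (t2 ∘ t); split; first exact: (calc_comp calc).
by rewrite -!hcompA.
Qed.

Lemma frac_epi X X' Y (w : mor C X' X) (f g : mor C X Y) : W w -> f ∘ w ≈ g ∘ w -> f ≈ g.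
Proof.
move=> Ww [Y' [t [Wt E]]].
have [|Y2 [v [Wv vE]]] := calc_cancel calc (t := w) (f := t ∘ f) (g := t ∘ g) Ww.
  by rewrite -!hcompA.
exists Y2, (v ∘ t); split; first exact: (calc_comp calc).
by rewrite -!hcompA.
Qed.

Lemma loc_iso X Y (w : mor C X Y) : W w -> is_iso (loc w).
Proof. by move=> Ww; exists (LocInv Ww); split; [exact: loc_invl | exact: loc_invr]. Qed.

Lemma loc_compE X Y Z (g : mor C Y Z) (f : mor C X Y) : loc (g ∘ f) ≡ loc g ∘ loc f.
Proof. exact: loc_map_comp. Qed.

Lemma loc_addE X Y (f g : mor C X Y) : loc (hadd f g) ≡ hadd (loc f) (loc g).
Proof. exact: loc_map_add. Qed.

Lemma loc_scaleE X Y c (f : mor C X Y) : loc (hscale c f) ≡ hscale c (loc f).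
Proof. exact: loc_map_scale. Qed.

Lemma frac_loc X Y (f g : mor C X Y) : f ≈ g -> loc f ≡ loc g.
Proof.
move=> [Y' [t [Wt E]]]; apply: (iso_cancel_l (loc_iso Wt)).
by rewrite -!loc_compE; exact: (htp_loc calc).
Qed.

(* [loc_rel e b a] expresses, in terms of morphisms of [C] only, that [b ∘ e = a] in the
   localization. *)
Fixpoint loc_rel (X Y : C) (e : loc_hom (@W) X Y) (T : C) :
    mor C Y T -> mor C X T -> Prop :=
  match e in loc_hom _ X Y return mor C Y T -> mor C X T -> Prop with
  | Loc _ _ f => fun b a => b ∘ f ≈ a
  | LocInv _ _ w _ => fun b a => b ≈ a ∘ w
  | LocComp X Y Z g f => fun c a => exists T' (t : mor C T T') (b : mor C Y T'),
      [/\ W t, loc_rel g (t ∘ c) b & loc_rel f b (t ∘ a)]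
  | LocAdd X Y f g => fun b a => exists T' (t : mor C T T') (a1 a2 : mor C X T'),
      [/\ W t, loc_rel f (t ∘ b) a1, loc_rel g (t ∘ b) a2 & t ∘ a ≈ hadd a1 a2]
  | LocScale X Y c f => fun b a => exists T' (t : mor C T T') (a1 : mor C X T'),
      [/\ W t, loc_rel f (t ∘ b) a1 & t ∘ a ≈ hscale c a1]
  end.

Lemma loc_rel_frac X Y (e : loc_hom (@W) X Y) T (b b' : mor C Y T) (a a' : mor C X T) :
  b ≈ b' -> a ≈ a' -> loc_rel e b a -> loc_rel e b' a'.
Proof.
elim: e T b b' a a' => {X Y} [X Y f|X Y w Ww|X Y Z g IHg f IHf|X Y f IHf g IHg|X Y c f IHf] T
  b b' a a' bb aa /=.
- by rewrite bb aa.
- by rewrite bb aa.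
- move=> [T' [t [d [Wt gd fd]]]]; exists T', t, d; split=> //.
    by apply: IHg gd; [rewrite bb; reflexivity | reflexivity].
  by apply: IHf fd; [reflexivity | rewrite aa; reflexivity].
- move=> [T' [t [a1 [a2 [Wt f1 g2 E]]]]]; exists T', t, a1, a2; split=> //.
  + by apply: IHf f1; [rewrite bb; reflexivity | reflexivity].
  + by apply: IHg g2; [rewrite bb; reflexivity | reflexivity].
  + by rewrite -aa.
- move=> [T' [t [a1 [Wt f1 E]]]]; exists T', t, a1; split=> //.
  + by apply: IHf f1; [rewrite bb; reflexivity | reflexivity].
  + by rewrite -aa.
Qed.

#[local] Instance loc_rel_proper X Y (e : loc_hom (@W) X Y) T :
  Proper (@frac_eq Y T ==> @frac_eq X T ==> iff) (@loc_rel X Y e T).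
Proof.
move=> b b' bb a a' aa; split; first exact: loc_rel_frac.
by apply: loc_rel_frac; symmetry.
Qed.

Lemma loc_rel_comp X Y (e : loc_hom (@W) X Y) T T' (s : mor C T T') (b : mor C Y T)
    (a : mor C X T) : loc_rel e b a -> loc_rel e (s ∘ b) (s ∘ a).
Proof.
elim: e T T' s b a => {X Y} [X Y f|X Y w Ww|X Y Z g IHg f IHf|X Y f IHf g IHg|X Y c f IHf] T T1
  s b a /=.
- by move=> <-; rewrite hcompA; reflexivity.
- by move=> ->; rewrite hcompA; reflexivity.
- move=> [T' [t [d [Wt gd fd]]]].
  have [T2 [t' [s' [Wt' E]]]] := calc_ore calc s Wt.
  exists T2, t', (s' ∘ d); split=> //; rewrite hcompA -E -hcompA; [exact: IHg | exact: IHf].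
- move=> [T' [t [a1 [a2 [Wt f1 g2 aE]]]]].
  have [T2 [t' [s' [Wt' E]]]] := calc_ore calc s Wt.
  exists T2, t', (s' ∘ a1), (s' ∘ a2); split=> //; rewrite hcompA -E -hcompA.
  + exact: IHf.
  + exact: IHg.
  + by rewrite aE hcompDr; reflexivity.
- move=> [T' [t [a1 [Wt f1 aE]]]].
  have [T2 [t' [s' [Wt' E]]]] := calc_ore calc s Wt.
  exists T2, t', (s' ∘ a1); split=> //; rewrite hcompA -E -hcompA; first exact: IHf.
  by rewrite aE hcompZr; reflexivity.
Qed.

(** For compound terms the auxiliary map absorbs [t]; for atomic ones W is left cancellable up to
    [≈]. *)
Lemma loc_rel_local X Y (e : loc_hom (@W) X Y) T T' (t : mor C T T') (b : mor C Y T)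
    (a : mor C X T) : W t -> loc_rel e (t ∘ b) (t ∘ a) -> loc_rel e b a.
Proof.
move=> Wt; case: {X Y} e T T' t Wt b a => [X Y f|X Y w Ww|X Y Z g f|X Y f g|X Y c f] T T1 t Wt b a /=.
- by rewrite -hcompA; exact: frac_mono.
- by rewrite -hcompA; exact: frac_mono.
- move=> [T' [t1 [d [W1 gd fd]]]]; exists T', (t1 ∘ t), d; split.
  + exact: (calc_comp calc).
  + by rewrite -hcompA.
  + by rewrite -hcompA.
- move=> [T' [t1 [a1 [a2 [W1 f1 g2 aE]]]]]; exists T', (t1 ∘ t), a1, a2; split.
  + exact: (calc_comp calc).
  + by rewrite -hcompA.
  + by rewrite -hcompA.
  + by rewrite -hcompA.
- move=> [T' [t1 [a1 [W1 f1 aE]]]]; exists T', (t1 ∘ t), a1; split.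
  + exact: (calc_comp calc).
  + by rewrite -hcompA.
  + by rewrite -hcompA.
Qed.

(** An image of b may exist only after enlarging T along W. With [loc_rel_fun], a term from X to Y
    thus acts as a map from Hom(Y, T) to the colimit of the Hom(X, T') over the maps T -> T' in
    W. *)
Lemma loc_rel_total X Y (e : loc_hom (@W) X Y) T (b : mor C Y T) :
  exists T' (t : mor C T T') (a : mor C X T'), W t /\ loc_rel e (t ∘ b) a.
Proof.
elim: e T b => {X Y} [X Y f|X Y w Ww|X Y Z g IHg f IHf|X Y f IHf g IHg|X Y c f IHf] T b /=.
- exists T, (hid T), (b ∘ f); split; first exact: (calc_id calc).
  by rewrite hcomp1f; reflexivity.
- have [T' [t [a [Wt E]]]] := calc_ore calc b Ww; exists T', t, a; split=> //.
  by rewrite -E; reflexivity.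
- have [T1 [t1 [d [W1 gd]]]] := IHg _ b; have [T2 [t2 [a [W2 fa]]]] := IHf _ d.
  exists T2, (t2 ∘ t1), a; split; first exact: (calc_comp calc).
  exists T2, (hid T2), (t2 ∘ d); split; first exact: (calc_id calc).
    by rewrite hcomp1f -hcompA; exact: loc_rel_comp.
  by rewrite hcomp1f.
- have [T1 [t1 [a1 [W1 f1]]]] := IHf _ b; have [T2 [t2 [a2 [W2 g2]]]] := IHg _ (t1 ∘ b).
  exists T2, (t2 ∘ t1), (hadd (t2 ∘ a1) a2); split; first exact: (calc_comp calc).
  exists T2, (hid T2), (t2 ∘ a1), a2; split; first exact: (calc_id calc).
  + by rewrite hcomp1f -hcompA; exact: loc_rel_comp.
  + by rewrite hcomp1f -hcompA.
  + by rewrite hcomp1f; reflexivity.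
- have [T1 [t1 [a1 [W1 f1]]]] := IHf _ b; exists T1, t1, (hscale c a1); split=> //.
  exists T1, (hid T1), a1; split; first exact: (calc_id calc).
  + by rewrite hcomp1f.
  + by rewrite hcomp1f; reflexivity.
Qed.

Lemma common_refinement T T1 T2 (t1 : mor C T T1) (t2 : mor C T T2) : W t1 -> W t2 ->
  exists T' (t : mor C T T') (s1 : mor C T1 T') (s2 : mor C T2 T'),
    [/\ W t, W s2, t ≈ s1 ∘ t1 & t ≈ s2 ∘ t2].
Proof.
move=> W1 W2; have [T' [t' [u' [W' E]]]] := calc_ore calc t2 W1.
exists T', (t' ∘ t2), u', t'; split=> //; first exact: (calc_comp calc).
  by rewrite E; reflexivity.
by reflexivity.
Qed.

(** The auxiliary choices of two computations are compared in a common refinement; at a formal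
    inverse, uniqueness is the cancellation axiom. *)
Lemma loc_rel_fun X Y (e : loc_hom (@W) X Y) T (b : mor C Y T) (a a' : mor C X T) :
  loc_rel e b a -> loc_rel e b a' -> a ≈ a'.
Proof.
elim: e T b a a' => {X Y} [X Y f|X Y w Ww|X Y Z g IHg f IHf|X Y f IHf g IHg|X Y c f IHf] T b a a' /=.
- by move=> -> .
- by move=> ->; exact: frac_epi.
- move=> [T1 [t1 [d1 [W1 g1 f1]]]] [T2 [t2 [d2 [W2 g2 f2]]]].
  have [T' [t [s1 [s2 [Wt _ E1 E2]]]]] := common_refinement W1 W2.
  have dd : s1 ∘ d1 ≈ s2 ∘ d2.
    apply: (IHg _ (t ∘ b)); first by rewrite E1 -hcompA; exact: loc_rel_comp.
    by rewrite E2 -hcompA; exact: loc_rel_comp.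
  apply: (frac_mono Wt); apply: (IHf _ (s1 ∘ d1)).
    by rewrite E1 -hcompA; exact: loc_rel_comp.
  by rewrite dd E2 -hcompA; exact: loc_rel_comp.
- move=> [T1 [t1 [a1 [a2 [W1 f1 g1 aE]]]]] [T2 [t2 [a3 [a4 [W2 f2 g2 aE']]]]].
  have [T' [t [s1 [s2 [Wt _ E1 E2]]]]] := common_refinement W1 W2.
  have aa : s1 ∘ a1 ≈ s2 ∘ a3.
    apply: (IHf _ (t ∘ b)); first by rewrite E1 -hcompA; exact: loc_rel_comp.
    by rewrite E2 -hcompA; exact: loc_rel_comp.
  have aa' : s1 ∘ a2 ≈ s2 ∘ a4.
    apply: (IHg _ (t ∘ b)); first by rewrite E1 -hcompA; exact: loc_rel_comp.
    by rewrite E2 -hcompA; exact: loc_rel_comp.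
  apply: (frac_mono Wt); rewrite {1}E1 E2 -!hcompA aE aE' !hcompDr aa aa'; reflexivity.
- move=> [T1 [t1 [a1 [W1 f1 aE]]]] [T2 [t2 [a2 [W2 f2 aE']]]].
  have [T' [t [s1 [s2 [Wt _ E1 E2]]]]] := common_refinement W1 W2.
  have aa : s1 ∘ a1 ≈ s2 ∘ a2.
    apply: (IHf _ (t ∘ b)); first by rewrite E1 -hcompA; exact: loc_rel_comp.
    by rewrite E2 -hcompA; exact: loc_rel_comp.
  apply: (frac_mono Wt); rewrite {1}E1 E2 -!hcompA aE aE' !hcompZr aa; reflexivity.
Qed.

Lemma loc_rel_add X Y (e : loc_hom (@W) X Y) T (b b' : mor C Y T) (a a' : mor C X T) :
  loc_rel e b a -> loc_rel e b' a' -> loc_rel e (hadd b b') (hadd a a').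
Proof.
have split_comp (U T0 T1 T2 T' : C) (u v : mor C U T0) (t : mor C T0 T') (t1 : mor C T0 T1)
    (t2 : mor C T0 T2) (s1 : mor C T1 T') (s2 : mor C T2 T') : t ≈ s1 ∘ t1 -> t ≈ s2 ∘ t2 ->
    t ∘ hadd u v ≈ hadd (s1 ∘ (t1 ∘ u)) (s2 ∘ (t2 ∘ v)).
  by move=> E1 E2; rewrite hcompDr {1}E1 E2 -!hcompA; reflexivity.
elim: e T b b' a a' => {X Y} [X Y f|X Y w Ww|X Y Z g IHg f IHf|X Y f IHf g IHg|X Y c f IHf] T
  b b' a a' /=.
- by move=> <- <-; rewrite hcompDl; reflexivity.
- by move=> -> ->; rewrite hcompDl; reflexivity.
- move=> [T1 [t1 [d1 [W1 g1 f1]]]] [T2 [t2 [d2 [W2 g2 f2]]]].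
  have [T' [t [s1 [s2 [Wt _ E1 E2]]]]] := common_refinement W1 W2.
  exists T', t, (hadd (s1 ∘ d1) (s2 ∘ d2));
    split=> //; rewrite (split_comp _ _ _ _ _ _ _ _ _ _ _ _ E1 E2).
    by apply: IHg; exact: loc_rel_comp.
  by apply: IHf; exact: loc_rel_comp.
- move=> [T1 [t1 [a1 [a2 [W1 f1 g1 aE]]]]] [T2 [t2 [a3 [a4 [W2 f2 g2 aE']]]]].
  have [T' [t [s1 [s2 [Wt _ E1 E2]]]]] := common_refinement W1 W2.
  exists T', t, (hadd (s1 ∘ a1) (s2 ∘ a3)), (hadd (s1 ∘ a2) (s2 ∘ a4)).
  split=> //; rewrite (split_comp _ _ _ _ _ _ _ _ _ _ _ _ E1 E2).
  + by apply: IHf; exact: loc_rel_comp.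
  + by apply: IHg; exact: loc_rel_comp.
  + rewrite aE aE' !hcompDr -!haddA (haddA (s1 ∘ a2)) (haddC (s1 ∘ a2)) -!haddA; reflexivity.
- move=> [T1 [t1 [a1 [W1 f1 aE]]]] [T2 [t2 [a2 [W2 f2 aE']]]].
  have [T' [t [s1 [s2 [Wt _ E1 E2]]]]] := common_refinement W1 W2.
  exists T', t, (hadd (s1 ∘ a1) (s2 ∘ a2));
    split=> //; rewrite (split_comp _ _ _ _ _ _ _ _ _ _ _ _ E1 E2).
  + by apply: IHf; exact: loc_rel_comp.
  + by rewrite aE aE' !hcompZr hscaleDr; reflexivity.
Qed.

Lemma loc_rel_scale X Y (e : loc_hom (@W) X Y) T c (b : mor C Y T) (a : mor C X T) :
  loc_rel e b a -> loc_rel e (hscale c b) (hscale c a).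
Proof.
elim: e T b a => {X Y} [X Y f|X Y w Ww|X Y Z g IHg f IHf|X Y f IHf g IHg|X Y c' f IHf] T b a /=.
- by move=> <-; rewrite hcompZl; reflexivity.
- by move=> ->; rewrite hcompZl; reflexivity.
- move=> [T' [t [d [Wt gd fd]]]]; exists T', t, (hscale c d).
  by split=> //; rewrite hcompZr; [exact: IHg | exact: IHf].
- move=> [T' [t [a1 [a2 [Wt f1 g2 E]]]]]; exists T', t, (hscale c a1), (hscale c a2).
  split=> //; rewrite hcompZr; [exact: IHf | exact: IHg |].
  by rewrite E hscaleDr; reflexivity.
- move=> [T' [t [a1 [Wt f1 E]]]]; exists T', t, (hscale c a1); split=> //; rewrite hcompZr.
    exact: IHf.
  by rewrite E !hscaleA mulrC; reflexivity.
Qed.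

(* As the relations are total and functional, an inclusion between them is an equality. *)
Lemma loc_rel_incl X Y (e e' : loc_hom (@W) X Y) :
  (forall T b a, @loc_rel X Y e T b a -> loc_rel e' b a) ->
  forall T b a, @loc_rel X Y e T b a <-> loc_rel e' b a.
Proof.
move=> ee T b a; split=> [|ba]; first exact: ee.
have [T' [t [a' [Wt ba']]]] := loc_rel_total e b; apply: (loc_rel_local Wt).
have <- // : a' ≈ t ∘ a; apply: (loc_rel_fun (ee _ _ _ ba')); exact: loc_rel_comp.
Qed.

Lemma loc_eq_rel X Y (e e' : loc_hom (@W) X Y) : loc_eq e e' ->
  forall T b a, @loc_rel X Y e T b a <-> loc_rel e' b a.
Proof.
have Wid := calc_id calc.
elim=> {X Y e e'}.
- by [].
- by move=> X Y f g _ IH T b a; rewrite IH.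
- by move=> X Y f g h _ IH _ IH' T b a; rewrite IH.
- move=> X Y Z g g' f f' _ IHg _ IHf T c a; split=> -[T' [t [b [Wt gb fb]]]];
    by exists T', t, b; split=> //; [apply/IHg | apply/IHf].
- move=> X Y f f' g g' _ IHf _ IHg T b a; split=> -[T' [t [a1 [a2 [Wt f1 g2 E]]]]];
    by exists T', t, a1, a2; split=> //; [apply/IHf | apply/IHg].
- move=> X Y c f f' _ IHf T b a; split=> -[T' [t [a1 [Wt f1 E]]]];
    by exists T', t, a1; split=> //; apply/IHf.
- move=> X Y Z V h g f; apply: loc_rel_incl => T d a /=.
  move=> [T1 [t1 [c [W1 hc [T2 [t2 [b [W2 gb fb]]]]]]]].
  exists T2, (t2 ∘ t1), b; split; first exact: (calc_comp calc).
    exists T2, (hid T2), (t2 ∘ c); split=> //.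
      by rewrite hcomp1f -hcompA; exact: loc_rel_comp.
    by rewrite hcomp1f.
  by rewrite -hcompA.
- move=> X Y f; apply: loc_rel_incl => T b a /= [T' [t [c [Wt E fc]]]].
  by apply: (loc_rel_local Wt); move: E; rewrite hcompf1 => ->.
- move=> X Y f; apply: loc_rel_incl => T b a /= [T' [t [c [Wt fc E]]]].
  by apply: (loc_rel_local Wt); move: E; rewrite hcompf1 => <-.
- move=> X Y f g h; apply: loc_rel_incl => T b a /=.
  move=> [T1 [t1 [a1 [a2 [W1 f1 [T2 [t2 [a3 [a4 [W2 g3 h4 E2]]]]] E1]]]]].
  exists T2, (t2 ∘ t1), (hadd (t2 ∘ a1) a3), a4; split; first exact: (calc_comp calc).
  + exists T2, (hid T2), (t2 ∘ a1), a3; split=> //.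
    * by rewrite hcomp1f -hcompA; exact: loc_rel_comp.
    * by rewrite hcomp1f -hcompA.
    * by rewrite hcomp1f; reflexivity.
  + by rewrite -hcompA.
  + by rewrite -hcompA E1 hcompDr E2 haddA; reflexivity.
- move=> X Y f g; apply: loc_rel_incl => T b a /= [T' [t [a1 [a2 [Wt f1 g2 E]]]]].
  by exists T', t, a2, a1; split=> //; rewrite E haddC; reflexivity.
- move=> X Y f; apply: loc_rel_incl => T b a /= [T' [t [a1 [a2 [Wt f1 g2 E]]]]].
  by apply: (loc_rel_local Wt); rewrite E -f1 hcompf0 hadd0f.
- move=> X Y f; apply: loc_rel_incl => T b a /= [T' [t [a1 [Wt f1 E]]]].
  by apply: (frac_mono Wt); rewrite E hscale0f !hcompf0; reflexivity.
- move=> X Y f; apply: loc_rel_incl => T b a /= [T' [t [a1 [Wt f1 E]]]].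
  by apply: (loc_rel_local Wt); rewrite E hscale1f.
- move=> X Y c c' f; apply: loc_rel_incl => T b a /=.
  move=> [T1 [t1 [a1 [W1 [T2 [t2 [a2 [W2 f2 E2]]]] E1]]]].
  exists T2, (t2 ∘ t1), a2; split; first exact: (calc_comp calc).
    by rewrite -hcompA.
  by rewrite -hcompA E1 hcompZr E2 hscaleA; reflexivity.
- move=> X Y c f g; apply: loc_rel_incl => T b a /=.
  move=> [T1 [t1 [a1 [W1 [T2 [t2 [a2 [a3 [W2 f2 g3 E2]]]]] E1]]]].
  exists T2, (t2 ∘ t1), (hscale c a2), (hscale c a3); split; first exact: (calc_comp calc).
  + exists T2, (hid T2), a2; split=> //; last by rewrite hcomp1f; reflexivity.
    by rewrite hcomp1f -hcompA.
  + exists T2, (hid T2), a3; split=> //; last by rewrite hcomp1f; reflexivity.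
    by rewrite hcomp1f -hcompA.
  + by rewrite -hcompA E1 hcompZr E2 hscaleDr; reflexivity.
- move=> X Y c c' f; apply: loc_rel_incl => T b a /= [T1 [t1 [a1 [W1 f1 E1]]]].
  exists T1, t1, (hscale c a1), (hscale c' a1); split=> //.
  + by exists T1, (hid T1), a1; split=> //; rewrite hcomp1f //; reflexivity.
  + by exists T1, (hid T1), a1; split=> //; rewrite hcomp1f //; reflexivity.
  + by rewrite E1 hscaleDl; reflexivity.
- move=> X Y Z g g' f; apply: loc_rel_incl => T c a /=.
  move=> [T1 [t1 [b [W1 [T2 [t2 [b1 [b2 [W2 g1 g2 E2]]]]] fb]]]].
  (* The target is enlarged twice, until f acts on both summands; additivity and uniqueness then
     identify the sum with the action of f on [b]. *)
  have [T3 [t3 [a1 [W3 f1]]]] := loc_rel_total f b1.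
  have [T4 [t4 [a2 [W4 f2]]]] := loc_rel_total f (t3 ∘ b2).
  have W' : W (t4 ∘ (t3 ∘ (t2 ∘ t1))) by do !apply: (calc_comp calc) => //.
  exists T4, (t4 ∘ (t3 ∘ (t2 ∘ t1))), (t4 ∘ a1), a2; split=> //.
  + exists T4, (hid T4), (t4 ∘ (t3 ∘ b1)); split=> //.
      by rewrite hcomp1f -!hcompA; do 2!apply: loc_rel_comp.
    by rewrite hcomp1f; exact: loc_rel_comp.
  + exists T4, (hid T4), (t4 ∘ (t3 ∘ b2)); split=> //.
      by rewrite hcomp1f -!hcompA; do 2!apply: loc_rel_comp.
    by rewrite hcomp1f.
  + apply: (@loc_rel_fun _ _ f _ (t4 ∘ (t3 ∘ (t2 ∘ b)))).
      by rewrite -!hcompA; do 3!apply: loc_rel_comp.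
    rewrite E2 !hcompDr; apply: loc_rel_add => //; exact: loc_rel_comp.
- move=> X Y Z g f f'; apply: loc_rel_incl => T c a /=.
  move=> [T1 [t1 [b [W1 gb [T2 [t2 [a1 [a2 [W2 f1 f2 E2]]]]]]]]].
  exists T2, (t2 ∘ t1), a1, a2; split; first exact: (calc_comp calc).
  + exists T2, (hid T2), (t2 ∘ b); split=> //; rewrite hcomp1f -?hcompA //.
    exact: loc_rel_comp.
  + exists T2, (hid T2), (t2 ∘ b); split=> //; rewrite hcomp1f -?hcompA //.
    exact: loc_rel_comp.
  + by rewrite -hcompA.
- move=> X Y Z c g f; apply: loc_rel_incl => T d a /=.
  move=> [T1 [t1 [b [W1 [T2 [t2 [b1 [W2 g1 E2]]]] fb]]]].
  have [T3 [t3 [a1 [W3 f1]]]] := loc_rel_total f b1.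
  have W' : W (t3 ∘ (t2 ∘ t1)) by do !apply: (calc_comp calc) => //.
  exists T3, (t3 ∘ (t2 ∘ t1)), a1; split=> //.
    exists T3, (hid T3), (t3 ∘ b1); split=> //; last by rewrite hcomp1f.
    by rewrite hcomp1f -!hcompA; exact: loc_rel_comp.
  apply: (@loc_rel_fun _ _ f _ (t3 ∘ (t2 ∘ b))).
    by rewrite -!hcompA; do 2!apply: loc_rel_comp.
  by rewrite E2 hcompZr; exact: loc_rel_scale.
- move=> X Y Z c g f; apply: loc_rel_incl => T d a /=.
  move=> [T1 [t1 [b [W1 gb [T2 [t2 [a1 [W2 f1 E2]]]]]]]].
  exists T2, (t2 ∘ t1), a1; split; first exact: (calc_comp calc).
    exists T2, (hid T2), (t2 ∘ b); split=> //; last by rewrite hcomp1f.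
    by rewrite hcomp1f -hcompA; exact: loc_rel_comp.
  by rewrite -hcompA.
- move=> X Y f g fg; apply: loc_rel_incl => T b a /= <-.
  by rewrite fg; reflexivity.
- move=> X Y Z g f; apply: loc_rel_incl => T b a /= E.
  exists T, (hid T), (b ∘ g); split=> //; rewrite hcomp1f; first by reflexivity.
  by rewrite -E hcompA; reflexivity.
- move=> X Y f g; apply: loc_rel_incl => T b a /= E.
  exists T, (hid T), (b ∘ f), (b ∘ g); split=> //; rewrite hcomp1f; try by reflexivity.
  by rewrite -E hcompDr; reflexivity.
- move=> X Y c f; apply: loc_rel_incl => T b a /= E.
  exists T, (hid T), (b ∘ f); split=> //; rewrite hcomp1f; first by reflexivity.
  by rewrite -E hcompZr; reflexivity.
- move=> X Y w Ww; apply: loc_rel_incl => T c a /= [T' [t [b [Wt E1 E2]]]].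
  by apply: (frac_mono Wt); rewrite hcompf1 E1 E2; reflexivity.
- move=> X Y w Ww; apply: loc_rel_incl => T c a /= [T' [t [b [Wt E1 E2]]]].
  apply: (frac_mono Wt); rewrite hcompf1; apply: (frac_epi Ww).
  by rewrite E1 E2; reflexivity.
Qed.

(** The action of [Loc f] on the identity of Y is f up to [≈], so terms with equal actions come from
    equivalent maps. *)
Lemma loc_eq_frac X Y (f g : mor C X Y) : loc f ≡ loc g -> f ≈ g.
Proof.
move=> E; have [+ _] := loc_eq_rel E (hid Y) f; rewrite /= !hcomp1f => fg.
by symmetry; apply: fg; reflexivity.
Qed.

Lemma loc_rel_sound X Y (e : loc_hom (@W) X Y) T (b : mor C Y T) (a : mor C X T) :
  loc_rel e b a -> loc b ∘ (e : mor D X Y) ≡ loc a.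
Proof.
elim: e T b a => {X Y} [X Y f|X Y w Ww|X Y Z g IHg f IHf|X Y f IHf g IHg|X Y c f IHf] T b a E;
  rewrite /= in E.
- by rewrite -loc_compE; exact: frac_loc.
- rewrite (frac_loc E) loc_compE -hcompA.
  by rewrite (loc_invr Ww : loc w ∘ (LocInv Ww : mor D _ _) ≡ hid (Y : D)) hcompf1.
- move: E => [T' [t [d [Wt /IHg gd /IHf fd]]]]; apply: (iso_cancel_l (loc_iso Wt)).
  rewrite -(loc_compE t a) -fd -gd loc_compE -!hcompA; exact: heq_refl.
- move: E => [T' [t [a1 [a2 [Wt /IHf f1 /IHg g2 /frac_loc E]]]]].
  apply: (iso_cancel_l (loc_iso Wt)).
  rewrite -(loc_compE t a) E loc_addE -f1 -g2 hcompA -loc_compE.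
  exact: (hcompDr (loc (t ∘ b)) (f : mor D X Y) (g : mor D X Y)).
- move: E => [T' [t [a1 [Wt /IHf f1 /frac_loc E]]]]; apply: (iso_cancel_l (loc_iso Wt)).
  rewrite -(loc_compE t a) E loc_scaleE -f1 hcompA -loc_compE.
  exact: (hcompZr c (loc (t ∘ b)) (f : mor D X Y)).
Qed.

(** The fraction is read off from the action of [e] on the identity of Y. *)
Lemma left_fraction (X Y : D) (e : mor D X Y) :
  exists (Y' : C) (t : mor C Y Y') (f : mor C X Y'), W t /\ loc t ∘ e ≡ loc f.
Proof.
have [Y' [t [f [Wt ef]]]] := loc_rel_total e (hid (Y : C)); exists Y', t, f; split=> //.
rewrite -(loc_rel_sound ef) loc_compE.
by rewrite (_ : loc (hid (Y : C)) ≡ hid Y) // hcompf1.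
Qed.

End LeftCalculus.

(** * Differential graded modules *)

Lemma addr_insert (V : zmodType) (a b c d : V) : a + (c + d) = a - b + (c + (b + d)).
Proof. by rewrite (addrCA c b d) [RHS]addrA subrK. Qed.

Section DG.
Variables (k : fieldType) (A : dgcat k).
Implicit Types M N P : dgmod A.

Arguments md {k A} M {x i} : rename.
Arguments dgact {k A} M {x y i j l} e u a : rename.

Section Act.
Variable M : dgmod A.
Variables (x y : A) (i j l : int) (e : i + j = l).
Lemma dgactD u v (a : dghom x y j) : dgact M e (u + v) a = dgact M e u a + dgact M e v a.
Proof. by have /= := dgact_linear_l e a 1 u v; rewrite !scale1r. Qed.
Lemma dgact0 (a : dghom x y j) : dgact M e 0 a = 0.
Proof. by apply: (addrI (dgact M e 0 a)); rewrite -dgactD !addr0. Qed.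
Lemma dgactZ c u (a : dghom x y j) : dgact M e (c *: u) a = c *: dgact M e u a.
Proof. by have /= := dgact_linear_l e a c u 0; rewrite !addr0 dgact0 addr0. Qed.
Lemma dgactN u (a : dghom x y j) : dgact M e (- u) a = - dgact M e u a.
Proof. by rewrite -scaleN1r dgactZ scaleN1r. Qed.
Lemma dgactB u v (a : dghom x y j) : dgact M e (u - v) a = dgact M e u a - dgact M e v a.
Proof. by rewrite dgactD dgactN. Qed.
Lemma dgact_irr (e' : i + j = l) u (a : dghom x y j) : dgact M e u a = dgact M e' u a.
Proof. by rewrite (eq_irrelevance e e'). Qed.
End Act.

Lemma opp_linear (U V : lmodType k) (f : {linear U -> V}) : linear (fun u => - f u).
Proof. by move=> c u v; rewrite linearP opprD scalerN. Qed.

Lemma shift_deg i j l : i + j = l -> (i + 1) + j = l + 1 :> int.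
Proof. by move=> <-; rewrite addrAC. Qed.

(** For right modules only the differential changes sign; in the Leibniz rule this cancels against
    the change of parity from i to i + 1. *)
Definition dgshift (M : dgmod A) : dgmod A.
Proof.
refine (@DGMod k A (fun x i => M x (i + 1))
  (fun x i => linear_of (opp_linear (@md k A M x (i + 1))))
  (fun x y i j l e u a => dgact M (shift_deg e) u a) _ _ _ _ _ _).
- by move=> x i u /=; rewrite linearN opprK mdd.
- by move=> x y i j l e a; exact: dgact_linear_l.
- by move=> x y i j l e u; exact: dgact_linear_r.
- by move=> *; exact: dgactA.
- by move=> *; exact: dgact1.
- move=> x y i j l e e1 e2 u a /=.
  rewrite (m_leibniz _ (shift_deg e1) (shift_deg e2)) dgactN opprD; congr (_ + _).
  by rewrite exprzDr ?unitrN1 // expr1z mulrN1 scaleNr opprK.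
Defined.

Definition dgshift_hom M N (f : dgmod_hom M N) : dgmod_hom (dgshift M) (dgshift N).
Proof.
refine (@DGModHom k A (dgshift M) (dgshift N) (fun x i => mfun f x (i + 1)) _ _).
- by move=> x i u /=; rewrite linearN mfun_d.
- by move=> x y i j l e u a /=; rewrite mfun_act.
Defined.

Definition dgshift_functor : klinfunctor (dgmod_cat A) (dgmod_cat A).
Proof.
refine (@KLinFunctor k (dgmod_cat A) (dgmod_cat A) dgshift
  (fun M N f => dgshift_hom f) _ _ _ _ _) => //.
by move=> M N f g fg x i u /=; exact: fg.
Defined.

(* Transport along equalities of degrees; it is only needed for the inverse shift. *)
Definition mcast M x i j (e : i = j) (u : M x i) : M x j :=
  match e in _ = j return M x j with erefl => u end.

(** The differential with its target degree given by a proof, since (i - 1) + 1 and (i + 1) - 1 are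
    not convertible. *)
Definition mdc M x i j (e : i + 1 = j) (u : M x i) : M x j := mcast e (md M u).

Lemma mcast_linear M x i j (e : i = j) : linear (@mcast M x i j e).
Proof. by case: j / e. Qed.

Lemma mdc_linear M x i j (e : i + 1 = j) : linear (@mdc M x i j e).
Proof. by case: j / e => c u v; rewrite /mdc /= linearP. Qed.

Lemma mdcN M x i j (e : i + 1 = j) (u : M x i) : mdc e (- u) = - mdc e u.
Proof. exact: (linearN (linear_of (mdc_linear e))). Qed.

Lemma mcast_id M x i (e : i = i) (u : M x i) : mcast e u = u.
Proof. by rewrite (eq_irrelevance e erefl). Qed.

Lemma mcastK M x i j (e : i = j) (e' : j = i) (u : M x i) : mcast e' (mcast e u) = u.
Proof. by case: j / e e' => e'; rewrite mcast_id. Qed.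

Lemma mcast_mdc M x i j i' j' (c : i = j) (e : i + 1 = i') (e' : j + 1 = j') (c' : i' = j')
  (u : M x i) : mcast c' (mdc e u) = mdc e' (mcast c u).
Proof.
case: j / c e'; case: i' / e c' => c' e'; case: j' / c' e' => e' /=.
by rewrite (eq_irrelevance e' erefl).
Qed.

Lemma mcast_act M (x y : A) i i' j l l' (c : i = i') (c' : l = l') (e : i + j = l)
    (e' : i' + j = l') (u : M y i) (a : dghom x y j) :
  mcast c' (dgact M e u a) = dgact M e' (mcast c u) a.
Proof. by case: i' / c e'; case: l' / c' => e'; exact: dgact_irr. Qed.

Lemma mdc_mdc M x i j l (e : i + 1 = j) (e' : j + 1 = l) (u : M x i) : mdc e' (mdc e u) = 0.
Proof. by case: j / e e' => e'; case: l / e'; rewrite /mdc /= mdd. Qed.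

Lemma mdc_act M (x y : A) i i' j l l' (e : i + j = l) (f : l + 1 = l') (g : i + 1 = i')
    (e1 : i' + j = l') (e2 : i + (j + 1) = l') (u : M y i) (a : dghom x y j) :
  mdc f (dgact M e u a) =
    dgact M e1 (mdc g u) a + (-1 : k) ^ i *: dgact M e2 u (dgd _ _ _ a).
Proof. by case: i' / g e1 => e1; case: l' / f e1 e2 => e1 e2; exact: m_leibniz. Qed.

Lemma mfun_cast M N (f : dgmod_hom M N) x i j (e : i = j) (u : M x i) :
  mfun f x j (mcast e u) = mcast e (mfun f x i u).
Proof. by case: j / e. Qed.

Lemma mfun_mdc M N (f : dgmod_hom M N) x i j (e : i + 1 = j) (u : M x i) :
  mfun f x j (mdc e u) = mdc e (mfun f x i u).
Proof. by rewrite /mdc mfun_cast mfun_d. Qed.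

Lemma unshift_deg i j l : i + j = l -> (i - 1) + j = l - 1 :> int.
Proof. by move=> <-; rewrite addrAC. Qed.

Lemma unshift_deg1 i : (i - 1) + 1 = (i + 1) - 1 :> int.
Proof. by rewrite addrAC. Qed.

Definition dgunshift (M : dgmod A) : dgmod A.
Proof.
refine (@DGMod k A (fun x i => M x (i - 1))
  (fun x i => linear_of (opp_linear (linear_of (@mdc_linear M x _ _ (unshift_deg1 i)))))
  (fun x y i j l e u a => dgact M (unshift_deg e) u a) _ _ _ _ _ _).
- by move=> x i u /=; rewrite mdcN opprK mdc_mdc.
- by move=> x y i j l e a; exact: dgact_linear_l.
- by move=> x y i j l e u; exact: dgact_linear_r.
- by move=> *; exact: dgactA.
- by move=> *; exact: dgact1.
- move=> x y i j l e e1 e2 u a /=.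
  rewrite (mdc_act _ _ (unshift_deg1 i) (unshift_deg e1) (unshift_deg e2)) dgactN opprD.
  congr (_ + _); rewrite exprzDr ?unitrN1 // -[_ ^ -1]/((-1) ^-1) invrN1 mulrN1.
  by rewrite scaleNr opprK.
Defined.

Definition dgunshift_hom M N (f : dgmod_hom M N) : dgmod_hom (dgunshift M) (dgunshift N).
Proof.
refine (@DGModHom k A (dgunshift M) (dgunshift N) (fun x i => mfun f x (i - 1)) _ _).
- by move=> x i u /=; rewrite linearN mfun_mdc.
- by move=> x y i j l e u a /=; rewrite mfun_act.
Defined.

Definition dgunshift_functor : klinfunctor (dgmod_cat A) (dgmod_cat A).
Proof.
refine (@KLinFunctor k (dgmod_cat A) (dgmod_cat A) dgunshift
  (fun M N f => dgunshift_hom f) _ _ _ _ _) => //.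
by move=> M N f g fg x i u /=; exact: fg.
Defined.

Definition shift_counit M : dgmod_hom (dgshift (dgunshift M)) M.
Proof.
refine (@DGModHom k A (dgshift (dgunshift M)) M
  (fun x i => linear_of (@mcast_linear M x _ _ (addrK 1 i))) _ _).
- move=> x i u /=; rewrite opprK (mcast_mdc (addrK 1 i) _ erefl).
  by rewrite /mdc.
- by move=> x y i j l e u a /=; exact: mcast_act.
Defined.

Definition shift_counit_inv M : dgmod_hom M (dgshift (dgunshift M)).
Proof.
refine (@DGModHom k A M (dgshift (dgunshift M))
  (fun x i => linear_of (@mcast_linear M x _ _ (esym (addrK 1 i)))) _ _).
- move=> x i u /=; rewrite opprK.
exact: (mcast_mdc (esym (addrK 1 i)) erefl).
- by move=> x y i j l e u a /=; exact: mcast_act.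
Defined.

Lemma mdc_shift M x i j (e : i + 1 = j) (e' : (i + 1) + 1 = j + 1) (u : dgshift M x i) :
  @mdc (dgshift M) x i j e u = - @mdc M x (i + 1) (j + 1) e' u.
Proof. by case: j / e e' => e'; rewrite (eq_irrelevance e' erefl). Qed.

Definition shift_unit M : dgmod_hom M (dgunshift (dgshift M)).
Proof.
refine (@DGModHom k A M (dgunshift (dgshift M))
  (fun x i => linear_of (@mcast_linear M x _ _ (esym (subrK 1 i)))) _ _).
- move=> x i u /=.
  rewrite (mdc_shift _ (shift_deg (unshift_deg1 i))) opprK.
  exact: (mcast_mdc (esym (subrK 1 i)) erefl).
- by move=> x y i j l e u a /=; exact: mcast_act.
Defined.

Definition shift_unit_inv M : dgmod_hom (dgunshift (dgshift M)) M.
Proof.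
refine (@DGModHom k A (dgunshift (dgshift M)) M
  (fun x i => linear_of (@mcast_linear M x _ _ (subrK 1 i))) _ _).
- move=> x i u /=; rewrite (mdc_shift _ (shift_deg (unshift_deg1 i))) opprK.
  by rewrite (mcast_mdc (subrK 1 i) _ erefl).
- by move=> x y i j l e u a /=; exact: mcast_act.
Defined.

Lemma qisP M N (f : dgmod_hom M N) : quasi_iso f ->
  forall x i j (e : i + 1 = j),
    (forall z : M x j, md M z = 0 -> (exists y : N x i, mdc e y = mfun f _ _ z) ->
       exists y : M x i, mdc e y = z) /\
    (forall z : N x j, md N z = 0 -> exists (w : M x j) (y : N x i),
       md M w = 0 /\ z = mfun f _ _ w + mdc e y).
Proof. by move=> qf x i j e; case: j / e; exact: qf. Qed.

Lemma mdc_eq0 M x i j (e : i + 1 = j) (u : M x i) : mdc e u = 0 <-> md M u = 0.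
Proof. by case: j / e. Qed.

Lemma qis_shift M N (f : dgmod_hom M N) : quasi_iso f -> quasi_iso (dgshift_hom f).
Proof.
move=> qf x i; have [inj sur] := qf x (i + 1); split=> z /=.
  move=> /eqP; rewrite oppr_eq0 => /eqP z0 [y yE].
  have [|w wE] := inj z z0; first by exists (- y); rewrite linearN.
  by exists (- w); rewrite linearN opprK.
move=> /eqP; rewrite oppr_eq0 => /eqP z0; have [w [y [w0 ->]]] := sur z z0.
by exists w, (- y); rewrite w0 oppr0 linearN opprK.
Qed.

Lemma qis_unshift M N (f : dgmod_hom M N) : quasi_iso f -> quasi_iso (dgunshift_hom f).
Proof.
move=> qf x i; have [inj sur] := qisP qf x (unshift_deg1 i); split=> z /=.
  move=> /eqP; rewrite oppr_eq0 => /eqP/mdc_eq0 z0 [y yE].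
  have [|w wE] := inj z z0; first by exists (- y); rewrite mdcN.
  by exists (- w); rewrite mdcN opprK.
move=> /eqP; rewrite oppr_eq0 => /eqP/mdc_eq0 z0; have [w [y [w0 ->]]] := sur z z0.
exists w, (- y); rewrite mdcN opprK; split=> //.
by apply/eqP; rewrite oppr_eq0; apply/eqP/mdc_eq0.
Qed.

(* A homotopy from [g] to [f] is only evaluated in the degrees [i + 1]; every integer is of
   this form. *)
Definition homotopic M N (f g : dgmod_hom M N) : Prop :=
  exists s : forall x i, {linear M x (i + 1) -> N x i},
    (forall (x y : A) i j l (e : i + j = l) (e' : (i + 1) + j = l + 1)
       (u : M y (i + 1)) (a : dghom x y j), s x l (dgact M e' u a) = dgact N e (s y i u) a) /\
    (forall x i (u : M x (i + 1)),
       mfun f _ _ u = mfun g _ _ u + (md N (s x i u) + s x (i + 1) (md M u))).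

Definition prod_module (U V : lmodType k) : lmodType k := (U * V)%type.

(** * The mapping cone of a morphism of dg modules *)

Section Cone.
Variables (X Y : dgmod A) (f : dgmod_hom X Y).

Definition cone_car (x : A) (i : int) : lmodType k := prod_module (X x (i + 1)) (Y x i).

Definition cone_d x i (u : cone_car x i) : cone_car x (i + 1) :=
  (- md X u.1, mfun f _ _ u.1 + md Y u.2).

Lemma cone_d_linear x i : linear (@cone_d x i).
Proof.
move=> c [u1 u2] [v1 v2]; rewrite /cone_d /= !linearP.
congr (_, _); rewrite -[RHS]/(c *: (_ + _) + (_ + _)).
by rewrite scalerDr addrACA.
Qed.

Definition dgcone : dgmod A.
Proof.
refine (@DGMod k A cone_car (fun x i => linear_of (@cone_d_linear x i))
  (fun x y i j l e u a => (dgact X (shift_deg e) u.1 a, dgact Y e u.2 a)) _ _ _ _ _ _).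
- move=> x i [u1 u2]; rewrite /= /cone_d /=; congr (_, _).
    by rewrite (linearN (md X)) mdd !oppr0.
  by rewrite (linearN (mfun f _ _)) mfun_d (linearD (md Y)) mdd addr0 addNr.
- move=> x y i j l e a c [u1 u2] [v1 v2] /=.
  by congr (_, _); exact: dgact_linear_l.
- by move=> x y i j l e [u1 u2] c a b /=; congr (_, _); exact: dgact_linear_r.
- by move=> *; congr (_, _); exact: dgactA.
- by move=> x i e [u1 u2]; congr (_, _); exact: dgact1.
- move=> x y i j l e e1 e2 [u1 u2] a; rewrite /= /cone_d /=; congr (_, _).
    rewrite (m_leibniz _ (shift_deg e1) (shift_deg e2)) dgactN opprD; congr (_ + _).
    by rewrite exprzDr ?unitrN1 // expr1z mulrN1 scaleNr opprK.
  rewrite -[RHS]/(dgact Y e1 (mfun f _ _ u1 + md Y u2) a +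
    (-1) ^ i *: dgact Y e2 u2 (dgd _ _ _ a)).
  by rewrite (m_leibniz _ e1 e2) mfun_act dgactD addrA (dgact_irr (shift_deg e) e1).
Defined.

Lemma cone_in_linear x i : linear (fun v : Y x i => (0, v) : dgcone x i).
Proof. by move=> c u v; congr (_, _); rewrite -[RHS]/(c *: 0 + 0) scaler0 addr0. Qed.

Definition cone_in : dgmod_hom Y dgcone.
Proof.
refine (@DGModHom k A Y dgcone (fun x i => linear_of (@cone_in_linear x i)) _ _).
- by move=> x i u; rewrite /= /cone_d /= !linear0 add0r.
- by move=> x y i j l e u a /=; rewrite dgact0.
Defined.

Lemma cone_out_linear x i : linear (fun u : dgcone x i => u.1 : dgshift X x i).
Proof. by []. Qed.

Definition cone_out : dgmod_hom dgcone (dgshift X).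
Proof.
by refine (@DGModHom k A dgcone (dgshift X) (fun x i => linear_of (@cone_out_linear x i)) _ _).
Defined.

Lemma cone_in_comp : homotopic (dgmod_comp cone_in f) (dgmod_zero X dgcone).
Proof.
have l x i : linear (fun u : X x (i + 1) => (u, 0) : dgcone x i).
  by move=> c u v; congr (_, _); rewrite -[RHS]/(c *: 0 + 0) scaler0 addr0.
exists (fun x i => linear_of (l x i)); split.
- move=> x y i j l0 e e' u a /=; congr (_, _); first exact: dgact_irr.
  by rewrite dgact0.
- move=> x i u /=; rewrite /cone_d /= linear0 addr0 add0r.
  by rewrite -[RHS]/(- md X u + md X u, mfun f _ _ u + 0) addNr addr0.
Qed.

Lemma shift_comp_cone_out :
  homotopic (dgmod_comp (dgshift_hom f) cone_out) (dgmod_zero dgcone (dgshift Y)).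
Proof.
have l x i : linear (fun u : dgcone x (i + 1) => u.2 : dgshift Y x i) by [].
exists (fun x i => linear_of (l x i)); split.
- by move=> x y i j l0 e e' u a /=; exact: dgact_irr.
- by move=> x i u /=; rewrite add0r addrCA addNr addr0.
Qed.

(** A map out of the cone amounts to a map u out of Y and a null-homotopy s of u f. *)
Lemma cone_copair (V : dgmod A) (s : forall x i, {linear X x (i + 1) -> V x i})
    (u : dgmod_hom Y V) :
  (forall (x y : A) i j l (e : i + j = l) (e' : (i + 1) + j = l + 1)
       (v : X y (i + 1)) (a : dghom x y j), s x l (dgact X e' v a) = dgact V e (s y i v) a) ->
  (forall x i (v : X x (i + 1)),
     mfun u _ _ (mfun f _ _ v) = md V (s x i v) + s x (i + 1) (md X v)) ->
  exists h : dgmod_hom dgcone V, forall x i (w : dgcone x i),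
    mfun h _ _ w = s x i w.1 + mfun u _ _ w.2.
Proof.
move=> sa sd.
have l x i : linear (fun w : dgcone x i => s x i w.1 + mfun u _ _ w.2 : V x i).
  move=> c [v1 v2] [w1 w2] /=; rewrite -[LHS]/(s x i (c *: v1 + w1) + mfun u x i (c *: v2 + w2)).
  by rewrite !linearP scalerDr addrACA.
unshelve refine (ex_intro _ (@DGModHom k A dgcone V (fun x i => linear_of (l x i)) _ _) _) => //.
- move=> x i [v1 v2]; rewrite /= /cone_d /= linearN linearD /= sd mfun_d linearD.
  by rewrite addrA; congr (_ + _); rewrite addrC addrK.
- move=> x y i j l0 e [v1 v2] a /=.
  by rewrite (sa _ _ _ _ _ e) mfun_act dgactD.
Qed.

Lemma cone_split (V : dgmod A) (u : dgmod_hom dgcone V) x i (p : X x (i + 1)) (q : Y x i) :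
  mfun u x i ((p, q) : dgcone x i) =
    mfun u x i ((p, 0) : dgcone x i) + mfun u x i ((0, q) : dgcone x i).
Proof.
rewrite -linearD; congr (mfun u x i _).
by rewrite -[RHS]/(p + 0, 0 + q) addr0 add0r.
Qed.

Lemma cone_exact_in (V : dgmod A) (u : dgmod_hom dgcone V) :
  homotopic (dgmod_comp u cone_in) (dgmod_zero Y V) ->
  exists v : dgmod_hom (dgshift X) V, homotopic u (dgmod_comp v cone_out).
Proof.
move=> [s [sa sd]]; rewrite /= in sd.
pose inl x i (p : X x (i + 1)) : dgcone x i := (p, 0).
have inl_linear x i : linear (@inl x i).
  by move=> c p q; congr (_, _); rewrite -[RHS]/(c *: 0 + 0) scaler0 addr0.
(* On the first summand u need not commute with the differentials: the defect is u (0, f p), and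
   subtracting s f corrects it. *)
pose v x i (p : dgshift X x i) : V x i := mfun u x i (inl x i p) - s x i (mfun f x (i + 1) p).
have v_linear x i : linear (@v x i).
  move=> c p q; rewrite /v inl_linear (linearP (mfun u x i)) (linearP (mfun f x (i + 1))).
  by rewrite (linearP (s x i)) scalerBr opprD addrACA.
unshelve refine (ex_intro _ (@DGModHom k A (dgshift X) V
  (fun x i => linear_of (v_linear x i)) _ _) _).
- move=> x i p; rewrite /= /v /inl linearB /= -[md V (mfun u _ _ _)]mfun_d /= /cone_d /=.
  rewrite (linear0 (md Y)) addr0 [in RHS]cone_split.
  have := sd x i (mfun f x (i + 1) p); rewrite add0r => ->.
  rewrite (linearN (mfun f _ _)) mfun_d (linearN (s x (i + 1))) opprK.
  by rewrite -[RHS]addrA; congr (_ + _); rewrite [RHS]addrAC subrr add0r.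
- move=> x y i j l e p a; rewrite /= /v mfun_act (sa _ _ _ _ _ e) dgactB; congr (_ - _).
  by rewrite -mfun_act; congr (mfun u _ _ _); rewrite /= dgact0.
exists (fun x i => linear_of (fun (c : k) (w1 w2 : dgcone x (i + 1)) =>
  linearP (s x i) c w1.2 w2.2)).
split.
- by move=> x y i j l e e' w a /=; exact: sa.
- move=> x i [p q] /=; rewrite cone_split /v /inl.
  have := sd x i q; rewrite add0r => ->; rewrite /cone_d /= linearD /=.
  exact: addr_insert.
Qed.

Lemma cone_exact_out (V : dgmod A) (u : dgmod_hom (dgshift X) V) :
  homotopic (dgmod_comp u cone_out) (dgmod_zero dgcone V) ->
  exists v : dgmod_hom (dgshift Y) V, homotopic u (dgmod_comp v (dgshift_hom f)).
Proof.
move=> [s [sa sd]]; rewrite /= in sd.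
(* [cone_out] vanishes on Y, so there the null-homotopy is a chain map out of the shift of Y; its
   other half is the homotopy sought. *)
pose v x i (q : dgshift Y x i) : V x i := s x i ((0, q) : dgcone x (i + 1)).
pose t x i (p : dgshift X x (i + 1)) : V x i := s x i ((p, 0) : dgcone x (i + 1)).
have v_linear x i : linear (@v x i).
  move=> c p q; rewrite /v -linearP; congr (s x i _); congr (_, _).
  by rewrite -[RHS]/(c *: 0 + 0) scaler0 addr0.
have t_linear x i : linear (@t x i).
  move=> c p q; rewrite /t -linearP; congr (s x i _); congr (_, _).
  by rewrite -[RHS]/(c *: 0 + 0) scaler0 addr0.
unshelve refine (ex_intro _ (@DGModHom k A (dgshift Y) V
  (fun x i => linear_of (v_linear x i)) _ _) _).
- move=> x i q; have := sd x i (0, q); rewrite /= /cone_d /= !linear0 !add0r.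
  move/eqP; rewrite eq_sym addr_eq0 => /eqP; rewrite /v => ->.
  rewrite -(linearN (s x (i + 1))); congr (s x (i + 1) _).
  by rewrite -[RHS]/(- 0, - md Y q) oppr0.
- move=> x y i j l e q a; rewrite /= /v -(sa _ _ _ _ _ e (shift_deg e)).
  by congr (s x l _); rewrite /= dgact0.
exists (fun x i => linear_of (t_linear x i)); split.
- move=> x y i j l e e' p a /=; rewrite /t -(sa _ _ _ _ _ e e').
  by congr (s x l _); rewrite /= dgact0.
- move=> x i p /=; have := sd x i (p, 0); rewrite /= /cone_d /= linear0 addr0 add0r => ->.
  rewrite [RHS]addrCA; congr (_ + _); rewrite /v /t -linearD; congr (s x (i + 1) _).
  by rewrite -[RHS]/(0 + - md X p, mfun f _ _ p + 0) add0r addr0.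
Qed.

End Cone.

End DG.

(** * Homotopies, quasi-isomorphisms and the Ore conditions *)

Section Homotopy.
Variables (k : fieldType) (A : dgcat k).
Implicit Types M N P : dgmod A.
Arguments md {k A} M {x i} : rename.
Arguments dgact {k A} M {x y i j l} e u a : rename.
Local Notation C := (dgmod_cat A).

Lemma homotopic_heq M N (f g : mor C M N) : f ≡ g -> homotopic f g.
Proof.
move=> fg; exists (fun x i => \0 : {linear M x (i + 1) -> N x i}); split.
  by move=> x y i j l e e' u a /=; rewrite dgact0.
by move=> x i u /=; rewrite linear0 !addr0 fg.
Qed.

Lemma homotopic_sym M N (f g : mor C M N) : homotopic f g -> homotopic g f.
Proof.
move=> [s [sa sd]]; exists (fun x i => linear_of (opp_linear (s x i))); split.
  by move=> x y i j l e e' u a /=; rewrite dgactN (sa _ _ _ _ _ e).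
by move=> x i u /=; rewrite sd (linearN (md N)) -opprD addrK.
Qed.

Lemma homotopic_trans M N (f g h : mor C M N) : homotopic f g -> homotopic g h -> homotopic f h.
Proof.
move=> [s [sa sd]] [s' [sa' sd']].
exists (fun x i => (s x i \+ s' x i) : {linear M x (i + 1) -> N x i}); split.
  by move=> x y i j l e e' u a /=; rewrite dgactD (sa _ _ _ _ _ e) (sa' _ _ _ _ _ e).
by move=> x i u /=; rewrite sd sd' (linearD (md N)) -addrA; congr (_ + _); rewrite addrC addrACA.
Qed.

Lemma homotopic_add M N (f f' g g' : mor C M N) : homotopic f f' -> homotopic g g' ->
  homotopic (hadd f g : mor C M N) (hadd f' g' : mor C M N).
Proof.
move=> [s [sa sd]] [s' [sa' sd']].
exists (fun x i => (s x i \+ s' x i) : {linear M x (i + 1) -> N x i}); split.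
  by move=> x y i j l e e' u a /=; rewrite dgactD (sa _ _ _ _ _ e) (sa' _ _ _ _ _ e).
by move=> x i u /=; rewrite sd sd' (linearD (md N)) addrACA; congr (_ + _); rewrite addrACA.
Qed.

Lemma homotopic_scale M N c (f g : mor C M N) : homotopic f g ->
  homotopic (hscale c f : mor C M N) (hscale c g : mor C M N).
Proof.
move=> [s [sa sd]]; exists (fun x i => (c \*: s x i) : {linear M x (i + 1) -> N x i}); split.
  by move=> x y i j l e e' u a /=; rewrite dgactZ (sa _ _ _ _ _ e).
by move=> x i u /=; rewrite sd (linearZZ (md N)) !scalerDr.
Qed.

Lemma homotopic_compl M N P (u : mor C N P) (f g : mor C M N) : homotopic f g ->
  homotopic (u ∘ f : mor C M P) (u ∘ g : mor C M P).
Proof.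
move=> [s [sa sd]]; exists (fun x i => (mfun u x i \o s x i) : {linear M x (i + 1) -> P x i}).
split; first by move=> x y i j l e e' v a /=; rewrite (sa _ _ _ _ _ e) mfun_act.
by move=> x i v /=; rewrite sd !linearD /= mfun_d.
Qed.

Lemma homotopic_compr M N P (u : mor C M N) (f g : mor C N P) : homotopic f g ->
  homotopic (f ∘ u : mor C M P) (g ∘ u : mor C M P).
Proof.
move=> [s [sa sd]].
exists (fun x i => (s x i \o mfun u x (i + 1)) : {linear M x (i + 1) -> P x i}).
split; first by move=> x y i j l e e' v a /=; rewrite mfun_act (sa _ _ _ _ _ e).
by move=> x i v /=; rewrite sd mfun_d.
Qed.

Lemma quasi_iso_id M : quasi_iso (hid (M : C)).
Proof.
move=> x i; split=> z z0 //; exists z, 0; split=> //.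
by rewrite linear0 addr0.
Qed.

Lemma quasi_iso_comp M N P (g : mor C N P) (f : mor C M N) :
  quasi_iso g -> quasi_iso f -> quasi_iso (g ∘ f : mor C M P).
Proof.
move=> qg qf x i; have [gi gs] := qg x i; have [fi fs] := qf x i; split=> z z0.
  by move=> ey; apply: (fi z z0); apply: (gi _ _ ey); rewrite -mfun_d z0 linear0.
have [w [y [w0 ->]]] := gs z z0; have [v [u [v0 ->]]] := fs w w0.
exists v, (mfun g _ _ u + y); split=> //.
by rewrite linearD /= mfun_d (linearD (md P)) addrA.
Qed.

Definition acyclic M := forall x i (z : M x (i + 1)), md M z = 0 -> exists y : M x i, md M y = z.

Lemma cone_acyclic M N (f : dgmod_hom M N) : quasi_iso f -> acyclic (dgcone f).
Proof.
move=> qf x i [p q]; rewrite /= /cone_d /= => E.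
have /eqP : - md M p = 0 := congr1 fst E; rewrite oppr_eq0 => /eqP p0.
have {E}q0 : mfun f _ _ p + md N q = 0 := congr1 snd E.
have [|p1 p1E] := (qf x (i + 1)).1 p p0.
  by exists (- q); apply/eqP; rewrite linearN eq_sym -addr_eq0 q0.
have [|w [y [w0 wE]]] := (qf x i).2 (mfun f _ _ p1 + q).
  by rewrite linearD /= -mfun_d p1E q0.
exists ((w - p1, y) : dgcone f x i); rewrite /= /cone_d /=; congr (_, _).
  by rewrite linearB /= w0 sub0r opprK.
by rewrite linearB /= addrAC -wE addrAC subrr add0r.
Qed.

Lemma zero_quasi_iso M : acyclic M -> quasi_iso (hzero (M : C) (M : C)).
Proof.
move=> aM x i; split=> z z0; first by move=> _; exact: aM.
by have [y yE] := aM _ _ z z0; exists 0, y; rewrite linear0 add0r.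
Qed.

(** The quotient of the cone by N is a shift of M, which has no cohomology. *)
Lemma cone_in_quasi_iso M N (f : dgmod_hom M N) : acyclic M -> quasi_iso (cone_in f).
Proof.
move=> aM x i; split=> z z0.
  move=> [[p q]]; rewrite /= /cone_d /= => E.
  have /eqP : - md M p = 0 := congr1 fst E; rewrite oppr_eq0 => /eqP p0.
  have {E}q0 : mfun f _ _ p + md N q = z := congr1 snd E.
  have [p1 p1E] := aM _ _ p p0; exists (mfun f _ _ p1 + q).
  by rewrite linearD /= -mfun_d p1E.
case: z z0 => p q; rewrite /= /cone_d /= => E.
have /eqP : - md M p = 0 := congr1 fst E; rewrite oppr_eq0 => /eqP p0.
have {E}q0 : mfun f _ _ p + md N q = 0 := congr1 snd E.
have [p1 p1E] := aM _ _ p p0.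
exists (mfun f _ _ p1 + q), ((- p1, 0) : dgcone f x i); split.
  by rewrite linearD /= -mfun_d p1E.
rewrite /= /cone_d /= (linear0 (md N)) addr0 (linearN (md M)) (linearN (mfun f _ _)) opprK p1E.
rewrite -[RHS]/(0 + p, mfun f x (i + 1) p1 + q - mfun f x (i + 1) p1) add0r.
by congr (_, _); rewrite [RHS]addrAC subrr add0r.
Qed.

(* A null-homotopic map factors through the cone of an identity, which is acyclic; the zero
   endomorphism of an acyclic module is inverted in the derived category. *)
Lemma null_homotopic_loc M N (f : mor C M N) : homotopic f (dgmod_zero M N) ->
  @loc_eq k C (@quasi_iso k A) M N (Loc (@quasi_iso k A) f) (Loc (@quasi_iso k A) (dgmod_zero M N)).
Proof.
move=> [s [sa sd]].
have [h hE] := @cone_copair k A M M (dgmod_id M) N s f sa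
  (fun x i v => etrans (sd x i v) (add0r _)).
set I : C := dgcone (dgmod_id M) in h hE.
pose D := derived_cat A; pose loc X Y (u : mor C X Y) : mor D X Y := Loc (@quasi_iso k A) u.
have qid : quasi_iso (dgmod_id M) by exact: quasi_iso_id.
have q0 : quasi_iso (hzero I I) by apply/zero_quasi_iso/cone_acyclic.
have I0 : hid (I : D) ≡ hzero (I : D) I.
  have I_iso : is_iso (hzero (I : D) I).
    by exists (LocInv q0 : mor D I I); split; [exact: loc_invl | exact: loc_invr].
  by apply: (iso_cancel_l I_iso); rewrite !hcomp0f.
have fE : f ≡ (h : mor C I N) ∘ (cone_in (dgmod_id M) : mor C M I).
  by move=> x i u; rewrite /= hE /= linear0 add0r.
have : loc _ _ f ≡ loc _ _ h ∘ loc _ _ (cone_in (dgmod_id M)).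
  by rewrite (loc_map_eq _ fE : loc _ _ f ≡ _); exact: loc_map_comp.
rewrite -(hcompf1 (loc _ _ h)) I0 hcompf0 hcomp0f; exact.
Qed.

Lemma hsub_zero M N (f g : mor C M N) : f ≡ hadd (hadd f (hscale (-1) g)) g.
Proof. by rewrite -haddA haddNf haddf0. Qed.

Lemma homotopic_sub M N (f g : mor C M N) : homotopic f g <->
  homotopic (hadd f (hscale (-1) g) : mor C M N) (dgmod_zero M N).
Proof.
split=> [fg|fg].
  apply: homotopic_trans (homotopic_add fg (homotopic_heq (heq_refl (hscale (-1) g)))) _.
  exact/homotopic_heq/haddfN.
apply: homotopic_trans (homotopic_heq (hsub_zero f g)) _.
apply: homotopic_trans (homotopic_add fg (homotopic_heq (heq_refl g))) _.
exact/homotopic_heq/hadd0f.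
Qed.

Lemma homotopic_loc M N (f g : mor C M N) : homotopic f g ->
  @loc_eq k C (@quasi_iso k A) M N (Loc (@quasi_iso k A) f) (Loc (@quasi_iso k A) g).
Proof.
move=> /homotopic_sub/null_homotopic_loc E.
pose D := derived_cat A; pose loc (u : mor C M N) : mor D M N := Loc (@quasi_iso k A) u.
suff : loc f ≡ loc g by [].
rewrite (loc_map_eq _ (hsub_zero f g) : loc f ≡ loc _).
rewrite (loc_map_add _ _ _ : loc _ ≡ hadd (loc _) (loc g)).
by rewrite (E : loc _ ≡ hzero (M : D) N) hadd0f.
Qed.

Definition dgsum_car M N (x : A) (i : int) : lmodType k := prod_module (M x i) (N x i).

Lemma dgsum_d_linear M N x i :
  linear (fun u : dgsum_car M N x i => (md M u.1, md N u.2) : dgsum_car M N x (i + 1)).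
Proof. by move=> c [u1 u2] [v1 v2] /=; congr (_, _); rewrite /= linearP. Qed.

Definition dgsum M N : dgmod A.
Proof.
refine (@DGMod k A (dgsum_car M N) (fun x i => linear_of (@dgsum_d_linear M N x i))
  (fun x y i j l e u a => (dgact M e u.1 a, dgact N e u.2 a)) _ _ _ _ _ _).
- by move=> x i [u1 u2] /=; rewrite !mdd.
- by move=> x y i j l e a c [u1 u2] [v1 v2] /=; congr (_, _); exact: dgact_linear_l.
- by move=> x y i j l e [u1 u2] c a b /=; congr (_, _); exact: dgact_linear_r.
- by move=> *; congr (_, _); exact: dgactA.
- by move=> x i e [u1 u2]; congr (_, _); exact: dgact1.
- by move=> x y i j l e e1 e2 [u1 u2] a /=; congr (_, _); exact: m_leibniz.
Defined.

(** N' is the homotopy pushout, the cone of (v, -f) into the direct sum. The canonical homotopy of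
    this cone makes the square commute, and N -> N' is a quasi-isomorphism because its quotient is
    the cone of v, which is acyclic. *)
Lemma quasi_iso_ore M M' N (v : mor C M M') (f : mor C M N) : quasi_iso v ->
  exists (N' : C) (v' : mor C N N') (f' : mor C M' N'),
    quasi_iso v' /\ homotopic (f' ∘ v : mor C M N') (v' ∘ f : mor C M N').
Proof.
move=> qv.
have vfl x i : linear (fun u : M x i => (mfun v x i u, - mfun f x i u) : dgsum M' N x i).
  by move=> c u1 u2; congr (_, _); rewrite /= linearP // opprD scalerN.
unshelve epose (vf := @DGModHom k A M (dgsum M' N) (fun x i => linear_of (vfl x i)) _ _).
- by move=> x i u /=; rewrite !mfun_d linearN.
- by move=> x y i j l e u a /=; rewrite !mfun_act dgactN.
have inl_l x i : linear (fun u : M' x i => (u, 0) : dgsum M' N x i).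
  by move=> c u1 u2; congr (_, _); rewrite -[RHS]/(c *: 0 + 0) scaler0 addr0.
unshelve epose (inl := @DGModHom k A M' (dgsum M' N) (fun x i => linear_of (inl_l x i)) _ _).
- by move=> x i u /=; rewrite linear0.
- by move=> x y i j l e u a /=; rewrite dgact0.
have inr_l x i : linear (fun u : N x i => (0, u) : dgsum M' N x i).
  by move=> c u1 u2; congr (_, _); rewrite -[RHS]/(c *: 0 + 0) scaler0 addr0.
unshelve epose (inr := @DGModHom k A N (dgsum M' N) (fun x i => linear_of (inr_l x i)) _ _).
- by move=> x i u /=; rewrite linear0.
- by move=> x y i j l e u a /=; rewrite dgact0.
exists (dgcone vf), (dgmod_comp (cone_in vf) inr), (dgmod_comp (cone_in vf) inl); split.
  move=> x i; split=> z z0.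
    move=> [[p [q r]]]; rewrite /= /cone_d /= => E.
    have /eqP : - md M p = 0 := congr1 fst E; rewrite oppr_eq0 => /eqP p0.
    have q0 : mfun v _ _ p + md M' q = 0 := congr1 (fun w => w.2.1) E.
    have r0 : - mfun f _ _ p + md N r = z := congr1 (fun w => w.2.2) E.
    have [|p1 p1E] := (qv x i).1 p p0.
      by exists (- q); apply/eqP; rewrite linearN eq_sym -addr_eq0 q0.
    exists (r - mfun f _ _ p1); by rewrite linearB /= -mfun_d p1E -r0 [RHS]addrC.
  case: z z0 => p [q r]; rewrite /= /cone_d /= => E.
  have /eqP : - md M p = 0 := congr1 fst E; rewrite oppr_eq0 => /eqP p0.
  have q0 : mfun v _ _ p + md M' q = 0 := congr1 (fun w => w.2.1) E.
  have r0 : - mfun f _ _ p + md N r = 0 := congr1 (fun w => w.2.2) E.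
  have [|p1 p1E] := (qv x (i + 1)).1 p p0.
    by exists (- q); apply/eqP; rewrite linearN eq_sym -addr_eq0 q0.
  have [|w [u [w0 wE]]] := (qv x i).2 (mfun v _ _ p1 + q).
    by rewrite linearD /= -mfun_d p1E q0.
  exists (r + mfun f _ _ (w - p1)), ((w - p1, (u, 0)) : dgcone vf x i); split.
    rewrite linearD /= -mfun_d linearB /= w0 p1E sub0r (linearN (mfun f _ _)).
    by rewrite -[RHS]r0 [RHS]addrC.
  rewrite /= /cone_d /= (linear0 (md N)).
  transitivity ((0 + - md M (w - p1), (0 + (mfun v _ _ (w - p1) + md M' u),
     r + mfun f _ _ (w - p1) + (- mfun f _ _ (w - p1) + 0))) : dgcone vf x (i + 1)); last by [].
  rewrite add0r (linearB (md M)) w0 p1E !sub0r opprK addr0 addrK.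
  congr (_, (_, _)); rewrite (linearB (mfun v _ _)) [RHS]addrAC -wE.
  by rewrite [RHS]addrAC subrr add0r.
have out_l x i : linear (fun u : M x (i + 1) => (u, 0) : dgcone vf x i).
  by move=> c u1 u2; congr (_, _); rewrite -[RHS]/(c *: 0 + 0) scaler0 addr0.
exists (fun x i => linear_of (out_l x i)); split.
- move=> x y i j l e e' u a /=; congr (_, (_, _)); first exact: dgact_irr.
    by rewrite dgact0.
  by rewrite dgact0.
- move=> x i u; rewrite /= /cone_d /= !linear0.
  transitivity ((0 + (- md M u + md M u), (0 + (mfun v _ _ u + 0 + 0),
    mfun f _ _ u + (- mfun f _ _ u + 0 + 0))) : dgcone vf x (i + 1)); last by [].
  by rewrite addNr !addr0 add0r subrr.
Qed.

(** The difference u = f - g extends to a map h on the cone of t, since u t is null-homotopic. That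
    cone is acyclic, so N -> cone(h) is a quasi-isomorphism; it kills h, and with it u, up to
    homotopy. *)
Lemma quasi_iso_cancel M' M N (t : mor C M' M) (f g : mor C M N) :
  quasi_iso t -> homotopic (f ∘ t : mor C M' N) (g ∘ t : mor C M' N) ->
  exists (N' : C) (v : mor C N N'),
    quasi_iso v /\ homotopic (v ∘ f : mor C M N') (v ∘ g : mor C M N').
Proof.
move=> qt /homotopic_sub E.
pose u : mor C M N := hadd f (hscale (-1) g).
have [s [sa sd]] : homotopic (u ∘ t : mor C M' N) (dgmod_zero M' N).
  apply: homotopic_trans E; apply: homotopic_heq.
  by rewrite /u hcompDl hcompZl.
have [h hE] := @cone_copair k A M' M t N s u sa (fun x i v => etrans (sd x i v) (add0r _)).
exists (dgcone h), (cone_in h); split; first exact/cone_in_quasi_iso/cone_acyclic.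
have uE : u ≡ (h : mor C (dgcone t) N) ∘ (cone_in t : mor C M (dgcone t)).
  by move=> x i w; rewrite /= hE /= linear0 add0r.
pose v : mor C N (dgcone h) := cone_in h.
have vu0 : homotopic (v ∘ u : mor C M (dgcone h)) (dgmod_zero M (dgcone h)).
  apply: homotopic_trans (homotopic_compl v (homotopic_heq uE)) _.
  apply: homotopic_trans (homotopic_heq (hcompA v (h : mor C (dgcone t) N) _)) _.
  apply: homotopic_trans (homotopic_compr (cone_in t : mor C M (dgcone t)) (cone_in_comp h)) _.
  by apply: homotopic_heq; exact: hcomp0f.
apply/homotopic_sub; apply: homotopic_trans vu0; apply: homotopic_heq.
by rewrite /u hcompDr hcompZr.
Qed.

Lemma derived_left_calculus : left_calculus (@quasi_iso k A) (@homotopic k A).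
Proof.
split.
- exact: quasi_iso_id.
- exact: quasi_iso_comp.
- exact: homotopic_heq.
- exact: homotopic_sym.
- exact: homotopic_trans.
- exact: homotopic_add.
- exact: homotopic_scale.
- exact: homotopic_compl.
- exact: homotopic_compr.
- exact: homotopic_loc.
- exact: quasi_iso_ore.
- exact: quasi_iso_cancel.
Qed.

End Homotopy.

(** * The derived category *)

Section LocalizationFunctors.
Variables (k : fieldType) (C C' : klincat k).
Variables (W : forall X Y : C, mor C X Y -> Prop) (W' : forall X Y : C', mor C' X Y -> Prop).

Section Functor.
Variable F : klinfunctor C C'.
Hypothesis FW : forall X Y (f : mor C X Y), W f -> W' (fhom F f).

Fixpoint loc_map (X Y : C) (e : loc_hom W X Y) : loc_hom W' (F X) (F Y) :=
  match e with
  | Loc _ _ f => Loc W' (fhom F f)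
  | LocInv _ _ w Ww => LocInv (FW Ww)
  | LocComp _ _ _ g f => LocComp (loc_map g) (loc_map f)
  | LocAdd _ _ f g => LocAdd (loc_map f) (loc_map g)
  | LocScale _ _ c f => LocScale c (loc_map f)
  end.

Local Notation D := (localization W).
Local Notation D' := (localization W').

Lemma loc_map_loc_eq X Y (e e' : loc_hom W X Y) : loc_eq e e' -> loc_eq (loc_map e) (loc_map e').
Proof.
have Fid X0 : loc_eq (Loc W' (fhom F (hid X0))) (Loc W' (hid (F X0))).
  exact/loc_map_eq/fhom_id.
have F0 X0 Y0 : loc_eq (Loc W' (fhom F (hzero X0 Y0))) (Loc W' (hzero (F X0) (F Y0))).
  exact/loc_map_eq/fhom0.
elim=> {X Y e e'} /=; try by [constructor].
- by move=> X Y f g h _ fg _; exact: loc_trans.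
- move=> X Y f; apply: loc_trans (loc_comp (Fid Y) (loc_refl _)) _; exact: loc_comp1f.
- move=> X Y f; apply: loc_trans (loc_comp (loc_refl _) (Fid X)) _; exact: loc_compf1.
- move=> X Y f; apply: loc_trans (loc_add (F0 X Y) (loc_refl _)) _; exact: loc_add0f.
- move=> X Y f; apply: loc_trans (loc_sym (F0 X Y)); exact: loc_scale0f.
- by move=> X Y f g fg; apply/loc_map_eq/fhom_eq.
- move=> X Y Z g f; apply: loc_trans (loc_map_eq _ (fhom_comp F g f)) _; exact: loc_map_comp.
- move=> X Y f g; apply: loc_trans (loc_map_eq _ (fhom_add F f g)) _; exact: loc_map_add.
- move=> X Y c f; apply: loc_trans (loc_map_eq _ (fhom_scale F c f)) _; exact: loc_map_scale.
- by move=> X Y w Ww; exact: loc_trans (loc_invl (FW Ww)) (loc_sym (Fid X)).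
- by move=> X Y w Ww; exact: loc_trans (loc_invr (FW Ww)) (loc_sym (Fid Y)).
Qed.

Definition loc_functor : klinfunctor D D'.
Proof.
refine (@KLinFunctor k D D' F (fun X Y (e : mor D X Y) => loc_map e) _ _ _ _ _).
- by move=> X Y e e'; exact: loc_map_loc_eq.
- by move=> X; exact/loc_map_eq/fhom_id.
- by move=> X Y Z g f; exact: loc_refl.
- by move=> X Y f g; exact: loc_refl.
- by move=> X Y c f; exact: loc_refl.
Defined.

End Functor.

(** Naturality on the maps of C spreads to all terms; at a formal inverse it follows by cancelling
    the image of the inverted map. *)
Lemma loc_natural (E : klincat k) (F G : klinfunctor (localization W) E)
    (t : forall X : C, mor E (F X) (G X)) :
  (forall X Y (f : mor C X Y), t Y ∘ fhom F (Loc W f : mor (localization W) X Y) ≡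
     fhom G (Loc W f : mor (localization W) X Y) ∘ t X) ->
  forall (X Y : localization W) (e : mor (localization W) X Y),
    t Y ∘ fhom F e ≡ fhom G e ∘ t X.
Proof.
move=> nat X Y; elim=> {X Y} [X Y f|X Y w Ww|X Y Z g IHg f IHf|X Y f IHf g IHg|X Y c f IHf].
- exact: nat.
- set l : mor (localization W) X Y := Loc W w; set l' : mor (localization W) Y X := LocInv Ww.
  have ll' : l ∘ l' ≡ hid _ := loc_invr Ww.
  have l'l : l' ∘ l ≡ hid _ := loc_invl Ww.
  apply: (@iso_cancel_l _ _ _ _ _ (fhom G l)).
    by apply: fhom_iso; exists l'.
  rewrite !hcompA -nat -!hcompA -fhom_comp ll' !fhom_id hcompf1.
  by rewrite hcompA -fhom_comp ll' fhom_id hcomp1f.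
- rewrite (fhom_comp F (g : mor (localization W) Y Z) (f : mor (localization W) X Y)).
  rewrite (fhom_comp G (g : mor (localization W) Y Z) (f : mor (localization W) X Y)).
  by rewrite hcompA IHg -hcompA IHf hcompA.
- rewrite (fhom_add F (f : mor (localization W) X Y) (g : mor (localization W) X Y)).
  rewrite (fhom_add G (f : mor (localization W) X Y) (g : mor (localization W) X Y)).
  by rewrite hcompDr hcompDl IHf IHg.
- rewrite (fhom_scale F c (f : mor (localization W) X Y)).
  rewrite (fhom_scale G c (f : mor (localization W) X Y)).
  by rewrite hcompZr hcompZl IHf.
Qed.

End LocalizationFunctors.

(** A cone of a general morphism is thus obtained from one of the numerator of a left fraction. *)
Lemma cone_triangle_iso (k : fieldType) (C : klincat k) (S : klinfunctor C C) (X Y Y' Z : C)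
    (e : mor C X Y) (t : mor C Y Y') (f : mor C X Y') (g : mor C Y' Z) (h : mor C Z (S X)) :
  is_iso t -> t ∘ e ≡ f -> cone_triangle f g h -> cone_triangle e (g ∘ t) h.
Proof.
move=> t_iso te [gf fh exZ exS]; split.
- by rewrite -hcompA te.
- apply: (iso_cancel_l (fhom_iso S t_iso)).
  by rewrite hcompA -fhom_comp te fh hcompf0.
- move=> V u ugt; apply: exZ; apply: (iso_cancel_r t_iso).
  by rewrite -hcompA ugt hcomp0f.
- move=> V u /exS[v vE]; exists (v ∘ fhom S t).
  by rewrite -hcompA -fhom_comp te.
Qed.

Section DerivedCategory.
Variables (k : fieldType) (A : dgcat k).
Local Notation C := (dgmod_cat A).
Local Notation D := (derived_cat A).
Local Notation calc := (derived_left_calculus A).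
Local Notation loc f := (Loc (@quasi_iso k A) f : mor D _ _).

Definition derived_shift : klinfunctor D D :=
  @loc_functor k C C _ _ (dgshift_functor A) (@qis_shift k A).

Definition derived_unshift : klinfunctor D D :=
  @loc_functor k C C _ _ (dgunshift_functor A) (@qis_unshift k A).

Lemma loc_of_iso (X Y : C) (f : mor C X Y) (g : mor C Y X) :
  f ∘ g ≡ hid _ -> g ∘ f ≡ hid _ -> is_iso (loc f).
Proof.
move=> fg gf; exists (loc g); split; rewrite -(loc_compE (@quasi_iso k A)).
  exact: (loc_map_eq _ gf).
exact: (loc_map_eq _ fg).
Qed.

Lemma derived_shift_equivalence : is_equivalence derived_shift.
Proof.
exists derived_unshift; split.
  exists (fun X => loc (shift_unit X : mor C X (dgunshift (dgshift X)))); split=> [X|X Y f].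
    apply: (@loc_of_iso X _ _ (shift_unit_inv X)) => x i u /=; exact: mcastK.
  apply: (@loc_natural k C _ D (id_functor D) (comp_functor derived_unshift derived_shift)
    (fun X => loc (shift_unit X : mor C X (dgunshift (dgshift X))))) => {}X {}Y {}f.
  apply: loc_trans (loc_sym (loc_map_comp _ _ _)) _; apply: loc_trans (loc_map_comp _ _ _).
  by apply: loc_map_eq => x i u /=; rewrite mfun_cast.
exists (fun X => loc (shift_counit X : mor C (dgshift (dgunshift X)) X)); split=> [X|X Y f].
  apply: (@loc_of_iso _ X _ (shift_counit_inv X)) => x i u /=; exact: mcastK.
apply: (@loc_natural k C _ D (comp_functor derived_shift derived_unshift) (id_functor D)
  (fun X => loc (shift_counit X : mor C (dgshift (dgunshift X)) X))) => {}X {}Y {}f.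
apply: loc_trans (loc_sym (loc_map_comp _ _ _)) _; apply: loc_trans (loc_map_comp _ _ _).
by apply: loc_map_eq => x i u /=; rewrite mfun_cast.
Qed.

(** After enlarging V along a quasi-isomorphism, a vanishing in the derived category becomes a
    null-homotopy of dg modules, the input of the exactness of cones. *)
Lemma derived_kill (X Y V : C) (f : mor C X Y) (u : mor D Y V) :
  u ∘ loc f ≡ hzero (X : D) V -> exists (V' : C) (t : mor C V V') (b : mor C Y V'),
    [/\ is_iso (loc t), loc t ∘ u ≡ loc b & homotopic (b ∘ f : mor C X V') (dgmod_zero X V')].
Proof.
move=> uf0; have [V1 [t [b [Wt tu]]]] := left_fraction calc u.
have [|V2 [t' [Wt' E]]] := @loc_eq_frac _ _ _ _ calc X V1 (b ∘ f) (hzero X V1).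
  by rewrite loc_compE -tu -hcompA uf0 hcompf0.
exists V2, (t' ∘ t), (t' ∘ b); split.
- exact/(loc_iso (calc_comp calc Wt' Wt)).
- by rewrite !loc_compE -hcompA tu.
- apply: homotopic_trans (homotopic_heq (heq_sym (hcompA t' b f))) _.
  apply: homotopic_trans E _; apply: homotopic_heq; exact: hcompf0.
Qed.

Lemma derived_has_cones : has_cones derived_shift.
Proof.
move=> X Y e; have [Y' [t [f [Wt te]]]] := left_fraction calc e.
exists (dgcone f : C), (loc (cone_in f : mor C Y' (dgcone f)) ∘ loc t).
exists (loc (cone_out f : mor C (dgcone f) (dgshift X))).
apply: (cone_triangle_iso (loc_iso Wt) te); split.
- by rewrite -loc_compE; exact: (homotopic_loc (cone_in_comp f)).
- apply: heq_trans (heq_sym (loc_compE _ (dgshift_hom f : mor C (dgshift X) (dgshift Y')) _)) _.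
  exact: (homotopic_loc (shift_comp_cone_out f)).
- move=> V u /derived_kill[V' [s [b [s_iso su bg]]]].
  have [v vE] := cone_exact_in bg; have [s' _ [s's _]] := iso_inv s_iso.
  exists (s' ∘ loc (v : mor C (dgshift X) V')).
  rewrite -hcompA -loc_compE -(homotopic_loc vE : loc b ≡ loc _) -su.
  by rewrite hcompA s's hcomp1f.
- move=> V u /derived_kill[V' [s [b [s_iso su bg]]]].
  have [v vE] := cone_exact_out bg; have [s' _ [s's _]] := iso_inv s_iso.
  exists (s' ∘ loc (v : mor C (dgshift Y') V')).
  rewrite -hcompA.
  have -> : loc (v : mor C (dgshift Y') V') ∘ fhom derived_shift (loc f) ≡ loc b.
    apply: heq_trans (heq_sym (loc_compE _ (v : mor C (dgshift Y') V') _)) _.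
    exact/heq_sym/(homotopic_loc vE).
  by rewrite -su hcompA s's hcomp1f.
Qed.

Lemma compact_derived_weakly_triangulated : weakly_triangulated (compact_derived_cat A).
Proof. exact: compact_weakly_triangulated derived_shift_equivalence derived_has_cones. Qed.

End DerivedCategory.

Theorem proposition9p9 (k : closedFieldType) (m n : nat)
    (m_ge1 : (1 <= m)%N) (n_gt1 : (1 < n)%N) (m_dvd_n : (m %| n)%N)
    (L : algType k) (nakL : is_nakayama m n L) :
  (forall K I : bimodule L,
      is_syzygy 3 (regular_bimodule L) K -> invertible_bimodule I ->
      ~ stably_isomorphic K I) /\
  ~ triangulable (proj_cat L) /\
  ~ enhanceable (proj_cat L).
Proof.
have [pi [piZ pi_surj pi_ker]] := nakL.
have rad := nakayama_radical piZ pi_surj pi_ker.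
have basis := nakayama_basis piZ pi_surj pi_ker.
have not_tri := proj_not_weakly_triangulated rad n_gt1.
split; last split.
- by move=> K I; exact: (third_syzygy_not_invertible rad n_gt1 basis).
- by move=> [t]; apply: not_tri; exact: triangulation_weakly_triangulated t.
- move=> [B eqB]; apply: not_tri; apply: equivalent_weakly_triangulated eqB _.
  exact: compact_derived_weakly_triangulated.
Qed.
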